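(* Consider either of the two models (a) logistic regression, $p(z)=\frac{1}{1+e^{-\beta z}}$, or (b) probit regression, $p(z)=\frac1{\sqrt{2\pi}}\int_{-\infty}^{\beta z}e^{-u^2/2}\,du$, with parameter $\beta>0$. For each of the two models there exist absolute constants $b_1,b_2>0$ and $C,r>0$ (possibly different for the two models) such that the following holds for all positive integers $d,k,n$ with $k\le d$, all $\epsilon,\rho\in(0,1)$, all $\beta>0$, and all $\theta^*\in\Theta$. Let $L=\log\left(\frac{e\,d}{\epsilon\,\rho\,\min\{\beta,1\}}\right)$ and $$\Phi=\begin{cases}\dfrac{k}{\beta^2\epsilon^2}, & \beta\in(0,b_1),\\[2mm] \dfrac{k}{\beta\epsilon^2}, & \beta\in[b_1,\tfrac{b_2}{\epsilon}),\\[2mm] \dfrac{k}{\epsilon}, & \beta\in[\tfrac{b_2}{\epsilon},\infty).\end{cases}$$ If $n\ge C\,\Phi\,L^{r}$, then, with probability at least $1-\rho$, the sequence $(\hat\theta^{(t)})_{t\ge0}$ produced by normalized BIHT (see context) from the covariate matrix $X$ and responses $y=f(X\theta^* )$ satisfies $$\|\theta^*-\hat\theta^{(t)}\|_2\le 2^{2^{-t}}\,\epsilon^{1-2^{-t}}\quad\text{for every integer }t\ge0,\qquad\text{and}\qquad \limsup_{t\to\infty}\|\theta^*-\hat\theta^{(t)}\|_2\le\epsilon .$$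
   Context: Parameter space: $\Theta=\{v\in\mathbb R^d:\|v\|_2=1,\ \|v\|_0\le k\}$, where $\|v\|_0$ is the number of nonzero entries of $v$. Model: the covariates $x_1,\dots,x_n\sim\mathcal N(0,I_d)$ are i.i.d. and $X\in\mathbb R^{n\times d}$ is the matrix with rows $x_1^T,\dots,x_n^T$. For $p:\mathbb R\to[0,1]$, $f$ is the random function with $f(z)=1$ with probability $p(z)$ and $f(z)=-1$ with probability $1-p(z)$; it is applied to vectors entrywise, independently across entries. The responses $y=f(X\theta^* )\in\{-1,1\}^n$ are sampled once. $\operatorname{sign}(a)=1$ if $a\ge0$ and $-1$ otherwise, applied to vectors entrywise. $\log$ is the natural logarithm. Top-$k$ thresholding: $T_k(v)$ keeps the $k$ largest-magnitude entries of $v$ and sets the other entries to $0$ (ties broken arbitrarily). Normalized BIHT: draw $\hat\theta^{(0)}$ uniformly from $\Theta$; for $t=1,2,3,\dots$ set $$\tilde\theta^{(t)}=\hat\theta^{(t-1)}+\frac{\sqrt{2\pi}}{n}X^T\,\tfrac12\left(y-\operatorname{sign}(X\hat\theta^{(t-1)})\right),\qquad \hat\theta^{(t)}=\frac{T_k(\tilde\theta^{(t)})}{\|T_k(\tilde\theta^{(t)})\|_2}.$$ Probability is over $X$, the randomness of $f$, and the initialization. *)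

(* Defs.v *)
From HB Require Import structures.
From mathcomp Require Import all_boot all_order all_algebra.
From mathcomp Require Import all_classical all_reals all_analysis.
Set Implicit Arguments.
Unset Strict Implicit.
Unset Printing Implicit Defensive.
Import Order.TTheory GRing.Theory Num.Theory.
Import numFieldNormedType.Exports.
Local Open Scope classical_set_scope.
Local Open Scope ring_scope.

Section SparseVectors.
Context {R : realType}.

(* The library norm on matrices is the sup norm, hence an explicit l2 norm. *)
Definition l2norm {d : nat} (v : 'cV[R]_d) : R :=
  Num.sqrt (\sum_(i < d) v i 0 ^+ 2).

Definition l0norm {d : nat} (v : 'cV[R]_d) : nat :=
  #|[set i : 'I_d | v i 0 != 0]%SET|.

Definition Theta (d k : nat) : set 'cV[R]_d :=
  [set v | l2norm v = 1 /\ (l0norm v <= k)%N].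

Definition restrict {d : nat} (S : {set 'I_d}) (v : 'cV[R]_d) : 'cV[R]_d :=
  \col_i (if i \in S then v i 0 else 0).

(* Division being total, normalize 0 = 0. *)
Definition normalize {d : nat} (v : 'cV[R]_d) : 'cV[R]_d :=
  (l2norm v)^-1 *: v.

(* w is a possible value of T_k(v), for some way of breaking ties. *)
Definition is_top_k {d : nat} (k : nat) (v w : 'cV[R]_d) : Prop :=
  exists S : {set 'I_d}, [/\ #|S| = k,
    forall i j, i \in S -> j \notin S -> `|v j 0| <= `|v i 0|
    & w = restrict S v].

End SparseVectors.

Section BIHT.
Context {R : realType}.

Definition sign (a : R) : R := if 0 <= a then 1 else -1.

Definition biht_update {n d : nat} (X : 'M[R]_(n, d)) (y : 'cV[R]_n)
    (theta : 'cV[R]_d) : 'cV[R]_d :=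
  theta + (Num.sqrt (2 * pi) / n%:R) *:
            (X^T *m (2^-1 *: (y - map_mx sign (X *m theta)))).

(* A relation rather than a function of the starting point: ties in the
   thresholding may be broken differently at each iteration. *)
Definition biht_run {n d : nat} (k : nat) (X : 'M[R]_(n, d)) (y : 'cV[R]_n)
    (theta0 : 'cV[R]_d) (theta : nat -> 'cV[R]_d) : Prop :=
  theta 0%N = theta0 /\
  forall t : nat, exists2 w : 'cV[R]_d,
    is_top_k k (biht_update X y (theta t)) w & theta t.+1 = normalize w.

End BIHT.

Section Models.
Context {R : realType}.

Inductive glm : Type := Logistic | Probit.

Definition prob_one (model : glm) (beta z : R) : R :=
  match model with
  | Logistic => (1 + expR (- (beta * z)))^-1
  | Probit => (Num.sqrt (2 * pi))^-1 *
      \int[lebesgue_measure]_(u in `]-oo, beta * z]) expR (- (u ^+ 2 / 2))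
  end.

(* P(f(z) = s) for s = 1 or s = -1. *)
Definition resp_prob (p : R -> R) (z s : R) : R :=
  if s == 1 then p z else 1 - p z.

Definition Phi (b1 b2 : R) (k : nat) (beta eps : R) : R :=
  if beta < b1 then k%:R / (beta ^+ 2 * eps ^+ 2)
  else if beta < b2 / eps then k%:R / (beta * eps ^+ 2)
  else k%:R / eps.

Definition logfactor (d : nat) (beta eps rho : R) : R :=
  ln (expR 1 * d%:R / (eps * rho * Num.min beta 1)).

End Models.

Section Randomness.
Context {R : realType}.

Definition borel_mx (m n : nat) : set (set 'M[R]_(m, n)) := <<s open >>.

(* Expectation of F(g) for a standard Gaussian vector g in R^d, as an iterated
   integral over the coordinates. *)
Fixpoint gauss_int (d : nat) : ('cV[R]_d -> \bar R) -> \bar R :=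
  match d with
  | 0 => fun F => F 0
  | d'.+1 => fun F =>
      (\int[normal_prob (0 : R) 1]_x
         gauss_int (fun v : 'cV[R]_d' => F (col_mx (x%:M : 'cV[R]_1) v)))%E
  end.

(* Theta is the union of the unit spheres of the C(d,k) coordinate subspaces
   of dimension k, which overlap in null sets only: the uniform law picks one
   of them uniformly, then a uniform point g/|g| on it, g being Gaussian. *)
Definition unif_Theta (d k : nat) (A : set 'cV[R]_d) : \bar R :=
  (('C(d, k)%:R^-1)%:E *
   \sum_(S : {set 'I_d} | #|S| == k)
     gauss_int (fun v => (\1_A (normalize (restrict S v)))%:E))%E.

Context {disp : measure_display} {Omega : measurableType disp}.

Definition random_mx {m n : nat} (W : Omega -> 'M[R]_(m, n)) : Prop :=
  forall B, borel_mx B -> measurable (W @^-1` B).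

(* Taking all but one of the A i j equal to setT gives the N(0,1) marginals;
   the product rule is then the independence of the entries. *)
Definition iid_gaussian_mx (P : probability Omega R) {n d : nat}
    (X : Omega -> 'M[R]_(n, d)) : Prop :=
  random_mx X /\
  forall A : 'I_n -> 'I_d -> set R, (forall i j, measurable (A i j)) ->
    P [set w | forall i j, A i j (X w i j)] =
    (\prod_(i < n) \prod_(j < d) normal_prob (0 : R) 1 (A i j))%E.

(* y = f(X theta): conditionally on X, the entries of y are independent and
   y i = 1 with probability p((X theta) i), y i = -1 otherwise. *)
Definition glm_response (P : probability Omega R) (p : R -> R) {n d : nat}
    (theta : 'cV[R]_d) (X : Omega -> 'M[R]_(n, d)) (y : Omega -> 'cV[R]_n)
    : Prop :=
  [/\ random_mx y,
      forall w i, y w i 0 = 1 \/ y w i 0 = -1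
    & forall (B : set 'M[R]_(n, d)) (s : 'cV[R]_n),
      borel_mx B -> (forall i, s i 0 = 1 \/ s i 0 = -1) ->
      P (X @^-1` B `&` y @^-1` [set s]) =
      (\int[P]_(w in X @^-1` B)
         (\prod_(i < n) resp_prob p ((X w *m theta) i 0) (s i 0))%:E)%E].

(* theta0 is uniform on Theta and independent of (X, y). *)
Definition uniform_init (P : probability Omega R) {n d : nat} (k : nat)
    (X : Omega -> 'M[R]_(n, d)) (y : Omega -> 'cV[R]_n)
    (theta0 : Omega -> 'cV[R]_d) : Prop :=
  [/\ random_mx theta0,
      forall w, Theta k (theta0 w),
      forall A, borel_mx A -> P (theta0 @^-1` A) = unif_Theta k A
    & forall B D A, borel_mx B -> borel_mx D -> borel_mx A ->
      P (X @^-1` B `&` y @^-1` D `&` theta0 @^-1` A) =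
      (P (X @^-1` B `&` y @^-1` D) * P (theta0 @^-1` A))%E].

End Randomness.

(* Main.v *)
Require Import Defs.
From HB Require Import structures.
From mathcomp Require Import all_boot all_order all_algebra.
From mathcomp Require Import all_classical all_reals all_analysis.
From mathcomp Require Import measurable_realfun ring lra zify.
Import Order.TTheory GRing.Theory Num.Theory.
Import numFieldNormedType.Exports.
Set Implicit Arguments.
Unset Strict Implicit.
Unset Printing Implicit Defensive.
Local Open Scope classical_set_scope.
Local Open Scope ring_scope.

(** The event of good behaviour concerns only X and y, and it is uniform in the
    starting point, so the law of the initialization plays no role.

    One iteration.  The mean of the update at v is g theta*, with
    g = sqrt(2 pi) / 2 E[z (2 p(z) - 1)] >= min(beta, 1) / 10.  If the inner
    product of the update minus g theta* with every 2k-sparse unit vector is at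
    most D, thresholding and normalizing give an error at most 4 D / g.  It is
    enough to have D = (g / 4) sqrt(eps max(eps, |theta* - v|)), since the bounds
    e_t = 2^(2^-t) eps^(1 - 2^-t) satisfy e_(t+1) = sqrt(eps e_t).

    Concentration.  On a finite net of sparse unit vectors u, v, a row
    contributes W = <u, x> (y - sign<v, x>) / 2, which vanishes unless the sign
    is wrong.  A wrong sign has probability q = O~(min(1, |theta* - v| + 1 / beta)),
    which bounds the variance of W; a Chernoff bound then gives the three regimes
    of Phi.  Off the net, the signs change only on rows for which |<v, x>| is
    tiny, whose total contribution is controlled by a second Chernoff bound. *)

(** All iterations reuse the same rows, so v depends on X and concentration must hold for every
    sparse v at once; this is why the net is used for both u and v. The obstacle is that [sign] is
    discontinuous: a row can change its contribution by |<u, x>| however close v is to the net, so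
    such rows are counted separately.

    The form of D makes one sample size serve all scales. With m = max(eps, |theta* - v|), D^2 is
    proportional to g^2 eps m, and the variance is bounded, up to logarithms, by min(1, 1 / beta +
    m). Their ratio is of order at most 1 / (g^2 eps^2) since m >= eps and, for beta >= 1, where g
    is bounded below, at most 1 / (beta eps^2) + 1 / eps. The thresholds 1 and 1 / eps on beta are
    where the dominating term changes.

    The fourth power of L splits as follows: W has an unbounded Gaussian factor, cut at a level of
    order L, which costs L^2; the same cut in the probability of a wrong sign costs one L; the
    entropy of the net, of order k L, costs the last one. *)

(** * Integration against a density, translation invariance of Lebesgue measure *)

Section Density.
Local Open Scope ereal_scope.
Context d (T : measurableType d) (R : realType).
Variables (mu nu : {measure set T -> \bar R}) (p : T -> R).
Hypotheses (mp : measurable_fun setT p) (p0 : forall x, (0 <= p x)%R).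
Hypothesis nuE : forall A, measurable A -> nu A = \int[mu]_(x in A) (p x)%:E.

Import HBNNSimple.

Let integral_density_nnsfun (f : {nnsfun T >-> R}) :
  \int[nu]_x (f x)%:E = \int[mu]_x ((f x)%:E * (p x)%:E).
Proof.
under [LHS]eq_integral do rewrite fimfunE -fsumEFin//.
rewrite [LHS]ge0_integral_fsum//; last 2 first.
  - by move=> r; exact/measurable_EFinP/measurableT_comp.
  - by move=> n x _; rewrite EFinM nnfun_muleindic_ge0.
under [RHS]eq_integral.
  move=> x xD; rewrite fimfunE -fsumEFin// ge0_mule_fsuml; last first.
    by move=> r; rewrite EFinM nnfun_muleindic_ge0.
  over.
rewrite [RHS]ge0_integral_fsum//; last 2 first.
  - move=> r; apply: emeasurable_funM => //.
    by apply/measurable_EFinP; do 2 apply/measurableT_comp => //.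
    exact/measurable_EFinP.
  - by move=> n x _; rewrite mule_ge0 ?lee_fin// -lee_fin nnfun_muleindic_ge0.
apply: eq_fsbigr => r _.
rewrite integralZl_indic_nnsfun// integral_indic// setIT nuE//.
have [r0|r0] := ltP r 0%R.
  rewrite preimage_nnfun0// integral_set0 mule0; apply/esym.
  by apply: integral0_eq => x _; rewrite indicE in_set0 mulr0 mul0e.
under [RHS]eq_integral do rewrite EFinM -muleA.
rewrite ge0_integralZl//; last 2 first.
  - by apply: emeasurable_funM; apply/measurable_EFinP => //; exact: measurable_indic.
  - by move=> x _; rewrite mule_ge0// lee_fin.
congr (_ * _); rewrite integral_mkcond; apply: eq_integral => x _.
by rewrite patchE indicE; case: ifP => _; rewrite ?mul1e ?mul0e.
Qed.

Lemma ge0_integral_density (f : T -> \bar R) :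
  measurable_fun setT f -> (forall x, 0 <= f x) ->
  \int[nu]_x f x = \int[mu]_x (f x * (p x)%:E).
Proof.
move=> mf f0.
pose f_ := nnsfun_approx measurableT mf.
transitivity (lim (\int[nu]_x (f_ n x)%:E @[n --> \oo])%E).
  rewrite -monotone_convergence//=.
  - apply: eq_integral => ? /[!inE] xD; apply/esym/cvg_lim => //=.
    exact: cvg_nnsfun_approx.
  - by move=> n; exact/measurable_EFinP/measurable_funTS.
  - by move=> n ? _; rewrite lee_fin.
  - by move=> ? _ ? ? mn; rewrite lee_fin; exact/lefP/nd_nnsfun_approx.
transitivity (lim (\int[mu]_x ((f_ n x)%:E * (p x)%:E) @[n --> \oo])%E).
  by apply: congr_lim; apply/funext => n /=; exact: integral_density_nnsfun.
rewrite -monotone_convergence//=.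
- apply: eq_integral => x _; apply/cvg_lim => //=.
  have := @cvg_nnsfun_approx _ _ _ _ measurableT _ mf (fun x _ => f0 x) x I.
  by move=> cf; under eq_fun do rewrite muleC; rewrite muleC; exact: cvgeZl.
- by move=> n; apply: emeasurable_funM => //; exact/measurable_EFinP.
- by move=> n x _; rewrite mule_ge0// lee_fin.
- move=> x _ a b ab; rewrite lee_pmul ?lee_fin//.
  exact/lefP/nd_nnsfun_approx.
Qed.

End Density.

Section TranslationInvariance.
Local Open Scope ereal_scope.
Context {R : realType}.
Notation leb := (@lebesgue_measure R).
Notation mR := (measurableTypeR R).

Let shift (c : R) (x : measurableTypeR R) : measurableTypeR R := (x + c)%R.

Let measurable_shift c : measurable_fun setT (shift c).
Proof. by apply: measurable_funD. Qed.

Lemma lebesgue_measure_shift (c : R) A : measurable A ->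
  pushforward leb (shift c) A = leb A.
Proof.
move=> mA; apply/esym/(lebesgue_measure_unique (mu := pushforward leb (shift c))) => //= _ [[a b]] _ <-.
rewrite /pushforward.
have -> : shift c @^-1` `]a, b]%classic = `](a - c)%R, (b - c)%R]%classic.
  by apply/seteqP; split => x /=; rewrite !in_itv/= /shift => /andP[? ?]; apply/andP; split; lra.
rewrite !lebesgue_measure_itv/= !lte_fin ltrD2r.
by case: ifP => // _; rewrite -!EFinB opprD addrACA subrr addr0.
Qed.

Lemma ge0_integral_shift (c : R) (f : R -> \bar R) :
  measurable_fun setT f -> (forall x, 0 <= f x) ->
  \int[leb]_x f (x + c)%R = \int[leb]_x f x.
Proof.
move=> mf f0.
have -> : \int[leb]_x f x = \int[pushforward leb (shift c)]_x f x.
  by apply: eq_measure_integral => A mA _; exact/esym/lebesgue_measure_shift.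
by rewrite ge0_integral_pushforward.
Qed.

End TranslationInvariance.

(** * The standard normal law and its invariance under rotations *)

Section StandardNormal.
Local Open Scope ereal_scope.
Context {R : realType}.
Notation leb := (@lebesgue_measure R).
Notation mR := (measurableTypeR R).

Definition stdn : probability (measurableTypeR R) R := normal_prob (0%R : R) 1%R.
Definition phi (x : R) : R := normal_pdf 0 1 x.

Lemma phiE x : phi x = ((Num.sqrt (2 * pi))^-1 * expR (- (x ^+ 2 / 2)))%R.
Proof.
rewrite /phi normal_pdfE ?oner_neq0// /normal_peak /normal_fun subr0 expr1n mul1r.
by rewrite -mulr_natl mulNr.
Qed.

Lemma phi_ge0 x : (0 <= phi x)%R.
Proof. exact: normal_pdf_ge0. Qed.

Lemma measurable_phi : measurable_fun setT phi.
Proof. exact: measurable_normal_pdf. Qed.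

Lemma integral_stdn (f : R -> \bar R) :
  measurable_fun setT f -> (forall x, 0 <= f x) ->
  \int[stdn]_x f x = \int[leb]_x (f x * (phi x)%:E).
Proof.
move=> mf f0; apply: ge0_integral_density => //; [|exact: phi_ge0].
exact: measurable_phi.
Qed.

Definition rot2 (c s : R) (z : mR * mR) : mR * mR :=
  (c * z.1 - s * z.2, s * z.1 + c * z.2)%R.

Let shear1 (F : mR * mR -> \bar R) t : measurable_fun setT F -> (forall x, 0 <= F x) ->
  \int[leb]_x \int[leb]_y F (x - t * y, y)%R = \int[leb]_x \int[leb]_y F (x, y).
Proof.
move=> mF F0.
have mG : measurable_fun setT (fun z : mR * mR => F (z.1 - t * z.2, z.2)%R).
  apply: (measurableT_comp mF); apply: measurable_fun_pair => //=.
  by apply: measurable_funB => //; apply: measurable_funM.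
(* Tonelli makes y the outer variable; at fixed y the shear is a translation of x. *)
apply: etrans (fubini_tonelli (m1 := leb) (m2 := leb) _ mG (fun z => F0 _)) _.
apply: etrans (esym (fubini_tonelli (m1 := leb) (m2 := leb) F mF F0)).
apply: eq_integral => y _.
apply: (@ge0_integral_shift R (- (t * y)) (fun x => F (x, y))) => //.
exact: measurableT_comp.
Qed.

Let shear2 (F : mR * mR -> \bar R) t : measurable_fun setT F -> (forall x, 0 <= F x) ->
  \int[leb]_x \int[leb]_y F (x, y + t * x)%R = \int[leb]_x \int[leb]_y F (x, y).
Proof.
move=> mF F0; apply: eq_integral => x _.
apply: (@ge0_integral_shift R (t * x) (fun y => F (x, y))) => //.
exact: measurableT_comp.
Qed.

Let measurable_rot c s : measurable_fun setT (rot2 c s).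
Proof.
by apply: measurable_fun_pair => /=; [apply: measurable_funB|apply: measurable_funD];
  apply: measurable_funM.
Qed.

(* A rotation is a product of three shears, each of which preserves Lebesgue measure. *)
Let lebesgue_rot (F : mR * mR -> \bar R) c s :
  (c ^+ 2 + s ^+ 2 = 1)%R -> (0 <= c)%R ->
  measurable_fun setT F -> (forall x, 0 <= F x) ->
  \int[leb]_x \int[leb]_y F (rot2 c s (x, y)) = \int[leb]_x \int[leb]_y F (x, y).
Proof.
(* [t] is the tangent of half the angle; [0 <= c] keeps the denominator away from 0. *)
move=> cs c0 mF F0; pose t := (s / (1 + c))%R.
have c1 : (1 + c != 0)%R by lra.
have ts : (1 - t * s = c)%R.
  have -> : (t * s = s ^+ 2 / (1 + c))%R by rewrite /t; field.
  have -> : (s ^+ 2 = (1 + c) * (1 - c))%R by move: cs => /(canRL (addKr _)) ->; ring.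
  by field.
have t2 : (t * (1 + c) = s)%R by rewrite /t; field.
pose F1 (z : mR * mR) := F (z.1 - t * z.2, z.2)%R.
have mF1 : measurable_fun setT F1.
  apply: (measurableT_comp mF); apply: measurable_fun_pair => //=.
  by apply: measurable_funB => //; apply: measurable_funM.
pose F2 (z : mR * mR) := F1 (z.1, z.2 + s * z.1)%R.
have mF2 : measurable_fun setT F2.
  apply: (measurableT_comp mF1); apply: measurable_fun_pair => //=.
  by apply: measurable_funD => //; apply: measurable_funM.
have s2 : (t * (2 - t * s) = s)%R by rewrite -[RHS]t2 -ts; ring.
have F10 z : 0 <= F1 z by exact: F0.
have F20 z : 0 <= F2 z by exact: F0.
apply: etrans (etrans (shear1 t mF2 F20) (etrans (shear2 s mF1 F10) (shear1 t mF F0))).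
apply: eq_integral => x _; apply: eq_integral => y _.
rewrite /F2 /F1 /= /rot2/=; congr F; congr pair.
- by transitivity ((1 - t * s) * x - t * (2 - t * s) * y)%R; [rewrite ts s2|ring].
- by rewrite -[in LHS]ts; ring.
Qed.

Lemma stdn2 (F : mR * mR -> \bar R) :
  measurable_fun setT F -> (forall x, 0 <= F x) ->
  \int[stdn]_x \int[stdn]_y F (x, y) =
  \int[leb]_x \int[leb]_y (F (x, y) * (phi x * phi y)%:E).
Proof.
move=> mF F0; rewrite integral_stdn//; last 2 first.
- by apply: (measurable_fun_fubini_tonelli_F F).
- by move=> x; apply: integral_ge0.
apply: eq_integral => x _; rewrite integral_stdn//; last exact: measurableT_comp.
rewrite -ge0_integralZr//=.
- by apply: eq_integral => y _; rewrite EFinM -muleA [(phi y)%:E * _]muleC.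
- apply: emeasurable_funM; first exact: measurableT_comp.
  by apply/measurable_EFinP; exact: measurable_phi.
- by move=> y _; rewrite mule_ge0// lee_fin phi_ge0.
- by rewrite lee_fin phi_ge0.
Qed.

(** The product density depends on x^2 + y^2 only, so the invariance of Lebesgue measure carries
    over. The restriction [0 <= c] comes from the shears and is met by every rotation produced by
    [rot_coefs]. *)
Lemma stdn_rot (F : mR * mR -> \bar R) c s :
  (c ^+ 2 + s ^+ 2 = 1)%R -> (0 <= c)%R ->
  measurable_fun setT F -> (forall x, 0 <= F x) ->
  \int[stdn]_x \int[stdn]_y F (rot2 c s (x, y)) = \int[stdn]_x \int[stdn]_y F (x, y).
Proof.
move=> cs c0 mF F0.
have mFr := measurableT_comp mF (measurable_rot c s).
apply: etrans (stdn2 mFr (fun z => F0 _)) (etrans _ (esym (stdn2 mF F0))).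
pose G z := F z * (phi z.1 * phi z.2)%:E.
have mG : measurable_fun setT G.
  apply: emeasurable_funM => //; apply/measurable_EFinP/measurable_funM;
  by apply: measurableT_comp => //; exact: measurable_phi.
have G0 z : 0 <= G z by rewrite mule_ge0// lee_fin mulr_ge0// phi_ge0.
apply: etrans (lebesgue_rot cs c0 mG G0).
apply: eq_integral => x _; apply: eq_integral => y _.
congr (_ * _%:E); rewrite !phiE /rot2/= mulrACA [RHS]mulrACA -!expRD; congr (_ * expR _)%R.
rewrite -!opprD -!mulrDl; congr (- (_ / _))%R.
rewrite -[LHS]mul1r -cs; ring.
Qed.

End StandardNormal.

(** * Moments and exponential moments of a standard normal variable *)

Section NormalMoments.
Local Open Scope ereal_scope.
Context {R : realType}.
Notation leb := (@lebesgue_measure R).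
Notation mR := (measurableTypeR R).

Lemma measurable_bool_natr d (T : measurableType d) (b : T -> bool) :
  measurable_fun setT b -> measurable_fun setT (fun x => (b x)%:R : R).
Proof.
move=> mb; rewrite (_ : (fun x => _) = (fun x => if b x then 1%R else 0%R)).
  exact: measurable_fun_ifT.
by apply/funext => x; case: (b x).
Qed.

Lemma integral_phi : \int[leb]_x (phi x)%:E = 1%:E :> \bar R.
Proof. exact: (integral_normal_pdf (0%R : R) 1%R). Qed.

Lemma measurable_expRM (t : R) : measurable_fun setT (fun x : mR => expR (t * x)).
Proof. by apply: measurableT_comp => //; apply: measurable_funM. Qed.

Lemma measurable_expR_norm (t : R) : measurable_fun setT (fun x : mR => expR (t * `|x|)).
Proof.
by apply: measurableT_comp => //; apply: measurable_funM => //; apply: measurableT_comp.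
Qed.

Lemma stdn_expR (t : R) : \int[stdn]_x (expR (t * x))%:E = (expR (t ^+ 2 / 2))%:E.
Proof.
rewrite integral_stdn; last 2 first.
- by apply/measurable_EFinP; exact: measurable_expRM.
- by move=> x; rewrite lee_fin expR_ge0.
(* Completing the square: exp(t x) phi(x) = exp(t^2 / 2) phi(x - t). *)
transitivity (\int[leb]_x ((expR (t ^+ 2 / 2))%:E * (phi (x + - t))%:E)).
  apply: eq_integral => x _; rewrite -!EFinM !phiE; congr EFin.
  rewrite mulrCA [RHS]mulrCA -!expRD; congr (_ * expR _)%R.
  by field.
rewrite ge0_integralZl//; last 2 first.
- apply/measurable_EFinP; apply: (measurableT_comp (measurable_phi (R := R))).
  exact: measurable_funD.
- by move=> x _; rewrite lee_fin phi_ge0.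
rewrite (_ : \int[leb]_x _ = 1) ?mule1//.
apply: etrans (ge0_integral_shift (- t) (f := fun x => (phi x)%:E) _ _) integral_phi.
- by apply/measurable_EFinP; exact: measurable_phi.
- by move=> x; rewrite lee_fin phi_ge0.
Qed.

Lemma stdn_expR_norm_le (t : R) :
  \int[stdn]_x (expR (t * `|x|))%:E <= (2 * expR (t ^+ 2 / 2))%:E.
Proof.
have -> : (2 * expR (t ^+ 2 / 2))%:E =
    \int[stdn]_x ((expR (t * x))%:E + (expR (- t * x))%:E) :> \bar R.
  rewrite ge0_integralD//; last 2 first.
  - by apply/measurable_EFinP; exact: measurable_expRM.
  - by apply/measurable_EFinP; exact: measurable_expRM.
  by rewrite !stdn_expR -EFinD sqrrN; congr EFin; ring.
apply: ge0_le_integral => //.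
- by apply/measurable_EFinP; exact: measurable_expR_norm.
- by apply: emeasurable_funD; apply/measurable_EFinP; exact: measurable_expRM.
- move=> x _; rewrite -EFinD lee_fin; have [x0|x0] := leP 0%R x.
    by rewrite ger0_norm// lerDl expR_ge0.
  by rewrite ltr0_norm// mulrN mulNr lerDr expR_ge0.
Qed.

Lemma phi_le_half (x : R) : (phi x <= 2^-1)%R.
Proof.
rewrite phiE -[leRHS]mulr1 ler_pM// ?invr_ge0 ?sqrtr_ge0 ?expR_ge0//.
- rewrite lef_pV2 ?posrE ?sqrtr_gt0 ?mulr_gt0 ?pi_gt0//.
  rewrite (_ : 2 = Num.sqrt (2 ^+ 2))%R ?sqrtr_sqr ?ger0_norm// -[leLHS](@ger0_norm _ 2)// -sqrtr_sqr ler_sqrt; last by rewrite mulr_ge0 ?pi_ge0.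
  by have := @pi_ge2 R; nra.
- by rewrite -expR0 ler_expR oppr_le0 mulr_ge0 ?sqr_ge0.
Qed.

Lemma stdn_small_ball (r : R) : (0 <= r)%R ->
  \int[stdn]_x ((`|x| <= r)%R%:R)%:E <= r%:E.
Proof.
move=> r0; have mb : measurable_fun setT (fun x : mR => (`|x| <= r)%R%:R : R).
  by apply: measurable_bool_natr; apply: measurable_fun_ler => //; exact: measurableT_comp.
rewrite integral_stdn; last 2 first.
- exact/measurable_EFinP.
- by move=> x; rewrite lee_fin.
apply: (@le_trans _ _ (\int[leb]_(x in `[(- r)%R, r]) (2^-1%:E))).
  rewrite [leRHS]integral_mkcond; apply: ge0_le_integral => //.
  - by move=> x _; rewrite mule_ge0// lee_fin// phi_ge0.
  - apply: emeasurable_funM; first exact/measurable_EFinP.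
    by apply/measurable_EFinP; exact: measurable_phi.
  - by apply/(measurable_restrictT _ _).1 => //; exact: measurable_itv.
  - move=> x _; rewrite patchE mem_setE in_itv/= ler_norml.
    by case: ifP => _; rewrite ?mul0e// mul1e lee_fin phi_le_half.
rewrite integral_cst//= lebesgue_measure_itv/= lte_fin.
case: ifP => _; last by rewrite mule0 lee_fin.
by rewrite -EFinB -EFinM lee_fin; lra.
Qed.

Lemma continuous_phi : continuous (@phi R).
Proof. by apply: continuous_normal_pdf; exact: oner_neq0. Qed.

(** Moves the integral to the half line, where [|x|] is smooth and an explicit antiderivative can be
    used. *)
Lemma stdn_even (f : R -> R) : (forall x, 0 <= f x)%R -> continuous f ->
  (forall x, f (- x) = f x)%R ->
  \int[stdn]_x (f x)%:E = 2%:E * \int[leb]_(x in `[0%R, +oo[) (f x * phi x)%:E.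
Proof.
move=> f0 cf fe; rewrite integral_stdn; last 2 first.
- by apply/measurable_EFinP; exact: continuous_measurable_fun.
- by move=> x; rewrite lee_fin.
rewrite (_ : `[0%R, +oo[%classic = [set x : R | (0 <= x)%R]); last exact: set_itvcy.
apply: etrans (ge0_symfun_integralT (f := fun x => (f x * phi x)%R) _ _ _) => //.
- by move=> x; rewrite mulr_ge0// phi_ge0.
- by move=> x; apply: cvgM; [exact: cf|exact: continuous_phi].
- by move=> x /=; rewrite fe !phiE sqrrN.
Qed.

Let is_derive_gauss (x : R) :
  is_derive x 1%R (fun y : R => - phi y)%R (x * phi x)%R.
Proof.
have h1 : is_derive x 1%R (fun y : R => - (y ^+ 2 / 2))%R (- x)%R.
  by apply: is_derive_eq; rewrite /GRing.scale/=; rewrite ?mulr0 ?mulr1 ?add0r ?addr0; field.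
have h2 := is_derive1_comp (g := fun y : R => (- (y ^+ 2 / 2))%R) (is_derive_expR _) h1.
rewrite (_ : (fun y => - phi y)%R =
   (fun y : R => (- (Num.sqrt (2 * pi))^-1) * (expR \o (fun y => - (y ^+ 2 / 2))) y)%R); last first.
  by apply/funext => y; rewrite phiE/= mulNr.
apply: is_derive_eq.
by rewrite phiE /GRing.scale/= ?mulr0 ?add0r; ring.
Qed.

Lemma cvg_phi : phi x @[x --> +oo%R] --> (0 : R)%R.
Proof.
apply: (@squeeze_cvgr _ _ _ _ (fun=> 0%R) (fun x : R => expR (- x))); last 2 first.
- exact: cvg_cst.
- exact: cvgr_expR.
near=> x; rewrite phi_ge0/= phiE -[leRHS]mul1r ler_pM// ?invr_ge0 ?sqrtr_ge0 ?expR_ge0//.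
- rewrite invf_le1 ?sqrtr_gt0 ?mulr_gt0 ?pi_gt0// -[leLHS]sqrtr1 ler_sqrt ?mulr_ge0 ?pi_ge0//.
  by have := @pi_ge2 R; lra.
- rewrite ler_expR lerN2.
  have x2 : (2 <= x)%R by near: x; exact: nbhs_pinfty_ge.
  by nra.
Unshelve. all: by end_near. Qed.

(** [- phi x] is an antiderivative of [x * phi x]. The value explains the step size of BIHT, see
    [wmean_gain]. *)
Lemma stdn_norm : \int[stdn]_x `|x|%:E = (Num.sqrt (2 / pi))%:E :> \bar R.
Proof.
rewrite (stdn_even (f := fun x => `|x|)%R)//; last 2 first.
- by move=> x; exact: norm_continuous.
- by move=> x; rewrite normrN.
rewrite (_ : \int[leb]_(x in _) _ = \int[leb]_(x in `[0%R, +oo[) (x * phi x)%:E); last first.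
  by apply: eq_integral => x; rewrite inE/= in_itv/= andbT => x0; rewrite ger0_norm.
rewrite (@ge0_continuous_FTC2y _ (fun x => x * phi x)%R (fun x => - phi x)%R 0%R (- 0)%R).
- rewrite -EFinB -EFinM; congr EFin; rewrite phiE expr0n/= mul0r oppr0 expR0 mulr1 sub0r opprK.
  have p0 := @pi_gt0 R.
  rewrite sqrtrM// sqrtrM// invfM sqrtrV ?pi_ge0// mulrA; congr (_ * _)%R.
  have s2 : (Num.sqrt 2 != 0 :> R)%R by rewrite sqrtr_eq0 -ltNge.
  by apply: (mulIf s2); rewrite mulfVK// -expr2 sqr_sqrtr.
- by move=> x x0; rewrite mulr_ge0// phi_ge0.
- apply: continuous_subspaceT => x; apply: cvgM; first exact: cvg_id.
  exact: continuous_phi.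
- exact: (cvgN cvg_phi).
- by move=> x _; have [] := is_derive_gauss x.
- apply: cvg_at_right_filter; apply: cvgN; exact: continuous_phi.
- by move=> x _; rewrite derive1E; have [_ ->] := is_derive_gauss x.
Qed.

(** With the density bounded by 1/2 the integral is elementary. This is the source of the term 1 /
    beta in the probability of a wrong sign. *)
Lemma stdn_expR_Nnorm (b : R) : (0 < b)%R ->
  \int[stdn]_x (expR (- b * `|x|))%:E <= b^-1%:E.
Proof.
move=> b0; have cf : continuous (fun x : R => expR (- b * `|x|)).
  move=> x; apply: continuous_comp; last exact: continuous_expR.
  by apply: cvgM; [exact: cvg_cst|exact: norm_continuous].
have cf' : continuous (fun x : R => expR (- b * x)).
  move=> x; apply: continuous_comp; last exact: continuous_expR.
  by apply: cvgM; [exact: cvg_cst|exact: cvg_id].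
rewrite (stdn_even _ cf)//; last by move=> x; rewrite normrN.
apply: (@le_trans _ _ (2%:E * \int[leb]_(x in `[0%R, +oo[) (2^-1%:E * (expR (- b * x))%:E))).
  rewrite lee_pmul2l//; apply: ge0_le_integral => //.
  - by move=> x _; rewrite lee_fin mulr_ge0 ?expR_ge0 ?phi_ge0.
  - apply/measurable_EFinP; apply: measurable_funTS; apply: measurable_funM.
      exact: continuous_measurable_fun.
    exact: measurable_phi.
  - apply: emeasurable_funM => //; apply/measurable_EFinP; apply: measurable_funTS.
    exact: continuous_measurable_fun.
  - move=> x; rewrite /= in_itv/= andbT => x0; rewrite -EFinM lee_fin mulrC ger0_norm//.
    by rewrite ler_wpM2r ?expR_ge0// phi_le_half.
rewrite ge0_integralZl//; last first.
  apply/measurable_EFinP; apply: measurable_funTS; exact: continuous_measurable_fun.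
rewrite (@ge0_continuous_FTC2y _ (fun x => expR (- b * x))%R
   (fun x => - b^-1 * expR (- b * x))%R 0%R 0%R).
- rewrite mulr0 expR0 -EFinB -!EFinM lee_fin; lra.
- by move=> x x0; rewrite expR_ge0.
- exact: continuous_subspaceT.
- rewrite -[X in _ --> X](mulr0 (- b^-1)%R); apply: cvgM; first exact: cvg_cst.
  under eq_fun do rewrite mulNr.
  apply: (cvg_comp (fun x => b * x)%R (fun x => expR (- x))%R); last exact: cvgr_expR.
  by apply: gt0_cvgMry => //; exact: cvg_id.
- by [].
- apply: cvg_at_right_filter; apply: cvgM; [exact: cvg_cst|exact: cf'].
- move=> x _; rewrite derive1E.
  have h1 : is_derive x 1%R (fun y : R => - b * y)%R (- b)%R.
    by apply: is_derive_eq; rewrite /GRing.scale/= ?mulr0 ?mulr1 ?add0r.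
  have h2 := is_derive1_comp (g := fun y : R => (- b * y)%R) (is_derive_expR _) h1.
  have -> : (fun x => - b^-1 * expR (- b * x))%R =
    (fun x : R => (- b^-1) * (expR \o (fun y => - b * y)) x)%R by [].
  rewrite derive_val /=.
  by rewrite /GRing.scale/= ?mulr0 ?add0r; field; rewrite gt_eqF.
Qed.

End NormalMoments.

(** * Finite powers of a probability on tuples *)

Section PowerProbability.
Local Open Scope ereal_scope.
Context d (T : measurableType d) (R : realType) (mu : probability T R).

Definition pcons n (z : T * n.-tuple T) : n.+1.-tuple T := [tuple of z.1 :: z.2].

Lemma measurable_pcons n : measurable_fun setT (@pcons n).
Proof. exact: (measurable_cons measurable_fst measurable_snd). Qed.

Definition pcons_mfun n : {mfun (T * n.-tuple T)%type >-> n.+1.-tuple T} :=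
  mfun_Sub (mem_set (@measurable_pcons n)).

(** Recursion on the head lets integrals unfold one coordinate at a time. The construction serves
    twice: for the entries of a row and for the rows of the matrix. *)
Fixpoint pow_prob n : probability (n.-tuple T) R :=
  match n with
  | 0 => \d_([tuple] : 0.-tuple T)
  | n'.+1 => distribution (mu \x pow_prob n') (pcons_mfun n')
  end.

Lemma ge0_integral_pow0 (f : 0.-tuple T -> \bar R) : measurable_fun setT f ->
  (forall t, 0 <= f t) -> \int[pow_prob 0]_t f t = f [tuple].
Proof. by move=> mf f0; rewrite integral_dirac// diracT mul1e. Qed.

Lemma ge0_integral_powS n (f : n.+1.-tuple T -> \bar R) : measurable_fun setT f ->
  (forall t, 0 <= f t) ->
  \int[pow_prob n.+1]_t f t = \int[mu]_x \int[pow_prob n]_t f (pcons (x, t)).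
Proof.
move=> mf f0; rewrite ge0_integral_distribution//.
rewrite (@fubini_tonelli1 _ _ _ _ _ mu (pow_prob n) (f \o pcons_mfun n))//.
  by apply: measurableT_comp => //; exact: measurable_pcons.
by move=> z; exact: f0.
Qed.

Lemma tnth_pcons0 n x (t : n.-tuple T) : tnth (pcons (x, t)) ord0 = x.
Proof. by []. Qed.

Lemma tnth_pconsS n x (t : n.-tuple T) i : tnth (pcons (x, t)) (lift ord0 i) = tnth t i.
Proof. by rewrite /pcons tnthS. Qed.

Lemma emeasurable_prod d' (T' : measurableType d') n (g : 'I_n -> T' -> \bar R) :
  (forall i, measurable_fun setT (g i)) ->
  measurable_fun setT (fun t => \prod_(i < n) g i t).
Proof.
elim: n g => [|n IH] g mg.
  by rewrite (_ : (fun t => _) = cst 1)//; apply/funext => t; rewrite big_ord0.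
under eq_fun do rewrite big_ord_recl.
by apply: emeasurable_funM => //; apply: IH.
Qed.

Lemma prode_ge0E (I : finType) (F : I -> \bar R) :
  (forall i, 0 <= F i) -> 0 <= \prod_i F i.
Proof. by move=> F0; elim/big_ind: _ => //; exact: mule_ge0. Qed.

Lemma integral_pow_prod n (g : 'I_n -> T -> \bar R) :
  (forall i, measurable_fun setT (g i)) -> (forall i x, 0 <= g i x) ->
  \int[pow_prob n]_t \prod_(i < n) g i (tnth t i) = \prod_(i < n) \int[mu]_x g i x.
Proof.
elim: n g => [|n IH] g mg g0.
  rewrite ge0_integral_pow0 ?big_ord0//; last by move=> t; rewrite big_ord0.
  by rewrite (_ : (fun t => _) = cst 1)//; apply/funext => t; rewrite big_ord0.
have mG m (h : 'I_m -> T -> \bar R) (mh : forall i, measurable_fun setT (h i)) :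
    measurable_fun setT (fun t : m.-tuple T => \prod_(i < m) h i (tnth t i)).
  apply: (emeasurable_prod (g := fun i (t : m.-tuple T) => h i (tnth t i))) => i.
  by apply: (measurableT_comp (mh i)); exact: measurable_tnth.
rewrite ge0_integral_powS//; [|exact: mG|by move=> t; exact: prode_ge0E].
rewrite big_ord_recl -IH//.
transitivity (\int[mu]_x (g ord0 x *
    \int[pow_prob n]_t \prod_(i < n) g (lift ord0 i) (tnth t i))).
  apply: eq_integral => x _; rewrite -ge0_integralZl//.
  - apply: eq_integral => t _; rewrite big_ord_recl tnth_pcons0; congr (_ * _).
    by apply: eq_bigr => i _; rewrite tnth_pconsS.
  - exact: (mG _ (fun i => g (lift ord0 i))).
  - by move=> t _; exact: prode_ge0E.
rewrite ge0_integralZr//; apply: integral_ge0 => t _; exact: prode_ge0E.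
Qed.

Definition box n (A : 'I_n -> set T) : set (n.-tuple T) :=
  [set t | forall i, A i (tnth t i)].

Lemma measurable_box n (A : 'I_n -> set T) :
  (forall i, measurable (A i)) -> measurable (box A).
Proof.
move=> mA; rewrite (_ : box A = \bigcap_(i in [set: 'I_n]) ((@tnth n T)^~ i @^-1` A i)).
  apply: fin_bigcap_measurable => // i _; rewrite -[X in measurable X]setTI.
  exact: measurable_tnth.
by apply/seteqP; split => t /=; [move=> h i _|move=> h i]; exact: h.
Qed.

Lemma pow_prob_box n (A : 'I_n -> set T) : (forall i, measurable (A i)) ->
  pow_prob n (box A) = \prod_(i < n) mu (A i).
Proof.
move=> mA; rewrite -[LHS]mul1e -[X in X * _]/(1%:E) -integral_cst; last exact: measurable_box.
rewrite integral_mkcond.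
transitivity (\prod_(i < n) \int[mu]_x (\1_(A i) x)%:E); last first.
  by apply: eq_bigr => i _; rewrite integral_indic// setIT.
rewrite -integral_pow_prod//; last by move=> i; exact/measurable_EFinP/measurable_indic.
apply: eq_integral => t _; rewrite patchE; case: ifPn => [|/negP].
  rewrite inE => At; rewrite big1// => i _; rewrite indicE mem_set//; exact: At.
move=> At; have [i nAi] : exists i, ~ A i (tnth t i).
  by apply/existsNP => h; apply: At; rewrite inE.
by rewrite (bigD1 i)//= indicE memNset// mul0e.
Qed.

Section Unique.
Variable G : set (set T).
Hypotheses (mG : @measurable _ T = <<s G>>) (GT : G setT) (GI : setI_closed G).

Lemma setI_closed_box n : setI_closed [set B | exists2 A : 'I_n -> set T, (forall i, G (A i)) & B = box A].
Proof.
move=> _ _ [A GA ->] [B GB ->]; exists (fun i => A i `&` B i).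
  by move=> i; exact: GI.
by apply/seteqP; split => t /=; [move=> [hA hB] i; split|move=> h; split => i; have [] := h i].
Qed.

Lemma measurable_tuple_box n : @measurable _ (n.-tuple T) =
  <<s [set B | exists2 A : 'I_n -> set T, (forall i, G (A i)) & B = box A] >>.
Proof.
apply/seteqP; split; last first.
  apply: smallest_sub; first exact: sigma_algebra_measurable.
  move=> _ [A GA ->]; apply: measurable_box => i; rewrite mG; exact: sub_sigma_algebra.
set H := [set B | _].
apply: smallest_sub; first exact: smallest_sigma_algebra.
move=> B; rewrite -bigcup_seq/= => -[i _ [C mC <-]]; rewrite setTI.
suff : measurable `<=` [set C | <<s H >> ((@tnth n T)^~ i @^-1` C)] by exact.
rewrite mG; apply: smallest_sub.
  have [s0 sC sU] := @smallest_sigma_algebra _ setT H; split => /=.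
  - by rewrite preimage_set0.
  - by move=> D sD; rewrite setTD preimage_setC -setTD; exact: sC.
  - by move=> F sF; rewrite preimage_bigcup; exact: sU.
move=> D GD /=; apply: sub_sigma_algebra.
(* A condition on one coordinate is a box with all other sides equal to [setT], hence the assumption
   [GT]. *)
exists (fun j => if j == i then D else setT) => [j|]; first by case: ifP.
apply/seteqP; split => t /=; last by move=> /(_ i); rewrite eqxx.
by move=> Dt j; case: eqP => // ->.
Qed.

(** Boxes over an intersection-stable generator form an intersection-stable generator of the tuples.
    The generator [G] is left free because the law of a Gaussian matrix is given on products of
    one-dimensional sets only: for the rows, [G] is itself a class of boxes. *)
Lemma pow_prob_unique n (nu : probability (n.-tuple T) R) :
  (forall A : 'I_n -> set T, (forall i, G (A i)) -> nu (box A) = \prod_(i < n) mu (A i)) ->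
  forall B, measurable B -> nu B = pow_prob n B.
Proof.
move=> nuE B mB.
apply: (measure_unique _ (fun=> setT) (@measurable_tuple_box n) (@setI_closed_box n)) => //.
- move=> _; exists (fun=> setT) => //; by apply/seteqP; split.
- exact: bigcup_const.
- move=> _ [A GA ->]; apply: etrans (nuE A GA) (esym (pow_prob_box _)) => i.
  by rewrite mG; exact: sub_sigma_algebra.
- by move=> _; apply: le_lt_trans (ltry 1); exact: probability_le1.
Qed.

End Unique.

End PowerProbability.

(** * Laws of linear forms in a Gaussian vector *)

Section GaussianVector.
Local Open Scope ereal_scope.
Context {R : realType}.
Notation mR := (measurableTypeR R).

Definition gam n : probability (n.-tuple mR) R := pow_prob stdn n.

Definition dotp n (u : 'I_n -> R) (t : n.-tuple mR) : R := (\sum_i u i * tnth t i)%R.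
Definition sumsq n (u : 'I_n -> R) : R := (\sum_i u i ^+ 2)%R.

Lemma measurable_dotp n (u : 'I_n -> R) : measurable_fun setT (dotp u : _ -> mR).
Proof.
apply: measurable_sum => i; apply: measurable_funM => //; exact: measurable_tnth.
Qed.

Lemma sumsq_ge0 n (u : 'I_n -> R) : (0 <= sumsq u)%R.
Proof. by apply: sumr_ge0 => i _; exact: sqr_ge0. Qed.

Lemma dotp_pcons n (u : 'I_n.+1 -> R) x (t : n.-tuple mR) :
  dotp u (pcons (x, t)) = (u ord0 * x + dotp (fun i => u (lift ord0 i)) t)%R.
Proof.
rewrite /dotp big_ord_recl tnth_pcons0; congr (_ + _)%R.
by apply: eq_bigr => i _; rewrite tnth_pconsS.
Qed.

Lemma measurable_lin (a b : R) : measurable_fun setT (fun z : mR * mR => (a * z.1 + b * z.2)%R : mR).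
Proof. by apply: measurable_funD; apply: measurable_funM. Qed.

(** This is the rotation that turns p x + q y into r y with r = sqrt(p^2 + q^2). Multiplying the
    equations by r lets them cover r = 0, where the identity is chosen. *)
Lemma rot_coefs (p q : R) : (0 <= q)%R -> exists c s : R,
  [/\ (c ^+ 2 + s ^+ 2 = 1)%R, (0 <= c)%R, (c * Num.sqrt (p ^+ 2 + q ^+ 2) = q)%R
    & (s * Num.sqrt (p ^+ 2 + q ^+ 2) = - p)%R].
Proof.
move=> q0; have pq : (0 <= p ^+ 2 + q ^+ 2)%R by rewrite addr_ge0 ?sqr_ge0.
set r := Num.sqrt _.
have r2 : (r ^+ 2 = p ^+ 2 + q ^+ 2)%R by rewrite sqr_sqrtr.
have [r0|r0] := eqVneq r 0%R.
  exists 1%R, 0%R; rewrite r0; move: r2; rewrite r0 expr0n/= => pq0.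
  have p0 : p = 0%R by apply/eqP; rewrite -sqrf_eq0; apply/eqP; nra.
  have q00 : q = 0%R by apply/eqP; rewrite -sqrf_eq0; apply/eqP; nra.
  by rewrite p0 q00; split=> //; ring.
exists (q / r)%R, (- p / r)%R; split.
- by rewrite !expr_div_n -mulrDl r2 sqrrN addrC mulfV// -r2 sqrf_eq0.
- by rewrite divr_ge0// sqrtr_ge0.
- by rewrite mulfVK.
- by rewrite mulfVK.
Qed.

Lemma stdn_cst (k : \bar R) : \int[stdn]_(x in [set: mR]) k = k.
Proof. by rewrite integral_cst// [X in _ * X](probability_setT (stdn (R := R))) mule1. Qed.

Lemma stdn2_lin (f : mR -> \bar R) (p q : R) : (0 <= q)%R -> measurable_fun setT f ->
  (forall x, 0 <= f x) ->
  \int[stdn]_x \int[stdn]_y f (p * x + q * y)%R =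
  \int[stdn]_y f (Num.sqrt (p ^+ 2 + q ^+ 2) * y)%R.
Proof.
move=> q0 mf f0; have [c [s [cs c0 cq sp]]] := rot_coefs p q0.
set r := Num.sqrt _ in cq sp *.
pose F (z : mR * mR) := f (p * z.1 + q * z.2)%R.
have mF : measurable_fun setT F by apply: (measurableT_comp mf); exact: measurable_lin.
apply: etrans (esym (stdn_rot cs c0 mF (fun z => f0 _))) _.
transitivity (\int[stdn]_(x in [set: mR]) \int[stdn]_y f (r * y)%R); last exact: stdn_cst.
apply: eq_integral => x _; apply: eq_integral => y _; rewrite /F /rot2/=; congr f.
rewrite -cq -[p in LHS]opprK -sp.
transitivity ((c ^+ 2 + s ^+ 2) * (r * y))%R; first ring.
by rewrite cs mul1r.
Qed.

(* A pair of linear forms in a Gaussian vector is a linear image of two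
   independent standard normals, the first of which carries the second form. *)
Lemma gam_pair n (u a : 'I_n -> R) : exists al be : R,
  (al * Num.sqrt (sumsq a) = \sum_i u i * a i)%R /\
  (0 <= be)%R /\
  forall F : mR * mR -> \bar R, measurable_fun setT F -> (forall z, 0 <= F z) ->
  \int[gam n]_t F (dotp u t, dotp a t) =
  \int[stdn]_z \int[stdn]_w F (al * z + be * w, Num.sqrt (sumsq a) * z)%R.
Proof.
elim: n u a => [|n IH] u a.
  exists 0%R, 0%R; split; first by rewrite mul0r big_ord0.
  split=> // F mF F0; rewrite ge0_integral_pow0//; last first.
    apply: (measurableT_comp mF); apply: measurable_fun_pair; exact: measurable_dotp.
  rewrite /sumsq big_ord0 sqrtr0.
  rewrite (_ : (fun z : mR => _) = (fun=> F (0, 0)%R)); last first.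
    apply/funext => z; rewrite -[RHS]stdn_cst; apply: eq_integral => w _.
    by rewrite !mul0r addr0.
  by rewrite stdn_cst /dotp !big_ord0.
have [al [be [alE [be0 lawE]]]] := IH (fun i => u (lift ord0 i)) (fun i => a (lift ord0 i)).
set s := Num.sqrt _ in alE lawE.
have s0 : (0 <= s)%R by exact: sqrtr_ge0.
(* Rotate the new coordinate x together with z so that the second form a_0 x + s z becomes s' z. The
   first form becomes b' x + al' z + be w, and b' x + be w, which is independent of z, is merged
   into a single Gaussian by [stdn2_lin]. *)
have [c [g [cg c0 cs ga]]] := rot_coefs (a ord0) s0.
have sE : Num.sqrt (a ord0 ^+ 2 + s ^+ 2) = Num.sqrt (sumsq a).
  by rewrite /s sqr_sqrtr ?sumsq_ge0// [in RHS]/sumsq big_ord_recl.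
rewrite sE in cs ga; set s' := Num.sqrt _ in cs ga *.
pose b' := (u ord0 * c + al * g)%R.
exists (al * c - u ord0 * g)%R, (Num.sqrt (b' ^+ 2 + be ^+ 2)); split.
  by rewrite big_ord_recl -alE -[a ord0]opprK -ga -cs; ring.
split; first exact: sqrtr_ge0.
move=> F mF F0; rewrite ge0_integral_powS//; last first.
  apply: (measurableT_comp mF); apply: measurable_fun_pair; exact: measurable_dotp.
pose G (z : mR * mR) := \int[stdn]_w F (u ord0 * z.1 + (al * z.2 + be * w), a ord0 * z.1 + s * z.2)%R.
have mFL (k1 k2 k3 l1 l2 : R) : measurable_fun setT (fun z : mR * mR * mR =>
    F (k1 * z.1.1 + (k2 * z.1.2 + k3 * z.2), l1 * z.1.1 + l2 * z.1.2)%R).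
  have m11 : measurable_fun setT (fun z : mR * mR * mR => z.1.1) by apply: measurableT_comp.
  have m12 : measurable_fun setT (fun z : mR * mR * mR => z.1.2) by apply: measurableT_comp.
  apply: (measurableT_comp mF); apply: measurable_fun_pair.
    apply: measurable_funD; first exact: measurable_funM.
    by apply: measurable_funD; apply: measurable_funM.
  by apply: measurable_funD; apply: measurable_funM.
have mG : measurable_fun setT G.
  by apply: (measurable_fun_fubini_tonelli_F _ (mFL (u ord0) al be (a ord0) s)).
have G0 z : 0 <= G z by apply: integral_ge0.
transitivity (\int[stdn]_x \int[stdn]_z G (x, z)).
  apply: eq_integral => x _.
  pose Fx (z : mR * mR) := F (u ord0 * x + z.1, a ord0 * x + z.2)%R.
  have mFx : measurable_fun setT Fx.
    apply: (measurableT_comp mF); apply: measurable_fun_pair; exact: measurable_funD.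
  apply: etrans (lawE Fx mFx (fun z => F0 _)).
  by apply: eq_integral => t _; rewrite !dotp_pcons.
apply: etrans (esym (stdn_rot cg c0 mG G0)) _.
pose al' := (al * c - u ord0 * g)%R.
pose G' (z : mR * mR) := \int[stdn]_w F (b' * z.1 + (al' * z.2 + be * w), 0 * z.1 + s' * z.2)%R.
have mG' : measurable_fun setT G'.
  by apply: (measurable_fun_fubini_tonelli_F _ (mFL b' al' be 0%R s')).
have G'0 z : 0 <= G' z by apply: integral_ge0.
transitivity (\int[stdn]_x \int[stdn]_z G' (x, z)).
  apply: eq_integral => x _; apply: eq_integral => z _; apply: eq_integral => w _.
  rewrite /rot2/=; congr (F (_, _)); first by rewrite /b' /al'; ring.
  rewrite -cs -[a ord0]opprK -ga.
  transitivity ((c ^+ 2 + g ^+ 2) * (s' * z))%R; first ring.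
  by rewrite cg mul1r mul0r add0r.
apply: etrans (fubini_tonelli (m1 := stdn) (m2 := stdn) G' mG' G'0) _.
apply: eq_integral => z _.
apply: etrans (stdn2_lin (f := fun r => F (al' * z + r, s' * z)%R) b' be0 _ (fun r => F0 _)).
  apply: eq_integral => x _; apply: eq_integral => w _.
  by rewrite /=; congr (F (_, _)); ring.
apply: (measurableT_comp mF); apply: measurable_fun_pair => //; exact: measurable_funD.
Qed.

Lemma gam_dotp n (a : 'I_n -> R) (f : mR -> \bar R) : measurable_fun setT f ->
  (forall x, 0 <= f x) ->
  \int[gam n]_t f (dotp a t) = \int[stdn]_z f (Num.sqrt (sumsq a) * z)%R.
Proof.
move=> mf f0; have [al [be [_ [_ lawE]]]] := gam_pair a a.
apply: etrans (lawE (fun z => f z.2) _ (fun z => f0 _)) _.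
  exact: (measurableT_comp mf).
by apply: eq_integral => z _; exact: (stdn_cst (f (Num.sqrt (sumsq a) * z)%R)).
Qed.

End GaussianVector.

Section GaussianMean.
Local Open Scope ereal_scope.
Context {R : realType}.
Notation mR := (measurableTypeR R).

Lemma stdn_norm_lty : \int[stdn]_x (`|x|%:E) < +oo :> \bar R.
Proof. by rewrite stdn_norm ltry. Qed.

Lemma integrable_stdn_id : (@stdn R).-integrable setT (fun x : mR => (x : R)%:E).
Proof.
by apply/integrableP; split; [exact/measurable_EFinP|exact: stdn_norm_lty].
Qed.

(** A quarter turn replaces the first coordinate by minus the second. *)
Lemma stdn_opp (f : mR -> \bar R) : measurable_fun setT f -> (forall x, 0 <= f x) ->
  \int[stdn]_x f (- x)%R = \int[stdn]_x f x.
Proof.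
move=> mf f0.
have cs : (0 ^+ 2 + 1 ^+ 2 = 1 :> R)%R by rewrite expr0n expr1n add0r.
pose F (z : mR * mR) := f z.1.
have mF : measurable_fun setT F by exact: (measurableT_comp mf).
have := stdn_rot cs (lexx 0)%R mF (fun z => f0 _).
move=> H; transitivity (\int[stdn]_(x in [set: mR]) \int[stdn]_y f (- y)%R).
  by rewrite stdn_cst.
transitivity (\int[stdn]_x \int[stdn]_y F (rot2 0 1 (x, y))).
  apply: eq_integral => x _; apply: eq_integral => y _.
  by rewrite /F /rot2/= mul0r mul1r sub0r.
rewrite H; apply: eq_integral => x _; exact: (stdn_cst (f x)).
Qed.

Lemma stdn_mean0 : \int[stdn]_x (x : R)%:E = 0.
Proof.
rewrite integralE (_ : \int[stdn]_x ((fun x : R => x%:E)^\- x) = \int[stdn]_x ((fun x : R => x%:E)^\+ x)).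
  by rewrite subee//; exact: integrable_pos_fin_num integrable_stdn_id.
have mid : measurable_fun setT (fun x : mR => (x : R)%:E) by exact/measurable_EFinP.
apply: etrans (stdn_opp (f := (fun x : R => x%:E)^\+) _ _).
- by apply: eq_integral => x _; rewrite funeposE funenegE EFinN.
- exact: measurable_funepos.
- by move=> x; exact: funepos_ge0.
Qed.

Lemma gam_dotp_integrable n (u : 'I_n -> R) :
  (gam n).-integrable setT (fun t => (dotp u t)%:E).
Proof.
apply/integrableP; split; first by apply/measurable_EFinP; exact: measurable_dotp.
have mn : measurable_fun setT (fun x : mR => `|x|%:E).
  by apply/measurable_EFinP; exact: (measurableT_comp (@normr_measurable R setT)).
rewrite (gam_dotp u (f := fun x => `|x|%:E))//.
under eq_integral do rewrite normrM EFinM.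
rewrite ge0_integralZl//.
by rewrite stdn_norm -EFinM ltry.
Qed.

Lemma bounded_mul_integrable d (T : measurableType d) (mu : {measure set T -> \bar R})
  (f g : T -> R) : mu.-integrable setT (EFin \o f) -> measurable_fun setT g ->
  (forall x, `|g x| <= 1)%R -> mu.-integrable setT (fun x => (f x * g x)%:E).
Proof.
move=> intf mg g1.
have mf : measurable_fun setT f by apply/measurable_EFinP; exact: measurable_int intf.
apply: (le_integrable measurableT _ _ intf).
  by apply/measurable_EFinP; exact: measurable_funM.
by move=> x _ /=; rewrite lee_fin normrM ler_piMr.
Qed.

(** By [gam_pair], <u, t> = <u, a> z + be w where z = <a, t> and w is centred and independent of z,
    so the part in w integrates to 0. As the integrand is signed, the law is transferred on positive
    and negative parts, and Fubini needs the integrability of both products. Used with a = th and a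
    = v, it gives the two halves of the mean of W. *)
Lemma gam_mean n (u a : 'I_n -> R) (g : R -> R) : sumsq a = 1%R ->
  measurable_fun setT g -> (forall x, `|g x| <= 1)%R ->
  \int[gam n]_t (dotp u t * g (dotp a t))%:E =
  (\sum_i u i * a i)%:E * \int[stdn]_z (z * g z)%:E.
Proof.
move=> a1 mg g1; have [al [be [alE [be0 lawE]]]] := gam_pair u a.
rewrite a1 sqrtr1 mulr1 in alE; rewrite -alE.

pose lin (z : mR * mR) : mR * mR := ((al * z.1 + be * z.2)%R, z.1).
have mlin : measurable_fun setT lin.
  by apply: measurable_fun_pair => //; exact: measurable_lin.
have law (F : mR * mR -> \bar R) : measurable_fun setT F -> (forall z, 0 <= F z) ->
    \int[gam n]_t F (dotp u t, dotp a t) = \int[stdn \x stdn]_z F (lin z).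
  move=> mF F0.
  apply: etrans (esym (fubini_tonelli1 (m1 := stdn) (m2 := stdn) (F \o lin) _ (fun z => F0 _))).
    apply: etrans (lawE F mF F0) _; apply: eq_integral => z _; apply: eq_integral => w _.
    by rewrite /lin/= a1 sqrtr1 mul1r.
  exact: (measurableT_comp mF).
pose F (z : mR * mR) := ((z.1 : R) * g z.2)%:E.
have mF : measurable_fun setT F.
  by apply/measurable_EFinP; apply: measurable_funM => //; exact: (measurableT_comp mg).
transitivity (\int[stdn \x stdn]_z F (lin z)).
  rewrite integralE [RHS]integralE; congr (_ - _).
    apply: etrans (etrans (law F^\+ (measurable_funepos mF) (funepos_ge0 _)) _);
    by apply: eq_integral => t _; rewrite !funeposE.
  apply: etrans (etrans (law F^\- (measurable_funeneg mF) (funeneg_ge0 _)) _);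
    by apply: eq_integral => t _; rewrite !funenegE.
have mg1 : measurable_fun setT (fun z : mR * mR => g z.1) by exact: (measurableT_comp mg).
have int1 : (stdn \x stdn).-integrable setT (EFin \o (fun z : mR * mR => z.1 : R)).
  have m1 : measurable_fun setT (fun z : mR * mR => z.1 : R) by exact: measurable_fst.
  apply/integrableP; split; first exact/measurable_EFinP.
  rewrite (fubini_tonelli1 (m1 := stdn) (m2 := stdn) (fun z => `|(z.1 : R)%:E|))//; last first.
    by apply: measurableT_comp => //; exact/measurable_EFinP.
  rewrite /fubini_F/= (eq_integral (fun x : mR => `|x|%:E)) ?stdn_norm_lty// => x _.
  exact: stdn_cst.
have int2 : (stdn \x stdn).-integrable setT (EFin \o (fun z : mR * mR => z.2 : R)).
  have m2 : measurable_fun setT (fun z : mR * mR => z.2 : R) by exact: measurable_snd.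
  apply/integrableP; split; first exact/measurable_EFinP.
  rewrite (fubini_tonelli1 (m1 := stdn) (m2 := stdn) (fun z => `|(z.2 : R)%:E|))//; last first.
    by apply: measurableT_comp => //; exact/measurable_EFinP.
  by rewrite /fubini_F/= stdn_cst stdn_norm_lty.
have int1g := bounded_mul_integrable int1 mg1 (fun z => g1 _).
have int2g := bounded_mul_integrable int2 mg1 (fun z => g1 _).
have intH : (stdn \x stdn).-integrable setT (F \o lin).
  apply: (eq_integrable measurableT (fun z : mR * mR => al%:E * ((z.1 : R) * g z.1)%:E + be%:E * ((z.2 : R) * g z.1)%:E)).
    by move=> z _; rewrite /F/= -!EFinM -EFinD; congr EFin; ring.
  by apply: integrableD => //; exact: integrableZl.
apply: etrans (esym (integral12_prod_meas1 (m1 := stdn) (m2 := stdn) intH)) _.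
have intzg : (@stdn R).-integrable setT (fun z : mR => ((z : R) * g z)%:E).
  exact: (bounded_mul_integrable integrable_stdn_id).
rewrite -integralZl//; apply: eq_integral => z _; rewrite /fubini_F/=.
rewrite (eq_integral (fun w : mR => (al * (z * g z))%:E + (be * g z)%:E * (w : R)%:E)); last first.
  by move=> w _; rewrite /F/= -EFinM -EFinD; congr EFin; ring.
rewrite integralD//; last 2 first.
- apply: (eq_integrable measurableT (cst (al * (z * g z))%:E)) => //.
  exact: finite_measure_integrable_cst.
- by apply: integrableZl => //; exact: integrable_stdn_id.
by rewrite stdn_cst integralZl// ?stdn_mean0 ?mule0 ?adde0//; exact: integrable_stdn_id.
Qed.

End GaussianMean.

(** * Exponential inequalities and tools for integrals and signs *)

Section RealBounds.
Context {R : realType}.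
Implicit Types x B : R.

Lemma expR_le_quad x : expR x <= 1 + x + x ^+ 2 * expR `|x|.
Proof.
have h : expR x - 1 <= x * expR x.
  have := expR_ge1Dx (- x); rewrite expRN => h1.
  have ex := expR_gt0 x.
  have : (1 - x) * expR x <= 1 by rewrite -[leRHS](mulVf (lt0r_neq0 ex)) ler_pM2r.
  lra.
have h1 := expR_ge1Dx x.
have [x0|x0] := leP 0 x.
  by rewrite ger0_norm//; have := ler_wpM2l x0 h; nra.
have : 1 <= expR `|x| by rewrite -expR0 ler_expR.
have : x * (expR x - 1) <= x * x by rewrite ler_wnM2l ?(ltW x0)//; lra.
nra.
Qed.

Lemma expR_half_le2 : expR (2^-1 : R) <= 2.
Proof.
have := expR_ge1Dx (- 2^-1 : R); rewrite expRN => h.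
have e0 := expR_gt0 (2^-1 : R).
have : (1 - 2^-1) * expR (2^-1 : R) <= 1 by rewrite -[leRHS](mulVf (lt0r_neq0 e0)) ler_pM2r.
lra.
Qed.

Lemma expR_half_nat_le n : expR (n%:R / 2 : R) <= 2 ^+ n.
Proof. by rewrite expRM_natl lerXn2r ?nnegrE ?expR_ge0 ?expR_half_le2. Qed.

Lemma sqr_le_expR x : 0 <= x -> x ^+ 2 <= 2 * expR x.
Proof. by move=> x0; have := expR_ge1Dxn 1 x0; rewrite (_ : (1.+1)`! = 2)%N//; lra. Qed.

(** Truncation at level B in pointwise form: below B the square is at most B^2 and the exponential
    at most 4; above B, x^2 <= 2 e^x and e^(x / B) <= e^x <= e^(-B) e^(2 x), so the excess has a
    small prefactor and a finite Gaussian mean. *)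
Lemma truncated_sqr_le x B : 1 <= B -> 0 <= x ->
  x ^+ 2 * expR (x / B) <= 4 * B ^+ 2 + 2 * expR (- B) * expR (3 * x).
Proof.
move=> B1 x0; have B0 : 0 < B by lra.
have [xB|Bx] := leP x B.
  have : expR (x / B) <= 4.
    have -> : 4 = 2 ^+ 2 :> R by ring.
    apply: le_trans (expR_half_nat_le 2); rewrite ler_expR divff// ler_pdivrMr//; lra.
  have := expR_gt0 (- B); have := expR_gt0 (3 * x); have := expR_gt0 (x / B).
  have : x ^+ 2 <= B ^+ 2 by rewrite lerXn2r ?nnegrE// ltW.
  have := sqr_ge0 x.
  nra.
have h1 : expR (x / B) <= expR x.
  by rewrite ler_expR ler_pdivrMr//; nra.
have h2 := sqr_le_expR x0.
have h3 : expR x <= expR (- B) * expR (2 * x) by rewrite -expRD ler_expR; lra.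
have h4 : expR (3 * x) = expR x * expR (2 * x) by rewrite -expRD; congr expR; ring.
have := sqr_ge0 x; have := sqr_ge0 B; have := expR_gt0 x; have := expR_gt0 (2 * x).
have := expR_gt0 (- B); have := expR_gt0 (x / B) => e1 e2 e3 e4 b2 x2.
have : x ^+ 2 * expR (x / B) <= 2 * expR x * expR x.
  by apply: ler_pM => //; exact: ltW.
have : expR x * expR x <= expR x * (expR (- B) * expR (2 * x)) by rewrite ler_pM2l.
rewrite h4; nra.
Qed.

End RealBounds.

Section LinearIntegrals.
Local Open Scope ereal_scope.
Context d (T : measurableType d) (R : realType) (mu : {measure set T -> \bar R}).
Variables f g : T -> R.
Hypotheses (intf : mu.-integrable setT (EFin \o f)) (intg : mu.-integrable setT (EFin \o g)).

Lemma integrable_lin (a b : R) : mu.-integrable setT (EFin \o (fun x => a * f x + b * g x)%R).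
Proof.
apply: (eq_integrable measurableT (fun x => a%:E * (f x)%:E + b%:E * (g x)%:E)).
  by move=> x _; rewrite /= EFinD !EFinM.
by apply: integrableD => //; exact: integrableZl.
Qed.

Lemma integral_lin (a b : R) : \int[mu]_x (a * f x + b * g x)%:E =
  a%:E * \int[mu]_x (f x)%:E + b%:E * \int[mu]_x (g x)%:E.
Proof.
transitivity (\int[mu]_x (a%:E * (f x)%:E + b%:E * (g x)%:E)).
  by apply: eq_integral => x _; rewrite EFinD !EFinM.
by rewrite integralD//; [rewrite !integralZl|exact: integrableZl|exact: integrableZl].
Qed.

End LinearIntegrals.

Section SignMeasurability.
Context {R : realType}.
Notation mR := (measurableTypeR R).

Lemma measurable_sign : measurable_fun setT (sign : mR -> R).
Proof.
apply: measurable_fun_ifT => //; apply: measurable_fun_ler => //.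
Qed.

Lemma sign_pm1 (x : R) : sign x = 1 \/ sign x = -1.
Proof. by rewrite /sign; case: ifP; [left|right]. Qed.

Lemma norm_sign (x : R) : `|sign x| = 1.
Proof. by case: (sign_pm1 x) => ->; rewrite ?normrN normr1. Qed.

Lemma mul_sign (x : R) : x * sign x = `|x|.
Proof. rewrite /sign; case: (leP 0 x) => x0; first by rewrite mulr1 ger0_norm.
by rewrite mulrN1 ltr0_norm. Qed.

End SignMeasurability.

(** * One observation: mean and exponential moments of its statistics *)

Section RowStatistics.
Local Open Scope ereal_scope.
Context {R : realType}.
Notation mR := (measurableTypeR R).
Variable d : nat.
Implicit Types (u v th : 'I_d -> R) (t : d.-tuple mR) (s : R).

(* One observation: t is a row of X, with standard Gaussian entries, and s its
   response under the link p and the parameter th. *)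
Definition row_mean (p : R -> R) th (h : R -> d.-tuple mR -> R) : \bar R :=
  \int[gam d]_t (p (dotp th t) * h 1 t + (1 - p (dotp th t)) * h (- 1) t)%:E.

(* The contribution of an observation to <u, correction of BIHT at v>, up to the
   factor sqrt (2 * pi) / n; wmean is its mean, where sqrt (2 / pi) = E|z|. *)
Definition wstat u v s t : R := (dotp u t * ((s - sign (dotp v t)) / 2))%R.
Definition wrong v s t : R := (s != sign (dotp v t))%:R%R.
Definition corr (p : R -> R) : R := fine (\int[stdn]_z (z * (2 * p z - 1))%:E).
Definition wmean (p : R -> R) th u v : R :=
  ((\sum_i u i * th i) * corr p - (\sum_i u i * v i) * Num.sqrt (2 / pi))%R / 2.

Lemma measurable_sign_dotp v : measurable_fun setT (fun t => sign (dotp v t)).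
Proof. exact: (measurableT_comp measurable_sign (measurable_dotp v)). Qed.

Lemma measurable_wrong v s : measurable_fun setT (wrong v s).
Proof.
rewrite (_ : wrong v s = (fun t => if (0 <= dotp v t)%R then (s != 1)%:R%R else (s != -1)%:R%R)).
  apply: measurable_fun_ifT => //; apply: measurable_fun_ler => //; exact: measurable_dotp.
by apply/funext => t; rewrite /wrong /sign; case: ifP.
Qed.

Lemma wrong_ge0 v s t : (0 <= wrong v s t <= 1)%R.
Proof. by rewrite /wrong; case: (_ != _); rewrite lexx ler01. Qed.

Lemma wstat_norm u v s t : s = 1%R \/ s = (- 1)%R ->
  (`|wstat u v s t| = `|dotp u t| * wrong v s t)%R.
Proof.
rewrite /wstat /wrong normrM => s1; congr (_ * _)%R.
have n1 : (1 != -1 :> R)%R by lra.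
case: s1 => ->; case: (sign_pm1 (dotp v t)) => ->; rewrite ?eqxx ?n1 ?(eq_sym _ 1%R) ?n1/=.
- by rewrite subrr mul0r normr0.
- by rewrite opprK (_ : (1 + 1) / 2 = 1 :> R)%R ?normr1//; field.
- by rewrite (_ : (- 1 - 1) / 2 = - 1 :> R)%R ?normrN1//; field.
- by rewrite subrr mul0r normr0.
Qed.

(** Where the sign is right W vanishes and the second-order term costs nothing; where it is wrong,
    [|l| * B <= 1] replaces the exponent |l W| by |W| / B, the form treated by [truncated_sqr_le].
    The first-order term stays exact, as it carries the mean. *)
Lemma expR_wstat_le u v s t (l B : R) : s = 1%R \/ s = (- 1)%R -> (1 <= B)%R ->
  (`|l| * B <= 1)%R ->
  (expR (l * wstat u v s t) <= 1 + l * wstat u v s t +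
    l ^+ 2 * (4 * B ^+ 2 * wrong v s t + 2 * expR (- B) * expR (3 * `|dotp u t|)))%R.
Proof.
move=> s1 B1 lB; apply: le_trans (expR_le_quad _) _; rewrite lerD2l exprMn -[leLHS]mulrA.
apply: ler_wpM2l; first exact: sqr_ge0.
rewrite -(real_normK (num_real (wstat u v s t))) (normrM l) wstat_norm//.
set x := (`|dotp u t|)%R; have x0 : (0 <= x)%R by exact: normr_ge0.
have e0 : (0 <= 2 * expR (- B) * expR (3 * x))%R by rewrite !mulr_ge0// expR_ge0.
rewrite /wrong; case: (_ != _); last by rewrite mulr0 expr0n/= mul0r mulr0 add0r.
rewrite !mulr1; apply: le_trans (truncated_sqr_le B1 x0).
apply: ler_wpM2l; first exact: sqr_ge0.
by rewrite ler_expR mulrC ler_wpM2l// -[leRHS]mul1r ler_pdivlMr//; lra.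
Qed.

Lemma gam_expR_norm_le u (c : R) : sumsq u = 1%R ->
  \int[gam d]_t (expR (c * `|dotp u t|))%:E <= (2 * expR (c ^+ 2 / 2))%:E.
Proof.
move=> u1; rewrite (gam_dotp u (f := fun x => (expR (c * `|x|))%:E))//.
- under eq_integral do rewrite u1 sqrtr1 mul1r; exact: stdn_expR_norm_le.
- by apply/measurable_EFinP; exact: measurable_expR_norm.
Qed.

Lemma measurable_gam_expR_norm u (c : R) : measurable_fun setT (fun t => expR (c * `|dotp u t|)).
Proof. exact: (measurableT_comp (measurable_expR_norm c) (measurable_dotp u)). Qed.

Lemma gam_cst (k : \bar R) : \int[gam d]_(x in setT) k = k.
Proof. by rewrite integral_cst// [X in _ * X](probability_setT (gam d)) mule1. Qed.

Section Model.
Variables (p : R -> R) (th : 'I_d -> R).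
Hypotheses (mp : measurable_fun setT p) (p01 : forall z, (0 <= p z <= 1)%R).
Hypothesis th1 : sumsq th = 1%R.

Lemma measurable_p_dotp : measurable_fun setT (fun t => p (dotp th t)).
Proof. exact: (measurableT_comp mp (measurable_dotp th)). Qed.

Lemma measurable_row (h : R -> d.-tuple mR -> R) : (forall s, measurable_fun setT (h s)) ->
  measurable_fun setT (fun t => p (dotp th t) * h 1 t + (1 - p (dotp th t)) * h (- 1) t)%R.
Proof.
move=> mh; apply: measurable_funD; apply: measurable_funM => //; first exact: measurable_p_dotp.
by apply: measurable_funB => //; exact: measurable_p_dotp.
Qed.

Lemma corr_integrable : (@stdn R).-integrable setT (fun z : mR => (z * (2 * p z - 1))%:E).
Proof.
apply: (bounded_mul_integrable integrable_stdn_id).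
  by apply: measurable_funB => //; exact: measurable_funM.
by move=> x; have /andP[? ?] := p01 x; rewrite ler_norml; apply/andP; split; lra.
Qed.

(* W ^ 2 carries the indicator of a wrong sign, hence a variance proxy proportional
   to its probability q: this is what yields rates faster than eps ^ -2. *)
Lemma row_mean_mgf u v (l B : R) : sumsq u = 1%R -> sumsq v = 1%R -> (1 <= B)%R ->
  (`|l| * B <= 1)%R -> forall q : R,
  row_mean p th (wrong v) <= q%:E ->
  row_mean p th (fun s t => expR (l * wstat u v s t)) <=
    (expR (l * wmean p th u v + l ^+ 2 * (4 * B ^+ 2 * q + 2048 * expR (- B))))%:E.
Proof.
move=> u1 v1 B1 lB q hq.
pose f1 t := (dotp u t * (2 * p (dotp th t) - 1))%R.
pose f2 t := (dotp u t * sign (dotp v t))%R.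
pose f3 t := (p (dotp th t) * wrong v 1 t + (1 - p (dotp th t)) * wrong v (- 1) t)%R.
pose f4 t := expR (3 * `|dotp u t|).
have if1 : (gam d).-integrable setT (EFin \o f1).
  apply: (bounded_mul_integrable (gam_dotp_integrable u)).
    apply: measurable_funB => //; apply: measurable_funM => //; exact: measurable_p_dotp.
  by move=> x; have /andP[? ?] := p01 (dotp th x); rewrite ler_norml; apply/andP; split; lra.
have if2 : (gam d).-integrable setT (EFin \o f2).
  apply: (bounded_mul_integrable (gam_dotp_integrable u)); first exact: measurable_sign_dotp.
  by move=> x; rewrite norm_sign.
have f30 t : (0 <= f3 t <= 1)%R.
  have /andP[? ?] := p01 (dotp th t); have /andP[? ?] := wrong_ge0 v 1 t.
  by have /andP[? ?] := wrong_ge0 v (- 1) t; rewrite /f3; apply/andP; split; nra.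
have mf3 : measurable_fun setT f3 by apply: measurable_row => s; exact: measurable_wrong.
have if3 : (gam d).-integrable setT (EFin \o f3).
  apply: (measurable_bounded_integrable measurableT) => //.
    by apply: le_lt_trans (ltry 1); exact: probability_le1.
  exists 1%R; split; first exact: num_real.
  move=> x x1 t _; have /andP[? ?] := f30 t; rewrite /= ger0_norm//; lra.
have i4 := gam_expR_norm_le 3 u1.
have if4 : (gam d).-integrable setT (EFin \o f4).
  apply/integrableP; split; first by apply/measurable_EFinP; exact: measurable_gam_expR_norm.
  rewrite (eq_integral (fun t => (expR (3 * `|dotp u t|))%:E)).
    by apply: le_lt_trans i4 _; rewrite ltry.
  by move=> t _; rewrite /= ger0_norm// expR_ge0.
have E1 : \int[gam d]_t (f1 t)%:E = ((\sum_i u i * th i) * corr p)%:E.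
  rewrite (@gam_mean _ _ u th (fun z => 2 * p z - 1)%R)//.
  - by rewrite EFinM /corr fineK//; exact: integrable_fin_num corr_integrable.
  - by apply: measurable_funB => //; exact: measurable_funM.
  - by move=> x; have /andP[? ?] := p01 x; rewrite ler_norml; apply/andP; split; lra.
have E2 : \int[gam d]_t (f2 t)%:E = ((\sum_i u i * v i) * Num.sqrt (2 / pi))%:E.
  rewrite (@gam_mean _ _ u v sign)//.
  - by under eq_integral do rewrite mul_sign; rewrite stdn_norm EFinM.
  - exact: measurable_sign.
  - by move=> x; rewrite norm_sign.
(* Given the row, the response has mean 2 p - 1, so W averages to (f1 - f2) / 2. *)
pose g12 t := (2^-1 * f1 t + (- 2^-1) * f2 t)%R.
pose g34 t := (4 * B ^+ 2 * f3 t + 2 * expR (- B) * f4 t)%R.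
have ig12 : (gam d).-integrable setT (EFin \o g12) by exact: integrable_lin.
have ig34 : (gam d).-integrable setT (EFin \o g34) by exact: integrable_lin.
pose g t := (l * g12 t + l ^+ 2 * g34 t)%R.
have ig : (gam d).-integrable setT (EFin \o g) by exact: integrable_lin.
have i1 : (gam d).-integrable setT (EFin \o (fun=> 1%R : R)).
  exact: finite_measure_integrable_cst.
apply: (@le_trans _ _ (\int[gam d]_t (1 * 1 + 1 * g t)%:E)).
  apply: ge0_le_integral => //.
  - move=> t _; have /andP[p0 p1] := p01 (dotp th t).
    by rewrite lee_fin addr_ge0// mulr_ge0 ?expR_ge0// subr_ge0.
  - apply/measurable_EFinP; apply: (measurable_row (h := fun s t => expR (l * wstat u v s t)%R)) => s.
    apply: measurableT_comp => //.
    apply: measurable_funM => //; apply: measurable_funM; first exact: measurable_dotp.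
    by apply: measurable_funM => //; apply: measurable_funB => //; exact: measurable_sign_dotp.
  - by apply: (measurable_int (gam d)); exact: (integrable_lin i1 ig).
  - move=> t _; rewrite lee_fin; have /andP[p0 p1] := p01 (dotp th t).
    have h1 := expR_wstat_le u v t (or_introl (erefl 1%R)) B1 lB.
    have h2 := expR_wstat_le u v t (or_intror (erefl (- 1)%R)) B1 lB.
    have q0 : (0 <= 1 - p (dotp th t))%R by lra.
    have := lerD (ler_wpM2l p0 h1) (ler_wpM2l q0 h2) => /le_trans; apply.
    rewrite /g /g12 /g34 /f1 /f2 /f3 /f4 /wstat le_eqVlt; apply/orP; left; apply/eqP.
    by field.
rewrite (integral_lin i1 ig) (integral_lin ig12 ig34) (integral_lin if1 if2) (integral_lin if3 if4).
rewrite E1 E2 gam_cst.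
set I3 := \int[gam d]_t (f3 t)%:E; set I4 := \int[gam d]_t (f4 t)%:E.
have hI3 : I3 <= q%:E by exact: hq.
(* E exp(3 |z|) <= 2 e^(9/2) <= 2 * 2^9, from e^(1/2) <= 2; doubled, this is the constant 2048 of
   the statement. *)
have hI4 : I4 <= 1024%:E.
  apply: le_trans i4 _; rewrite lee_fin.
  have := expR_half_nat_le (R := R) 9; rewrite (_ : 3 ^+ 2 = 9%:R :> R)%R; last by ring.
  by rewrite (_ : 2 ^+ 9 = 512 :> R)%R; [lra|ring].
apply: (@le_trans _ _ (1%:E + (l * wmean p th u v + l ^+ 2 * (4 * B ^+ 2 * q + 2048 * expR (- B)))%:E)); last first.
  by rewrite -EFinD lee_fin; exact: expR_ge1Dx.
rewrite !mul1e leeD2l// EFinD; apply: leeD.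
  rewrite -(EFinM 2^-1) -(EFinM (- 2^-1)%R) -EFinD -EFinM lee_fin /wmean le_eqVlt; apply/orP; left; apply/eqP; by field.
rewrite [leRHS]EFinM lee_wpmul2l ?lee_fin ?sqr_ge0// EFinD; apply: leeD.
  rewrite [leRHS]EFinM; apply: lee_wpmul2l => //.
  by rewrite lee_fin; have := sqr_ge0 B; lra.
rewrite (_ : 2048 * expR (- B) = 2 * expR (- B) * 1024)%R; last by ring.
rewrite [leRHS]EFinM; by apply: lee_wpmul2l.
Qed.

Section WrongProbability.
Variables (C beta : R).
Hypotheses (C0 : (0 <= C)%R) (beta0 : (0 < beta)%R).
Hypothesis noise : forall z, (p z * (1 != sign z)%:R + (1 - p z) * (- 1 != sign z)%:R
  <= C * expR (- beta * `|z|))%R.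

Lemma row_mean_wrong v (m B : R) : (0 < m)%R -> (0 < B)%R ->
  (Num.sqrt (sumsq (fun i => th i - v i)) <= m)%R ->
  row_mean p th (wrong v) <= (Num.min 1 (C / beta + B * m + 4 * expR (- B)))%:E.
Proof.
move=> m0 B0 hm; pose dv i := (th i - v i)%R.
have dvE t : dotp dv t = (dotp th t - dotp v t)%R.
  by rewrite /dotp -sumrB; apply: eq_bigr => i _; rewrite mulrBl.
have mrow : measurable_fun setT (fun t => p (dotp th t) * wrong v 1 t + (1 - p (dotp th t)) * wrong v (- 1) t)%R.
  by apply: measurable_row => s; exact: measurable_wrong.
have row01 t : (0 <= p (dotp th t) * wrong v 1 t + (1 - p (dotp th t)) * wrong v (- 1) t <= 1)%R.
  have /andP[? ?] := p01 (dotp th t); have /andP[? ?] := wrong_ge0 v 1 t.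
  by have /andP[? ?] := wrong_ge0 v (- 1) t; apply/andP; split; nra.
(* A wrong sign at v is a wrong sign at th, or a disagreement of the signs at th
   and v; the latter forces |th.t| <= |(th - v).t|, where (th - v).t is Gaussian
   of standard deviation at most m. *)
rewrite EFin_min le_min; apply/andP; split.
  apply: (@le_trans _ _ (\int[gam d]_(t in setT) 1%:E)); last by rewrite gam_cst.
  apply: ge0_le_integral => //.
  - by move=> t _; rewrite lee_fin; case/andP: (row01 t).
  - exact/measurable_EFinP.
  - by move=> t _; rewrite lee_fin; case/andP: (row01 t).
pose a1 (z : R) : R := (C * expR (- beta * `|z|))%R.
pose a2 (z : R) : R := (`|z| <= B * m)%R%:R%R.
(* Exponential Markov bound for the event that |(th - v).t| exceeds B m. Since m > 0 is only an
   upper bound of |th - v|, the case v = th is included. *)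
pose a3 (z : R) : R := (expR (- B) * expR (m^-1 * `|z|))%R.
have ma1 : measurable_fun setT (a1 : mR -> R).
  by apply: measurable_funM => //; exact: measurable_expR_norm.
have ma2 : measurable_fun setT (a2 : mR -> R).
  apply: measurable_bool_natr; apply: measurable_fun_ler => //; exact: measurableT_comp.
have ma3 : measurable_fun setT (a3 : mR -> R).
  by apply: measurable_funM => //; exact: measurable_expR_norm.
have pos1 z : (0 <= a1 z)%R by rewrite mulr_ge0 ?expR_ge0.
have pos3 z : (0 <= a3 z)%R by rewrite mulr_ge0 ?expR_ge0.
have mA1 : measurable_fun setT (fun t => (a1 (dotp th t))%:E).
  by apply/measurable_EFinP; exact: (measurableT_comp ma1 (measurable_dotp th)).
have mA2 : measurable_fun setT (fun t => (a2 (dotp th t))%:E).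
  by apply/measurable_EFinP; exact: (measurableT_comp ma2 (measurable_dotp th)).
have mA3 : measurable_fun setT (fun t => (a3 (dotp dv t))%:E).
  by apply/measurable_EFinP; exact: (measurableT_comp ma3 (measurable_dotp dv)).
apply: (@le_trans _ _ (\int[gam d]_t ((a1 (dotp th t))%:E + (a2 (dotp th t))%:E + (a3 (dotp dv t))%:E))).
  apply: ge0_le_integral => //.
  - by move=> t _; rewrite lee_fin; case/andP: (row01 t).
  - exact/measurable_EFinP.
  - by apply: emeasurable_funD => //; exact: emeasurable_funD.
  - move=> t _; rewrite -!EFinD lee_fin.
    have [sE|sN] := eqVneq (sign (dotp v t)) (sign (dotp th t)).
      rewrite /wrong sE; have := noise (dotp th t); rewrite -/(a1 _).
      have := pos3 (dotp dv t); have : (0 <= a2 (dotp th t))%R by [].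
      lra.
    have zd : (`|dotp th t| <= `|dotp dv t|)%R.
      rewrite dvE; move: sN; rewrite /sign.
      case: (leP 0%R (dotp v t)) => h1; case: (leP 0%R (dotp th t)) => h2; rewrite ?eqxx// => _.
      - by rewrite ltr0_norm// ltr0_norm; lra.
      - by rewrite ger0_norm// ger0_norm; lra.
    have /andP[_ r1] := row01 t; have := pos1 (dotp th t).
    have [zs|zs] := leP `|dotp th t|%R (B * m)%R.
      have -> : a2 (dotp th t) = 1%R by rewrite /a2 zs.
      by have := pos3 (dotp dv t); lra.
    have : (1 <= a3 (dotp dv t))%R.
      rewrite /a3 -expRD -expR0 ler_expR addrC subr_ge0 mulrC ler_pdivlMr//.
      by rewrite ltW// (lt_le_trans zs).
    have : (0 <= a2 (dotp th t))%R by [].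
    lra.
have mA12 := emeasurable_funD mA1 mA2.
have g12 t : setT t -> 0 <= (a1 (dotp th t))%:E + (a2 (dotp th t))%:E.
  by move=> _; rewrite adde_ge0// lee_fin.
have g1 t : setT t -> 0 <= (a1 (dotp th t))%:E by move=> _; rewrite lee_fin.
have g2 t : setT t -> 0 <= (a2 (dotp th t))%:E by move=> _; rewrite lee_fin.
have g3 t : setT t -> 0 <= (a3 (dotp dv t))%:E by move=> _; rewrite lee_fin.
rewrite ge0_integralD//; rewrite ge0_integralD//.
rewrite EFinD EFinD; apply: leeD; first apply: leeD.
- rewrite (gam_dotp th (f := fun z => (a1 z)%:E)); [|exact/measurable_EFinP|by move=> z; rewrite lee_fin].
  rewrite th1 sqrtr1; under eq_integral do rewrite mul1r EFinM.
  rewrite ge0_integralZl//; last by apply/measurable_EFinP; exact: measurable_expR_norm.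
  by rewrite EFinM lee_wpmul2l ?lee_fin// stdn_expR_Nnorm.
- rewrite (gam_dotp th (f := fun z => (a2 z)%:E)); [|exact/measurable_EFinP|by move=> z; rewrite lee_fin].
  rewrite th1 sqrtr1; under eq_integral do rewrite mul1r.
  by apply: stdn_small_ball; rewrite mulr_ge0// ltW.
- rewrite (gam_dotp dv (f := fun z => (a3 z)%:E)); [|exact/measurable_EFinP|by move=> z; rewrite lee_fin].
  apply: (@le_trans _ _ (\int[stdn]_z ((expR (- B))%:E * (expR (1 * `|z|))%:E))).
    apply: ge0_le_integral => //.
    + by move=> z _; rewrite lee_fin.
    + apply/measurable_EFinP; apply: (measurableT_comp ma3); exact: measurable_funM.
    + by apply: emeasurable_funM => //; apply/measurable_EFinP; exact: measurable_expR_norm.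
    + move=> z _; rewrite -EFinM lee_fin /a3 ler_wpM2l ?expR_ge0// ler_expR normrM mul1r mulrA.
      rewrite -[leRHS]mul1r ler_wpM2r// ger0_norm ?sqrtr_ge0// mulrC ler_pdivrMr// mul1r.
      exact: hm.
  rewrite ge0_integralZl//; last by apply/measurable_EFinP; exact: measurable_expR_norm.
  apply: (@le_trans _ _ ((expR (- B))%:E * 4%:E)); last by rewrite -EFinM mulrC.
  rewrite lee_wpmul2l ?lee_fin ?expR_ge0//; apply: le_trans (stdn_expR_norm_le 1) _.
  rewrite lee_fin expr1n div1r; have := @expR_half_le2 R; lra.
Qed.

End WrongProbability.

End Model.

Definition norm1 t : R := (\sum_i `|tnth t i|)%R.
(* The rows at which a perturbation of v of sup norm tau can change the sign. *)
Definition near (tau : R) v t : bool := (`|dotp v t| <= tau * norm1 t)%R.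
(** The price of a flipped sign: the factor (s - sign) / 2 moves by at most 1, hence W by at most
    |<u, t>|, up to the small change of u. *)
Definition vstat (tau : R) u v t : R := (`|dotp u t| * (near tau v t)%:R)%R.

Lemma measurable_norm1 : measurable_fun setT norm1.
Proof.
apply: measurable_sum => i; apply: measurableT_comp => //; exact: measurable_tnth.
Qed.

Lemma norm1_ge0 t : (0 <= norm1 t)%R.
Proof. exact: sumr_ge0. Qed.

Lemma measurable_near tau v : measurable_fun setT (near tau v).
Proof.
apply: measurable_fun_ler.
  by apply: (measurableT_comp (@normr_measurable R setT)); exact: measurable_dotp.
by apply: measurable_funM => //; exact: measurable_norm1.
Qed.

Lemma measurable_vstat tau u v : measurable_fun setT (vstat tau u v).
Proof.
apply: measurable_funM.
  by apply: (measurableT_comp (@normr_measurable R setT)); exact: measurable_dotp.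
by apply: measurable_bool_natr; exact: measurable_near.
Qed.

Lemma gam_norm1 : \int[gam d]_t (norm1 t)%:E <= d%:R%:E.
Proof.
under eq_integral do rewrite /norm1 -sumEFin.
rewrite ge0_integral_sum//; last first.
  move=> i; apply/measurable_EFinP; apply: measurableT_comp => //; exact: measurable_tnth.
apply: (@le_trans _ _ (\sum_(i < d) 1%:E)); last first.
  by rewrite sumEFin sumr_const card_ord.
apply: lee_sum => i _.
pose e (j : 'I_d) : R := (j == i)%:R%R.
have eE t : dotp e t = tnth t i.
  rewrite /dotp (bigD1 i)//= /e eqxx mul1r big1 ?addr0// => j /negbTE ->.
  by rewrite mul0r.
have e1 : sumsq e = 1%R.
  rewrite /sumsq (bigD1 i)//= /e eqxx expr1n big1 ?addr0// => j /negbTE ->.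
  by rewrite expr0n.
under eq_integral do rewrite -eE.
rewrite (gam_dotp e (f := fun x => `|x|%:E))//; last first.
  by apply/measurable_EFinP; exact: (@normr_measurable R setT).
under eq_integral do rewrite e1 sqrtr1 mul1r.
rewrite stdn_norm lee_fin -[leRHS]sqrtr1 ler_sqrt// ler_pdivrMr ?pi_gt0// mul1r.
exact: pi_ge2.
Qed.

(** With tau = sg^2, the event forces |<v, t>| <= sg or sg * |t|_1 >= 1; the first has probability
    at most sg, the second at most sg d by Markov. The loss of a square root is harmless, tau being
    a high power of the small scale. *)
Lemma gam_near v (sg : R) : (0 < sg)%R -> sumsq v = 1%R ->
  \int[gam d]_t ((near (sg ^+ 2) v t)%:R)%:E <= (sg * (1 + d%:R))%:E.
Proof.
move=> sg0 v1.
have mb : measurable_fun setT (fun t => (`|dotp v t| <= sg)%R%:R : R).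
  apply: measurable_bool_natr; apply: measurable_fun_ler => //.
  by apply: (measurableT_comp (@normr_measurable R setT)); exact: measurable_dotp.
apply: (@le_trans _ _ (\int[gam d]_t (((`|dotp v t| <= sg)%R%:R)%:E + sg%:E * (norm1 t)%:E))).
  apply: ge0_le_integral => //.
  - apply/measurable_EFinP; apply: measurable_bool_natr; exact: measurable_near.
  - apply: emeasurable_funD; first exact/measurable_EFinP.
    by apply: emeasurable_funM => //; apply/measurable_EFinP; exact: measurable_norm1.
  - move=> t _; rewrite -EFinM -EFinD lee_fin /near.
    have n0 := norm1_ge0 t.
    have hb (b : bool) : (b%:R <= 1 :> R)%R by case: b.
    have sn : (0 <= sg * norm1 t)%R by rewrite mulr_ge0// ltW.
    have [h1|h1] := leP `|dotp v t|%R sg.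
      by have := hb (`|dotp v t| <= sg ^+ 2 * norm1 t)%R; rewrite mulr1n; lra.
    rewrite mulr0n add0r.
    case: (boolP (`|dotp v t| <= sg ^+ 2 * norm1 t)%R) => h2; rewrite ?mulr0n ?mulr1n//.
    rewrite -(ler_pM2l sg0) mulr1 mulrA -expr2; exact: ltW (lt_le_trans h1 h2).
rewrite ge0_integralD//; last 3 first.
- exact/measurable_EFinP.
- by move=> t _; rewrite mule_ge0// lee_fin ?norm1_ge0// ltW.
- by apply: emeasurable_funM => //; apply/measurable_EFinP; exact: measurable_norm1.
rewrite mulrDr mulr1 EFinD; apply: leeD.
  rewrite (gam_dotp v (f := fun z => ((`|z| <= sg)%R%:R)%:E))//; last first.
    apply/measurable_EFinP; apply: measurable_bool_natr.
    by apply: measurable_fun_ler => //; exact: (@normr_measurable R setT).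
  by under eq_integral do rewrite v1 sqrtr1 mul1r; apply: stdn_small_ball; exact: ltW.
rewrite ge0_integralZl//; last 3 first.
- by apply/measurable_EFinP; exact: measurable_norm1.
- by move=> t _; rewrite lee_fin norm1_ge0.
- by rewrite lee_fin ltW.
by rewrite EFinM lee_wpmul2l ?lee_fin ?(ltW sg0)//; exact: gam_norm1.
Qed.

(** Splitting at |<u, t>| <= B: below, the factor e^B is paid on a rare event; above, e^y <= e^(-B)
    e^(2 y), and 32 = 2 * 2^4 bounds E exp(2 |z|). The exponential moment at parameter 1 is enough,
    since it is already close to 1. *)
Lemma gam_vstat_mgf u v (sg B : R) : (0 < sg)%R -> sumsq u = 1%R -> sumsq v = 1%R ->
  \int[gam d]_t (expR (vstat (sg ^+ 2) u v t))%:E <=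
    (1 + (expR B * (sg * (1 + d%:R)) + 32 * expR (- B)))%:E.
Proof.
move=> sg0 u1 v1.
have mn : measurable_fun setT (fun t => ((near (sg ^+ 2) v t)%:R : R)%:E).
  by apply/measurable_EFinP; apply: measurable_bool_natr; exact: measurable_near.
have me : measurable_fun setT (fun t => (expR (2 * `|dotp u t|))%:E).
  by apply/measurable_EFinP; exact: measurable_gam_expR_norm.
apply: (@le_trans _ _ (\int[gam d]_t (1%:E + ((expR B)%:E * ((near (sg ^+ 2) v t)%:R : R)%:E +
    (expR (- B))%:E * (expR (2 * `|dotp u t|))%:E)))).
  apply: ge0_le_integral => //.
  - by apply/measurable_EFinP; apply: measurableT_comp => //; exact: measurable_vstat.
  - by apply: emeasurable_funD => //; apply: emeasurable_funD; exact: emeasurable_funM.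
  - move=> t _; rewrite -!EFinM -!EFinD lee_fin /vstat.
    have e1 := expR_gt0 B; have e2 := expR_gt0 (- B); have e3 := expR_gt0 (2 * `|dotp u t|)%R.
    case: (near _ _ _); rewrite /= ?mulr0 ?mulr1 ?expR0; last first.
      by rewrite add0r lerDl mulr_ge0// ltW.
    have [h|h] := leP `|dotp u t|%R B.
      have : (expR `|dotp u t| <= expR B)%R by rewrite ler_expR.
      have : (0 <= expR (- B) * expR (2 * `|dotp u t|))%R by rewrite mulr_ge0// ltW.
      lra.
    have : (expR `|dotp u t| <= expR (- B) * expR (2 * `|dotp u t|))%R.
      by rewrite -expRD ler_expR; lra.
    lra.
have mN : measurable_fun setT (fun t => (expR B)%:E * ((near (sg ^+ 2) v t)%:R : R)%:E).
  exact: emeasurable_funM.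
have mE : measurable_fun setT (fun t => (expR (- B))%:E * (expR (2 * `|dotp u t|))%:E).
  exact: emeasurable_funM.
have gN t : setT t -> 0 <= (expR B)%:E * ((near (sg ^+ 2) v t)%:R : R)%:E.
  by move=> _; rewrite mule_ge0// lee_fin expR_ge0.
have gE t : setT t -> 0 <= (expR (- B))%:E * (expR (2 * `|dotp u t|))%:E.
  by move=> _; rewrite mule_ge0// lee_fin expR_ge0.
have mNE := emeasurable_funD mN mE.
have gNE t : setT t -> 0 <= (expR B)%:E * ((near (sg ^+ 2) v t)%:R : R)%:E +
    (expR (- B))%:E * (expR (2 * `|dotp u t|))%:E.
  by move=> tT; rewrite adde_ge0 ?gN ?gE.
rewrite ge0_integralD//; rewrite ge0_integralD//.
rewrite gam_cst EFinD leeD2l// EFinD; apply: leeD.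
  rewrite ge0_integralZl ?lee_fin ?expR_ge0//.
  by rewrite EFinM lee_wpmul2l ?lee_fin ?expR_ge0// gam_near.
rewrite ge0_integralZl ?lee_fin ?expR_ge0//.
rewrite mulrC EFinM lee_wpmul2l ?lee_fin ?expR_ge0//.
apply: le_trans (gam_expR_norm_le 2 u1) _; rewrite lee_fin.
have := expR_half_nat_le (R := R) 4; rewrite (_ : 2 ^+ 2 = 4%:R :> R)%R; last by ring.
by rewrite (_ : 2 ^+ 4 = 16 :> R)%R; [lra|ring].
Qed.

End RowStatistics.

(** * The normal distribution function and the two link functions *)

Section NormalCdf.
Local Open Scope ereal_scope.
Context {R : realType}.
Notation mR := (measurableTypeR R).
Notation leb := (@lebesgue_measure R).

Definition Phi0 (a : R) : R := fine (stdn (R := R) `]-oo, a]%classic).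

Lemma stdnE (A : set mR) : measurable A -> stdn (R := R) A = \int[leb]_(x in A) (phi x)%:E.
Proof. by []. Qed.

Lemma stdn_fin (A : set mR) : measurable A -> (fine (stdn (R := R) A))%:E = stdn (R := R) A.
Proof. by move=> mA; rewrite fineK//; exact: fin_num_measure. Qed.

Lemma Phi0E (a : R) : (Phi0 a)%:E = stdn (R := R) `]-oo, a]%classic.
Proof. by apply: stdn_fin; exact: measurable_itv. Qed.

Lemma stdn_le (A B : set mR) : measurable A -> measurable B -> A `<=` B ->
  stdn (R := R) A <= stdn (R := R) B.
Proof. by move=> mA mB AB; apply: le_measure => //; rewrite inE. Qed.

Lemma stdn_ray (a : R) : (1 - Phi0 a)%:E = stdn (R := R) `]a, +oo[%classic.
Proof.
rewrite EFinB Phi0E.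
have := @probability_setC _ _ _ (@stdn R) _ (measurable_itv `]-oo, a]).
by rewrite setCitvl => ->.
Qed.

Lemma Phi0_ge0 a : (0 <= Phi0 a)%R.
Proof. by rewrite -lee_fin Phi0E; exact: measure_ge0. Qed.

Lemma Phi0_le1 a : (Phi0 a <= 1)%R.
Proof. by rewrite -lee_fin Phi0E; apply: probability_le1; exact: measurable_itv. Qed.

Lemma le_Phi0 a b : (a <= b)%R -> (Phi0 a <= Phi0 b)%R.
Proof.
move=> ab; rewrite -lee_fin !Phi0E; apply: stdn_le; [exact: measurable_itv..|].
by apply: subset_itvl; rewrite bnd_simp.
Qed.

Lemma Phi0N a : Phi0 (- a) = (1 - Phi0 a)%R.
Proof.
apply/EFin_inj; rewrite Phi0E stdn_ray.
have mI (i : interval R) : measurable_fun setT (fun x : mR => (\1_[set` i] x : R)%:E).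
  by apply/measurable_EFinP; apply: measurable_indic; exact: measurable_itv.
have E (i : interval R) : stdn (R := R) [set` i] = \int[stdn]_x (\1_[set` i] x)%:E.
  by rewrite integral_indic ?setIT//; exact: measurable_itv.
transitivity (stdn (R := R) `[a, +oo[%classic).
  rewrite !E -[RHS](stdn_opp (mI _)); last by move=> x; rewrite lee_fin.
  apply: eq_integral => x _; rewrite !indicE !mem_setE !in_itv/= andbT.
  by rewrite lerNr.
rewrite !stdnE; [|exact: measurable_itv..].
by rewrite -integral_itv_obnd_cbnd//; apply: measurable_funTS; apply/measurable_EFinP; exact: measurable_phi.
Qed.

(** The indicator of x > a is at most e^(-a) e^|x|. An exponential bound is preferred to a Gaussian
    one because logistic regression satisfies the same. *)
Lemma Phi0_tail a : (1 - Phi0 a <= 4 * expR (- a))%R.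
Proof.
rewrite -lee_fin stdn_ray.
have mI : measurable (`]a, +oo[%classic : set mR) by exact: measurable_itv.
rewrite (_ : stdn _ = \int[stdn]_x (\1_(`]a, +oo[%classic) x)%:E); last first.
  by rewrite integral_indic// setIT.
apply: (@le_trans _ _ (\int[stdn]_x ((expR (- a))%:E * (expR (1 * `|x|))%:E))).
  apply: ge0_le_integral => //.
  - by apply/measurable_EFinP; exact: measurable_indic.
  - by apply: emeasurable_funM => //; apply/measurable_EFinP; exact: measurable_expR_norm.
  - move=> x _; rewrite -EFinM lee_fin indicE mem_setE in_itv/= andbT -expRD.
    case: ltP => ax; last by rewrite mulr0n expR_ge0.
    rewrite mulr1n mul1r -expR0 ler_expR.
    by have := ler_norm (x : R); lra.
rewrite ge0_integralZl//; last by apply/measurable_EFinP; exact: measurable_expR_norm.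
rewrite mulrC EFinM lee_wpmul2l ?lee_fin ?expR_ge0//; apply: le_trans (stdn_expR_norm_le 1) _.
by rewrite lee_fin expr1n div1r; have := @expR_half_le2 R; lra.
Qed.

Lemma phi_ge_sixth (x : R) : (`|x| <= 1)%R -> (6^-1 <= phi x)%R.
Proof.
move=> x1; rewrite phiE.
have s3 : (3^-1 <= (Num.sqrt (2 * pi))^-1 :> R)%R.
  have p0 : (0 < 2 * pi :> R)%R by rewrite mulr_gt0 ?pi_gt0.
  rewrite lef_pV2 ?posrE ?sqrtr_gt0// (_ : 3 = Num.sqrt (3 ^+ 2))%R ?sqrtr_sqr ?ger0_norm//.
  rewrite -[leRHS](@ger0_norm _ 3)// -sqrtr_sqr ler_sqrt ?sqr_ge0//.
  by have := @pihalf_lt2 R; lra.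
have e2 : (2^-1 <= expR (- (x ^+ 2 / 2)))%R.
  apply: (@le_trans _ _ (expR (- 2^-1)%R)).
    by rewrite expRN lef_pV2 ?posrE ?expR_gt0//; exact: expR_half_le2.
  rewrite ler_expR lerN2; have : (x ^+ 2 <= 1)%R; last lra.
  by rewrite -(real_normK (num_real x)) expr_le1.
have -> : (6^-1 = 3^-1 * 2^-1 :> R)%R by field.
by apply: ler_pM.
Qed.

(** The left-out mass is symmetric, so the difference is the mass of ]-a, a]. The density is at
    least 1/6 on [-1, 1], which gives m / 3; the weaker m / 4 is shared with the logistic link. *)
Lemma Phi0_center a : (0 <= a)%R -> (Num.min a 1%R / 4 <= 2 * Phi0 a - 1)%R.
Proof.
move=> a0; set m := Num.min a 1%R.
have m0 : (0 <= m)%R by rewrite le_min a0 ler01.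
have [ma m1] : (m <= a)%R /\ (m <= 1)%R by rewrite /m !ge_min !lexx orbT.
have -> : (2 * Phi0 a - 1 = Phi0 a - Phi0 (- a))%R by rewrite Phi0N; ring.
rewrite -lee_fin EFinB !Phi0E.
have sE : `]-oo, a]%classic = `]-oo, (- a)%R] `|` `](- a)%R, a]%classic :> set R.
  by rewrite -itv_bndbnd_setU// bnd_simp; lra.
have mI (i : interval R) : measurable ([set` i]%classic : set mR) by exact: measurable_itv.
rewrite sE measureU//; last first.
  by apply/seteqP; split => x //=; rewrite !in_itv/= => -[h1 /andP[h2 _]]; lra.
rewrite addeAC subee ?add0e; last by rewrite fin_num_measure.
apply: (@le_trans _ _ (\int[leb]_(x in `](- m)%R, m]) (6^-1)%:E)).
  rewrite integral_cst//= lebesgue_measure_itv/= lte_fin; case: ifP => h.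
    by rewrite -EFinB -EFinM lee_fin; lra.
  by rewrite mule0 lee_fin; lra.
apply: (@le_trans _ _ (\int[leb]_(x in `](- m)%R, m]) (phi x)%:E)).
  apply: ge0_le_integral => //.
  - by apply: measurable_funTS; apply/measurable_EFinP; exact: measurable_phi.
  - move=> x; rewrite /= in_itv/= => /andP[x1 x2]; rewrite lee_fin phi_ge_sixth//.
    by rewrite ler_norml; apply/andP; split; lra.
rewrite -stdnE//; apply: stdn_le => //.
by move=> x /=; rewrite !in_itv/= => /andP[? ?]; apply/andP; split; lra.
Qed.

End NormalCdf.

Section Link.
Local Open Scope ring_scope.
Context {R : realType}.
Notation mR := (measurableTypeR R).

Lemma prob_one_probit (beta z : R) : prob_one Probit beta z = Phi0 (beta * z).
Proof.
have mI : measurable (`]-oo, (beta * z)]%classic : set mR) by exact: measurable_itv.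
rewrite /prob_one /Phi0 stdnE//.
rewrite -[LHS]/((Num.sqrt (2 * pi))^-1 * fine (\int[lebesgue_measure]_(u in `]-oo, (beta * z)%R]) (expR (- (u ^+ 2 / 2)))%:E)%E).
have s0 : 0 < Num.sqrt (2 * pi) :> R by rewrite sqrtr_gt0 mulr_gt0 ?pi_gt0.
transitivity (fine ((Num.sqrt (2 * pi))^-1%:E * (\int[lebesgue_measure]_(u in `]-oo, (beta * z)%R]) (expR (- (u ^+ 2 / 2)))%:E))%E); last first.
  rewrite -ge0_integralZl//.
  - by congr fine; apply: eq_integral => x _; rewrite phiE EFinM.
  - apply: measurable_funTS; apply/measurable_EFinP; apply: measurableT_comp => //.
    by apply: measurableT_comp => //; apply: measurable_funM => //; exact: measurable_funX.
(* [fine] sends both infinities to 0, so the constant passes through it whether or not the integral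
   is known to be finite. *)
case: (\int[_]_(_ in _) _)%E => [r| |]//=.
- by rewrite mulr0 mulry gtr0_sg ?invr_gt0// mul1e.
- by rewrite mulr0 mulrNy gtr0_sg ?invr_gt0// mul1e.
Qed.

Section Fixed.
Variables (model : glm) (beta : R).
Hypothesis beta0 : 0 < beta.
Let p := prob_one model beta.

Lemma prob_oneN z : p (- z) = 1 - p z.
Proof.
rewrite /p; case: model; last by rewrite !prob_one_probit mulrN Phi0N.
rewrite /prob_one mulrN opprK expRN.
have e0 := expR_gt0 (beta * z).
field.
by apply/andP; split; lra.
Qed.

Lemma prob_one01 z : 0 <= p z <= 1.
Proof.
rewrite /p; case: model; last by rewrite prob_one_probit Phi0_ge0 Phi0_le1.
rewrite /prob_one; have e0 := expR_gt0 (- (beta * z)).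
have e1 : 0 < 1 + expR (- (beta * z)) by lra.
by rewrite invr_ge0 invf_le1// ltW//=; lra.
Qed.

Lemma prob_one_tail z : 0 <= z -> 1 - p z <= 4 * expR (- beta * z).
Proof.
move=> z0; rewrite /p; case: model; last first.
  by rewrite prob_one_probit mulNr; exact: Phi0_tail.
rewrite /prob_one mulNr; set e := expR _; have e0 : 0 < e by exact: expR_gt0.
have -> : 1 - (1 + e)^-1 = e / (1 + e) by field; lra.
by rewrite ler_pdivrMr; nra.
Qed.

Lemma prob_one_center z : 0 <= z -> Num.min (beta * z) 1 / 4 <= 2 * p z - 1.
Proof.
move=> z0; have a0 : 0 <= beta * z by rewrite mulr_ge0// ltW.
rewrite /p; case: model; last by rewrite prob_one_probit; exact: Phi0_center.
rewrite /prob_one; set a := beta * z in a0 *; set m := Num.min a 1.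
have [m0 ma m1] : [/\ 0 <= m, m <= a & m <= 1] by rewrite /m le_min a0 ler01 !ge_min !lexx orbT.
rewrite expRN; have ea := expR_ge1Dx a; set e := expR a in ea *.
have -> : 2 * (1 + e^-1)^-1 - 1 = (e - 1) / (e + 1).
  by field; apply/andP; split; lra.
rewrite ler_pdivlMr; nra.
Qed.

Lemma measurable_prob_one : measurable_fun setT p.
Proof.
apply: nondecreasing_measurable => // x y xy.
have bxy : beta * x <= beta * y by rewrite ler_pM2l.
rewrite /p; case: model; last by rewrite !prob_one_probit; exact: le_Phi0.
rewrite /prob_one; have ex := expR_gt0 (- (beta * x)); have ey := expR_gt0 (- (beta * y)).
rewrite lef_pV2 ?posrE; [|lra|lra].
by rewrite lerD2l ler_expR lerN2.
Qed.

Lemma prob_one_noise z : p z * (1 != sign z)%:R + (1 - p z) * (- 1 != sign z)%:R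
  <= 4 * expR (- beta * `|z|).
Proof.
have n1 : (1 != -1 :> R) by apply/eqP => h; have := @ltr01 R; lra.
rewrite /sign; case: (leP 0 z) => z0.
  by rewrite eqxx eq_sym n1 mulr0 add0r mulr1 ger0_norm//; exact: prob_one_tail.
rewrite eqxx n1 mulr0 addr0 mulr1 ltr0_norm// -[z in p z]opprK prob_oneN.
by apply: prob_one_tail; lra.
Qed.

(** The integrand is even, and on z >= 0 it is at least (b / 4) z min(z, 1) >= (b / 4) (z - 1/4),
    the last step being (z - 1/2)^2 >= 0 when z <= 1. This minorant is affine in |z|, whose mean
    sqrt(2 / pi) >= 7/10 is known, and (7/10 - 1/4) / 4 > 1/10. *)
Lemma corr_ge : Num.min beta 1 / 10 <= corr p.
Proof.
have p01 := prob_one01; have mp := measurable_prob_one.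
set b := Num.min beta 1.
have [b0 bb b1] : [/\ 0 < b, b <= beta & b <= 1] by rewrite /b lt_min beta0 ltr01 !ge_min !lexx orbT.
have ic := corr_integrable mp p01.
have pw z : b / 4 * (`|z| - 4^-1) <= z * (2 * p z - 1).
  wlog z0 : z / 0 <= z.
    move=> H; have [z0|z0] := leP 0 z; first exact: H.
    have := H (- z); rewrite prob_oneN normrN => /(_ _)/le_trans; apply; first by lra.
    by rewrite le_eqVlt; apply/orP; left; apply/eqP; ring.
  rewrite ger0_norm//; have c := prob_one_center z0.
  have h : b * Num.min z 1 <= Num.min (beta * z) 1.
    by rewrite /Num.min; do 2 case: ifP; nra.
  have h2 : z - 4^-1 <= z * Num.min z 1.
    have := sqr_ge0 (z - 2^-1); rewrite sqrrB /Num.min; case: ifP; nra.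
  have h3 := ler_wpM2l (ltW b0) h2; have h4 := ler_wpM2l z0 h; have h5 := ler_wpM2l z0 c.
  nra.
rewrite -lee_fin /corr fineK; last exact: integrable_fin_num ic.
have inrm : (@stdn R).-integrable setT (EFin \o (fun x : mR => `|x| : R)).
  exact: integrable_norm integrable_stdn_id.
have i1 : (@stdn R).-integrable setT (EFin \o (fun=> 1 : R)).
  exact: finite_measure_integrable_cst.
apply: (@le_trans _ _ (\int[stdn]_z (b / 4 * `|z| + (- b / 16) * 1)%:E)%E); last first.
  apply: le_integral => //; first exact: (integrable_lin inrm i1).
  move=> z _; rewrite lee_fin; apply: le_trans (pw z).
  by rewrite le_eqVlt; apply/orP; left; apply/eqP; field.
rewrite (integral_lin inrm i1) stdn_norm stdn_cst -!EFinM -EFinD lee_fin.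
have s7 : 7 / 10 <= Num.sqrt (2 / pi) :> R.
  rewrite -(@ger0_norm _ (7 / 10 : R)) ?divr_ge0// -sqrtr_sqr ler_sqrt; last by rewrite divr_ge0 ?pi_ge0.
  rewrite ler_pdivlMr ?pi_gt0//; have := @pihalf_lt2 R; have := @pi_gt0 R; nra.
nra.
Qed.

End Fixed.
End Link.

(** * Euclidean norm and one step of hard thresholding *)

Section EuclideanNorm.
Context {R : realType} {d : nat}.
Implicit Types u v w x a : 'cV[R]_d.

Definition dotc u v : R := \sum_(i < d) u i 0 * v i 0.

Lemma l2norm_ge0 u : 0 <= l2norm u.
Proof. exact: sqrtr_ge0. Qed.

Lemma l2norm_sqr u : l2norm u ^+ 2 = \sum_(i < d) u i 0 ^+ 2.
Proof. by rewrite sqr_sqrtr// sumr_ge0// => i _; exact: sqr_ge0. Qed.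

Lemma l2norm_eq0 u : l2norm u = 0 -> u = 0.
Proof.
move=> u0; have := l2norm_sqr u; rewrite u0 expr0n/= => /esym/eqP.
rewrite psumr_eq0 => [/allP h|i _]; last exact: sqr_ge0.
apply/matrixP => i j; rewrite ord1 mxE; apply/eqP; rewrite -sqrf_eq0.
exact: h (mem_index_enum i).
Qed.

Lemma l2normZ (c : R) u : l2norm (c *: u) = `|c| * l2norm u.
Proof.
rewrite /l2norm -[X in X * _]sqrtr_sqr -sqrtrM ?sqr_ge0// mulr_sumr; congr Num.sqrt.
by apply: eq_bigr => i _; rewrite mxE exprMn.
Qed.

Lemma l2normN u : l2norm (- u) = l2norm u.
Proof. by rewrite -scaleN1r l2normZ normrN1 mul1r. Qed.

Lemma dotc_cs u v : dotc u v <= l2norm u * l2norm v.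
Proof.
set s := l2norm u; set t := l2norm v.
have s0 := l2norm_ge0 u; have t0 := l2norm_ge0 v; rewrite -/s -/t in s0 t0.
have [s00|sN0] := eqVneq s 0.
  rewrite /dotc (l2norm_eq0 s00) s00 mul0r big1// => i _; by rewrite mxE mul0r.
have [t00|tN0] := eqVneq t 0.
  rewrite /dotc (l2norm_eq0 t00) t00 mulr0 big1// => i _; by rewrite mxE mulr0.
have : 0 <= \sum_(i < d) (t * u i 0 - s * v i 0) ^+ 2.
  by apply: sumr_ge0 => i _; exact: sqr_ge0.
have -> : \sum_(i < d) (t * u i 0 - s * v i 0) ^+ 2 =
    t ^+ 2 * s ^+ 2 - 2 * (t * s) * dotc u v + s ^+ 2 * t ^+ 2.
  rewrite /dotc [X in t ^+ 2 * X](l2norm_sqr u : s ^+ 2 = _).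
  rewrite [X in s ^+ 2 * X](l2norm_sqr v : t ^+ 2 = _).
  rewrite !mulr_sumr -sumrB -big_split/=; apply: eq_bigr => i _; ring.
have st : 0 < t * s by rewrite mulr_gt0// lt_def ?tN0 ?sN0.
by move=> h; rewrite -(ler_pM2l st); nra.
Qed.

Lemma ler_l2normD u v : l2norm (u + v) <= l2norm u + l2norm v.
Proof.
have h := dotc_cs u v; have u0 := l2norm_ge0 u; have v0 := l2norm_ge0 v.
rewrite -(@ler_pXn2r _ 2)// ?nnegrE ?addr_ge0 ?l2norm_ge0// sqrrD !l2norm_sqr.
apply: (@le_trans _ _ (\sum_i u i 0 ^+ 2 + dotc u v *+ 2 + \sum_i v i 0 ^+ 2)).
  rewrite /dotc -sumrMnl -!big_split/=; apply: ler_sum => i _.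
  by rewrite mxE sqrrD.
by rewrite lerD2r lerD2l lerMn2r.
Qed.

Lemma l2norm_distC u v : l2norm (u - v) = l2norm (v - u).
Proof. by rewrite -opprB l2normN. Qed.

Lemma l2norm_coord u i : `|u i 0| <= l2norm u.
Proof.
rewrite -(@ler_pXn2r _ 2)// ?nnegrE ?l2norm_ge0// l2norm_sqr (bigD1 i)//=.
by rewrite real_normK ?num_real// lerDl sumr_ge0// => j _; exact: sqr_ge0.
Qed.

Lemma l2norm_le_sum u : l2norm u <= \sum_(i < d) `|u i 0|.
Proof.
have s0 : 0 <= \sum_(i < d) `|u i 0| by exact: sumr_ge0.
rewrite -(@ler_pXn2r _ 2)// ?nnegrE ?l2norm_ge0// l2norm_sqr expr2 mulr_sumr.
apply: ler_sum => i _; rewrite -[leLHS](real_normK (num_real _)) expr2.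
apply: ler_wpM2r => //; rewrite (bigD1 i)//= lerDl; exact: sumr_ge0.
Qed.

End EuclideanNorm.

Section ThresholdingStep.
Context {R : realType} {d : nat}.
Implicit Types u v w x a : 'cV[R]_d.

(** Exchange argument. The largest discarded square m separates the two sets: indices of S' outside
    S have squares at most m, those of S outside S' at least m, and the latter are at least as many.
    Ties are harmless. *)
Lemma top_k_sum k (S S' : {set 'I_d}) x : #|S| = k -> (#|S'| <= k)%N ->
  (forall i j, i \in S -> j \notin S -> `|x j 0| <= `|x i 0|) ->
  \sum_(i in ~: S) x i 0 ^+ 2 <= \sum_(i in ~: S') x i 0 ^+ 2.
Proof.
move=> Sk S'k top.
pose m := \big[Num.max/0]_(j in ~: S) (x j 0 ^+ 2).
have m0 : 0 <= m by exact: bigmax_ge_id.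
have mj j : j \in ~: S -> x j 0 ^+ 2 <= m by move=> jS; exact: le_bigmax_cond.
have mi i : i \in S -> m <= x i 0 ^+ 2.
  move=> iS; apply: bigmax_le => [|j]; first exact: sqr_ge0.
  rewrite inE => jS; rewrite -(real_normK (num_real (x j 0))) -(real_normK (num_real (x i 0))).
  by rewrite lerXn2r ?nnegrE//; exact: top.
rewrite (big_setID S')/= [leRHS](big_setID S)/=.
have -> : ~: S' :&: S = S :\: S' by apply/setP => i; rewrite !inE andbC.
have -> : ~: S' :\: S = ~: S :\: S' by apply/setP => i; rewrite !inE andbC.
rewrite lerD2r.
apply: (@le_trans _ _ (\sum_(i in ~: S :&: S') m)).
  by apply: ler_sum => i; rewrite inE => /andP[/mj].
apply: (@le_trans _ _ (\sum_(i in S :\: S') m)); last first.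
  by apply: ler_sum => i; rewrite inE => /andP[_ /mi].
rewrite !sumr_const; apply: ler_wpMn2l => //.
have -> : ~: S :&: S' = S' :\: S by apply/setP => i; rewrite !inE.
have h1 := cardsID S' S; have h2 := cardsID S S'.
by rewrite finset.setIC in h2; lia.
Qed.

(* w minimizes |w' - x| among the k-sparse w', hence |w - x| <= |g theta - x|. *)
Lemma top_k_dist k x w (theta : 'cV[R]_d) (g : R) : is_top_k k x w -> (l0norm theta <= k)%N ->
  l2norm (w - g *: theta) ^+ 2 <= 2 * dotc (w - g *: theta) (x - g *: theta).
Proof.
move=> [S [Sk top wE]] th0; set a := g *: theta.
have key : \sum_(i < d) (w i 0 - x i 0) ^+ 2 <= \sum_(i < d) (a i 0 - x i 0) ^+ 2.
  pose S' := [set i : 'I_d | theta i 0 != 0]%SET.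
  have h := top_k_sum Sk (th0 : (#|S'| <= k)%N) top.
  rewrite (bigID (mem S))/= [leRHS](bigID (mem (~: S')))/= big1 ?add0r; last first.
    by move=> i iS; rewrite wE mxE iS subrr expr0n.
  apply: (@le_trans _ _ (\sum_(i in ~: S) x i 0 ^+ 2)).
    rewrite le_eqVlt; apply/orP; left; apply/eqP; apply: eq_big => i; first by rewrite inE.
    by move=> /negbTE iS; rewrite wE mxE iS sub0r sqrrN.
  apply: le_trans h _.
  rewrite -[leLHS]addr0; apply: lerD; last by apply: sumr_ge0 => i _; exact: sqr_ge0.
  apply: ler_sum => i; rewrite !inE negbK => /eqP ti.
  by rewrite /a mxE ti mulr0 sub0r sqrrN.
rewrite l2norm_sqr /dotc mulr_sumr.
rewrite (eq_bigr (fun i => ((w i 0 - x i 0) ^+ 2 - (a i 0 - x i 0) ^+ 2) +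
   2 * ((w - a) i 0 * (x - a) i 0))); last by move=> i _; rewrite !mxE; ring.
by rewrite big_split/= sumrB gerDr subr_le0.
Qed.

Lemma l0norm_top_k k x w (theta : 'cV[R]_d) (g : R) : is_top_k k x w -> (l0norm theta <= k)%N ->
  (l0norm (w - g *: theta) <= k + k)%N.
Proof.
move=> [S [Sk _ wE]] th0.
apply: (@leq_trans #|S :|: [set i : 'I_d | theta i 0 != 0]%SET|); last first.
  rewrite finset.cardsU; apply: leq_trans (leq_subr _ _) _; rewrite Sk; exact: leq_add.
apply: subset_leq_card; apply/fintype.subsetP => i; rewrite !inE wE !mxE.
apply: contraR; rewrite negb_or negbK => /andP[/negbTE -> /eqP ->].
by rewrite mulr0 subrr.
Qed.

Lemma l0normZ (c : R) u : (l0norm (c *: u) <= l0norm u)%N.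
Proof.
apply: subset_leq_card; apply/fintype.subsetP => i; rewrite !inE mxE.
by apply: contraNneq => ->; rewrite mulr0.
Qed.

(** Let a = g theta and N = |w - a|. The vector w - a is 2k-sparse, so [top_k_dist] gives N^2 <= 2 D
    N, hence N <= 2 D. Normalizing w moves it, on the scale of g, by | |w| - g | <= N more, so the
    total is 2 N <= 4 D. The condition [2 * D < g] keeps w away from 0. *)
Lemma top_k_step k x w (theta : 'cV[R]_d) (g D : R) : 0 < g -> 0 <= D -> 2 * D < g ->
  Theta k theta -> is_top_k k x w ->
  (forall u, l2norm u = 1 -> (l0norm u <= k + k)%N -> dotc u (x - g *: theta) <= D) ->
  Theta k (normalize w) /\ l2norm (theta - normalize w) <= 4 * D / g.
Proof.
move=> g0 Dge0 Dg [th1 th0] topw hD; set a := g *: theta.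
have N2 := top_k_dist g topw th0; rewrite -/a in N2.
set N := l2norm (w - a) in N2.
have N0 : 0 <= N by exact: l2norm_ge0.
have ND : N <= 2 * D \/ N = 0.
  have [->|NN0] := eqVneq N 0; [by right|left].
  have Npos : 0 < N by rewrite lt_def NN0.
  have := hD (N^-1 *: (w - a)); rewrite l2normZ ger0_norm ?invr_ge0// mulVf// => /(_ erefl) h.
  have := h (leq_trans (l0normZ _ _) (l0norm_top_k g topw th0)).
  have -> : dotc (N^-1 *: (w - a)) (x - a) = N^-1 * dotc (w - a) (x - a).
    by rewrite /dotc mulr_sumr; apply: eq_bigr => i _; rewrite mxE mulrA.
  rewrite mulrC ler_pdivrMr// => h1.
  have : N * N <= 2 * D * N by rewrite -expr2; nra.
  by rewrite ler_pM2r.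
have an : l2norm a = g by rewrite /a l2normZ th1 mulr1 gtr0_norm.
have t1 : l2norm w <= g + N.
  by rewrite -an addrC; apply: le_trans (ler_l2normD _ _); rewrite subrK.
have t2 : g <= l2norm w + N.
  rewrite -an /N l2norm_distC; apply: le_trans (ler_l2normD _ _); by rewrite addrC subrK.
have D0 : N <= 2 * D.
  by case: ND => // ->; rewrite mulr_ge0.
have wpos : 0 < l2norm w by lra.
split.
  split; first by rewrite /normalize l2normZ gtr0_norm ?invr_gt0// mulVf// gt_eqF.
  have [S [Sk _ wE]] := topw; apply: leq_trans (l0normZ _ _) _; rewrite -Sk.
  apply: subset_leq_card; apply/fintype.subsetP => i; rewrite inE wE mxE.
  by case: (i \in S) => //; rewrite eqxx.
rewrite ler_pdivlMr// mulrC -[g in g * _](gtr0_norm g0) -l2normZ scalerBr -/a.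
have -> : a - g *: normalize w = (a - w) + (1 - g / l2norm w) *: w.
  by rewrite /normalize scalerA scalerBl scale1r addrA subrK.
apply: le_trans (ler_l2normD _ _) _; rewrite l2norm_distC -/N l2normZ.
have -> : `|1 - g / l2norm w| * l2norm w = `|l2norm w - g|.
  rewrite -[X in _ * X](gtr0_norm wpos) -normrM mulrBl mul1r divfK ?gt_eqF//.
have : `|l2norm w - g| <= N by rewrite ler_norml; apply/andP; split; lra.
lra.
Qed.

End ThresholdingStep.

(** * The error recursion and its limit *)

Section ErrorSequence.
Context {R : realType}.
Variable eps : R.
Hypothesis eps01 : 0 < eps < 1.

Definition err_bound (t : nat) : R := 2 `^ (2 ^- t) * eps `^ (1 - 2 ^- t).

Lemma err_bound0 : err_bound 0 = 2.
Proof. by rewrite /err_bound expr0 invr1 subrr powRr1// powRr0 mulr1. Qed.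

Lemma err_boundS t : err_bound t.+1 = Num.sqrt (eps * err_bound t).
Proof.
have /andP[e0 _] := eps01.
rewrite -powR12_sqrt ?mulr_ge0 ?powR_ge0 ?(ltW e0)//.
rewrite /err_bound mulrCA powRM ?powR_ge0 ?mulr_ge0 ?(ltW e0)//; last first.
  exact: powR_ge0.
rewrite -powRrM -{2}(powRr1 (ltW e0)) -powRD; last by rewrite (gt_eqF e0) implybT.
rewrite -powRrM exprS invfM; congr (_ `^ _ * _ `^ _); first by rewrite mulrC.
by field; rewrite expf_neq0.
Qed.

Lemma err_bound_ge t : eps <= err_bound t.
Proof.
have /andP[e0 e1] := eps01.
elim: t => [|t IH]; first by rewrite err_bound0; lra.
rewrite err_boundS -{1}(ger0_norm (ltW e0)) -sqrtr_sqr ler_sqrt.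
  by rewrite expr2 ler_pM2l.
by rewrite mulr_ge0 ?(ltW e0)// (le_trans (ltW e0) IH).
Qed.

(** By the inequality of arithmetic and geometric means, sqrt(eps D) <= (eps + D) / 2, so the excess
    over eps is at least halved at each step. This yields the upper limit without limits of real
    powers. *)
Lemma err_bound_le t : err_bound t <= eps + 2 * 2 ^- t.
Proof.
have /andP[e0 e1] := eps01.
elim: t => [|t IH]; first by rewrite err_bound0 expr0 invr1; lra.
have h := err_bound_ge t; set D := err_bound t in IH h.
apply: (@le_trans _ _ ((eps + D) / 2)); last first.
  by rewrite exprS invfM; lra.
rewrite err_boundS -/D.
have m0 : 0 <= (eps + D) / 2 by lra.
rewrite -[leRHS](ger0_norm m0) -sqrtr_sqr ler_sqrt ?sqr_ge0//.
have := sqr_ge0 (eps - D); nra.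
Qed.

Lemma limn_esup_err (x : nat -> R) : (forall t, x t <= err_bound t) ->
  (limn_esup (fun t => (x t)%:E) <= eps%:E)%E.
Proof.
move=> xt.
have cv : (fun t => (eps + 2 * 2 ^- t)%:E) @ \oo --> eps%:E.
  apply: cvg_EFin; first by near=> t.
  rewrite -[X in _ --> X]addr0; apply: cvgD; first exact: cvg_cst.
  rewrite -[X in _ --> X](mulr0 2); apply: cvgM; first exact: cvg_cst.
  under eq_fun do rewrite -exprVn.
  apply: cvg_expr; rewrite ger0_norm ?invr_ge0//; lra.
rewrite -(cvg_limn_einf_sup cv).2 !limn_esup_lim; apply: lee_lim; [exact: is_cvg_esups..|].
apply: nearW => n; apply: ge_ereal_sup => _ [m nm <-].
apply: (@le_trans _ _ (eps + 2 * 2 ^- m)%:E).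
  by rewrite lee_fin; exact: le_trans (xt m) (err_bound_le m).
by apply: ereal_sup_ubound; exists m.
Unshelve. all: by end_near. Qed.

End ErrorSequence.

(** * A finite net of sparse unit vectors *)

Section SparseNet.
Context {R : realType} {d : nat}.
Implicit Types u v : 'cV[R]_d.
Variables (N K : nat).
Hypothesis N0 : (0 < N)%N.

(** A code lists K coordinates covering the support, repetitions allowed, each with its value in
    [-1, 1] rounded to a grid of step 1 / N, which has 2 N + 1 points. *)
Let code := {ffun 'I_K -> 'I_d * 'I_(N.*2).+1}.

Let rnd (x : R) : 'I_(N.*2).+1 := inord (Num.truncn (N%:R * (x + 1))).

Let rnd_dist (x y : R) : `|x| <= 1 -> `|y| <= 1 -> rnd x = rnd y -> `|x - y| <= N%:R^-1.
Proof.
have NR : 0 < N%:R :> R by rewrite ltr0n.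
have bnd (z : R) : `|z| <= 1 -> 0 <= N%:R * (z + 1) /\ (Num.truncn (N%:R * (z + 1)%R) < (N.*2).+1)%N.
  rewrite ler_norml => /andP[z1 z2]; have z0 : 0 <= N%:R * (z + 1) by rewrite mulr_ge0//; lra.
  split=> //; rewrite ltnS -(ler_nat R); have /andP[h _] := truncn_itv z0.
  apply: le_trans h _; rewrite -muln2 natrM ler_pM2l//; lra.
move=> /bnd[x0 xN] /bnd[y0 yN] /(congr1 val); rewrite /= !inordK// => E.
have /andP[a1 a2] := truncn_itv x0; have /andP[b1 b2] := truncn_itv y0.
rewrite -E -natr1 in b1 b2; rewrite -natr1 in a2.
rewrite -[leRHS]mul1r ler_pdivlMr// -[X in _ * X](gtr0_norm NR) -normrM ler_norml.
by apply/andP; split; lra.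
Qed.

Let describes (c : code) u := (forall i, u i 0 != 0 -> exists j, (c j).1 = i) /\
  (forall j, rnd (u (c j).1 0) = (c j).2).

Let cell (c : code) : set 'cV[R]_d := [set v | l2norm v = 1 /\ describes c v].

(* Representatives of the nonempty cells, rather than their centres, are unit
   vectors. *)
Lemma sparse_net : exists net : seq 'cV[R]_d,
  [/\ (size net <= (d * (N.*2).+1) ^ K)%N, forall v, v \in net -> l2norm v = 1
    & forall u, l2norm u = 1 -> (l0norm u <= K)%N ->
        exists2 v, v \in net & forall i, `|u i 0 - v i 0| <= N%:R^-1].
Proof.
exists [seq xget 0 (cell c) | c <- enum {: code} & `[< cell c !=set0 >]]; split.
- rewrite size_map size_filter (leq_trans (count_size _ _))// -cardE card_ffun card_prod !card_ord.
  by [].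
- move=> v /mapP[c]; rewrite mem_filter => /andP[/asboolP [w cw] _] ->.
  by have [] := xgetPex 0 (ex_intro _ w cw).
move=> u u1 uK; pose S := [set i : 'I_d | u i 0 != 0]%SET.
have [i0 i0S] : exists i0, i0 \in S.
  have [S0|/set0Pn//] := eqVneq S finset.set0.
  have : u = 0.
    apply/matrixP => i j; rewrite ord1 mxE; have : i \notin S by rewrite S0 inE.
    by rewrite inE negbK => /eqP.
  by move=> u0; move: u1; rewrite u0 /l2norm big1 ?sqrtr0 => [/esym/eqP|i _]; rewrite ?oner_eq0 ?mxE ?expr0n.
(* The support may have fewer than K elements; the list is then padded with [i0], an index of the
   support. *)
pose c : code := [ffun j : 'I_K => let i := nth i0 (enum S) j in (i, rnd (u i 0))].
have cu : cell c u.
  split=> //; split=> [i ui|j]; last by rewrite ffunE.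
  have iS : i \in enum S by rewrite mem_enum inE.
  have hK : (index i (enum S) < K)%N.
    by apply: leq_trans uK; rewrite /l0norm cardE index_mem.
  by exists (Ordinal hK); rewrite ffunE/= nth_index.
exists (xget 0 (cell c)).
  by apply/mapP; exists c => //; rewrite mem_filter mem_enum andbT; apply/asboolP; exists u.
have [v1 [vs vr]] := xgetPex 0 (ex_intro _ u cu).
set v := xget 0 (cell c) in v1 vs vr *; have [_ [us ur]] := cu.
have crd w : l2norm w = 1 -> forall i, `|w i 0| <= 1 by move=> <- i; exact: l2norm_coord.
(* Outside the list both vectors vanish; on it their entries round to the same grid point. *)
move=> i; have [ui|ui] := eqVneq (u i 0) 0; have [vi|vi] := eqVneq (v i 0) 0.
- by rewrite ui vi subrr normr0 invr_ge0.
- have [j ji] := vs _ vi; apply: rnd_dist; [exact: crd|exact: crd|].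
  by rewrite -ji ur vr.
- have [j ji] := us _ ui; apply: rnd_dist; [exact: crd|exact: crd|].
  by rewrite -ji ur vr.
- have [j ji] := us _ ui; apply: rnd_dist; [exact: crd|exact: crd|].
  by rewrite -ji ur vr.
Qed.

End SparseNet.

(** * Union bounds, the law of the rows of X, and sums over observations *)

Section UnionBound.
Local Open Scope ereal_scope.
Context d (T : measurableType d) (R : realType) (mu : {measure set T -> \bar R}).

Lemma measurable_bigsetU (I : Type) (s : seq I) (A : I -> set T) :
  (forall i, measurable (A i)) -> measurable (\big[setU/set0]_(i <- s) A i).
Proof. by move=> mA; elim/big_ind: _ => //; exact: measurableU. Qed.

Lemma measure_bigsetU_le (I : Type) (s : seq I) (A : I -> set T) :
  (forall i, measurable (A i)) ->
  mu (\big[setU/set0]_(i <- s) A i) <= \sum_(i <- s) mu (A i).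
Proof.
move=> mA; elim: s => [|i s IH]; first by rewrite !big_nil measure0.
rewrite !big_cons; apply: (@le_trans _ _ (mu (A i) + mu (\big[setU/set0]_(j <- s) A j))).
  by apply: measureU2 => //; exact: measurable_bigsetU.
exact: leeD2l.
Qed.

End UnionBound.

Section MatrixRows.
Context {R : realType} {n d : nat}.
Notation mR := (measurableTypeR R).

(** Passes from matrices, which carry the Borel sets of their topology, to tuples, which carry the
    product sigma-algebra of [pow_prob]. *)
Definition rows (M : 'M[R]_(n, d)) : n.-tuple (d.-tuple mR) :=
  [tuple [tuple (M i j : mR) | j < d] | i < n].

Lemma measurable_coord (i : 'I_n) (j : 'I_d) :
  measurable_fun setT (fun M : g_sigma_algebraType (@open 'M[R]_(n, d)) => (M : 'M[R]_(n, d)) i j : R).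
Proof.
apply: (measurability (@RGenOpens.G R)) => [|_ [_ [x [y ->]] <-]].
  exact: RGenOpens.measurableE.
rewrite setTI; apply: sub_sigma_algebra.
apply: (@open_comp 'M[R]_(n, d) R (fun M => M i j)); last exact: interval_open.
by move=> M _; exact: coord_continuous.
Qed.

Lemma measurable_rows :
  measurable_fun setT (rows : g_sigma_algebraType (@open 'M[R]_(n, d)) -> _).
Proof.
apply/measurable_fun_tnthP => i; apply/measurable_fun_tnthP => j.
rewrite (_ : _ \o _ = (fun M : 'M[R]_(n, d) => M i j)); first exact: measurable_coord.
by apply/funext => M /=; rewrite /rows !tnth_mktuple.
Qed.

Lemma dotp_row (v : 'cV[R]_d) (M : 'M[R]_(n, d)) i :
  dotp (fun j => v j 0) (tnth (rows M) i) = (M *m v) i 0.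
Proof.
rewrite /dotp mxE; apply: eq_bigr => j _; rewrite /rows !tnth_mktuple mulrC //.
Qed.

End MatrixRows.

Section RowsLaw.
Local Open Scope ereal_scope.
Context {R : realType} {disp : measure_display} {Omega : measurableType disp}.
Notation mR := (measurableTypeR R).
Variables (P : probability Omega R) (n d : nat) (X : Omega -> 'M[R]_(n, d)).
Hypothesis gX : iid_gaussian_mx P X.

Lemma measurable_rowsX : measurable_fun setT (fun w => rows (X w)).
Proof.
have mX : measurable_fun setT (X : Omega -> g_sigma_algebraType (@open 'M[R]_(n, d))).
  by move=> _ B mB; rewrite setTI; exact: gX.1.
exact: (measurableT_comp (@measurable_rows R n d) mX).
Qed.

Definition rowsX_mfun : {mfun Omega >-> n.-tuple (d.-tuple mR)} :=
  mfun_Sub (mem_set measurable_rowsX).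

Lemma rows_law (B : set (n.-tuple (d.-tuple mR))) : measurable B ->
  distribution P rowsX_mfun B = pow_prob (gam d) n B.
Proof.
pose G := [set B : set (d.-tuple mR) | exists2 A : 'I_d -> set mR, (forall i, measurable (A i)) & B = box A].
have mG0 : @measurable _ mR = <<s @measurable _ mR >>.
  by rewrite sigma_algebra_id//; exact: sigma_algebra_measurable.
have IG0 : setI_closed (@measurable _ mR) by move=> A1 A2; exact: measurableI.
have mG : @measurable _ (d.-tuple mR) = <<s G>> by exact: (measurable_tuple_box mG0 measurableT).
apply: (pow_prob_unique mG).
- by exists (fun=> setT) => //; apply/seteqP; split.
- exact: setI_closed_box.
move=> A GA.
have [a ha] := @choice _ _ (fun i (a : 'I_d -> set mR) => (forall j, measurable (a j)) /\ A i = box a)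
  (fun i => let: ex_intro2 a h1 h2 := GA i in ex_intro _ a (conj h1 h2)).
transitivity (P [set w | forall i j, a i j (X w i j)]).
  rewrite /distribution /pushforward; congr (P _); apply/seteqP; split => w /=.
    move=> h i j; have := h i; rewrite (ha i).2 => /(_ j).
    by rewrite /rows !tnth_mktuple.
  by move=> h i; rewrite (ha i).2 => j; rewrite /rows !tnth_mktuple; exact: h.
rewrite (gX.2 (fun i j => a i j)); last by move=> i j; exact: (ha i).1.
apply: eq_bigr => i _; rewrite (ha i).2 [RHS]pow_prob_box//; exact: (ha i).1.
Qed.

Lemma ge0_integral_rows (f : n.-tuple (d.-tuple mR) -> \bar R) : measurable_fun setT f ->
  (forall t, 0 <= f t) -> \int[P]_w f (rows (X w)) = \int[pow_prob (gam d) n]_t f t.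
Proof.
move=> mf f0; transitivity (\int[distribution P rowsX_mfun]_t f t).
  by rewrite ge0_integral_distribution.
by apply: eq_measure_integral => B mB _; exact: rows_law.
Qed.

Lemma integral_rows_prod (g : 'I_n -> d.-tuple mR -> \bar R) :
  (forall i, measurable_fun setT (g i)) -> (forall i x, 0 <= g i x) ->
  \int[P]_w \prod_(i < n) g i (tnth (rows (X w)) i) = \prod_(i < n) \int[gam d]_t g i t.
Proof.
move=> mg g0; rewrite -integral_pow_prod//.
apply: (ge0_integral_rows (f := fun t => \prod_(i < n) g i (tnth t i))).
  apply: (emeasurable_prod (g := fun i (t : n.-tuple (d.-tuple mR)) => g i (tnth t i))) => i.
  by apply: (measurableT_comp (mg i)); exact: measurable_tnth.
by move=> t; exact: prode_ge0E.
Qed.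

Lemma integral_row (i : 'I_n) (f : d.-tuple mR -> \bar R) : measurable_fun setT f ->
  (forall t, 0 <= f t) -> \int[P]_w f (tnth (rows (X w)) i) = \int[gam d]_t f t.
Proof.
move=> mf f0; pose g (j : 'I_n) t := if j == i then f t else 1.
have mg j : measurable_fun setT (g j) by rewrite /g; case: (j == i).
have g0 j t : 0 <= g j t by rewrite /g; case: (j == i).
have := integral_rows_prod mg g0.
rewrite [RHS](bigD1 i)//= [X in _ * X]big1 ?mule1; last first.
  by move=> j /negbTE ji; rewrite /g ji gam_cst.
rewrite {2}/g eqxx => <-; apply: eq_integral => w _.
by rewrite (bigD1 i)//= big1 ?mule1 /g ?eqxx// => j /negbTE ->.
Qed.

(** Markov suffices: the level K = 2 d / rho that it imposes is polynomial in the parameters, and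
    multiplies the mesh of the net, which can be taken much smaller. *)
Lemma rows_norm1_tail (K : R) : (0 < n)%N -> (0 < K)%R ->
  measurable [set w | (K * n%:R <= \sum_(i < n) norm1 (tnth (rows (X w)) i))%R] /\
  P [set w | (K * n%:R <= \sum_(i < n) norm1 (tnth (rows (X w)) i))%R] <= (d%:R / K)%:E.
Proof.
move=> n0 K0; set S := fun w => (\sum_(i < n) norm1 (tnth (rows (X w)) i))%R.
have mS1 i : measurable_fun setT (fun w => norm1 (tnth (rows (X w)) i)).
  apply: (measurableT_comp (@measurable_norm1 R d)).
  by apply: (measurableT_comp (measurable_tnth i)); exact: measurable_rowsX.
have mS : measurable_fun setT S by apply: measurable_sum => i; exact: mS1.
have S0 w : (0 <= S w)%R by apply: sumr_ge0 => i _; exact: norm1_ge0.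
have nK : (0 < K * n%:R)%R by rewrite mulr_gt0// ltr0n.
have mE : measurable [set w | (K * n%:R <= S w)%R].
  by rewrite -[X in measurable X]setTI; exact: measurable_fun_le.
split => //.
have h : (K * n%:R)%:E * P [set w | (K * n%:R <= S w)%R] <= (n%:R * d%:R)%:E.
  apply: (@le_trans _ _ (\int[P]_w (S w)%:E)).
    rewrite -[P _]mul1e -[X in X * P _]/(1%:E) -integral_cst// -ge0_integralZl//; last by rewrite lee_fin ltW.
    rewrite integral_mkcond; apply: ge0_le_integral => //.
    + by move=> w _; rewrite patchE; case: ifP => //; rewrite mule1 lee_fin ltW.
    + by apply/(measurable_restrictT _ _).1.
    + exact/measurable_EFinP.
    + by move=> w _; rewrite patchE; case: ifP => [|_]; [rewrite inE mule1 lee_fin|rewrite lee_fin].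
  under eq_integral do rewrite /S -sumEFin.
  rewrite ge0_integral_sum//; last 2 first.
  - by move=> i; exact/measurable_EFinP.
  - by move=> i w _; rewrite lee_fin norm1_ge0.
  apply: (@le_trans _ _ (\sum_(i < n) d%:R%:E)); last first.
    by rewrite sumEFin sumr_const card_ord lee_fin mulr_natl.
  apply: lee_sum => i _; rewrite (integral_row i (f := fun t => (norm1 t)%:E)).
  - exact: gam_norm1.
  - by apply/measurable_EFinP; exact: measurable_norm1.
  - by move=> t; rewrite lee_fin norm1_ge0.
have : P [set w | (K * n%:R <= S w)%R] \is a fin_num by exact: fin_num_measure.
move: h; case: (P _) => // r + _; rewrite -EFinM !lee_fin => h.
rewrite ler_pdivlMr// -(ler_pM2l (_ : 0 < n%:R :> R)%R) ?ltr0n//; nra.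
Qed.

Section Response.
Variables (p : R -> R) (th : 'cV[R]_d) (y : Omega -> 'cV[R]_n).
Hypotheses (mp : measurable_fun setT p) (p01 : forall z, (0 <= p z <= 1)%R).
Hypothesis yp : glm_response P p th X y.
Let thf j := th j 0%R.

Let sv (s : {ffun 'I_n -> bool}) : 'cV[R]_n := \col_i (if s i then 1 else - 1)%R.

Lemma y_sv w : exists s, y w = sv s.
Proof.
have [_ y1 _] := yp; exists [ffun i => y w i 0%R == 1%R].
apply/matrixP => i j; rewrite ord1 mxE ffunE.
by case: eqP => // yn; case: (y1 w i) => //.
Qed.

(** The response law is known only on the events {X in B, y = s}, so the event is split over the 2^n
    sign vectors s, and on each piece the indicator is bounded by exp(sum - T). The sum over s of
    products over rows is a product over rows of two-term sums, and the independence of the rows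
    turns its mean into a product of factors at most M. *)
Lemma stat_sum_tail (h : R -> d.-tuple mR -> R) (T M : R) :
  (forall s, measurable_fun setT (h s)) ->
  row_mean p thf (fun s t => expR (h s t)) <= M%:E ->
  measurable [set w | (T <= \sum_(i < n) h (y w i 0%R) (tnth (rows (X w)) i))%R] /\
  P [set w | (T <= \sum_(i < n) h (y w i 0%R) (tnth (rows (X w)) i))%R] <=
    (expR (- T) * M ^+ n)%:E.
Proof.
move=> mh hM; have [my y1 yE] := yp.
pose B s : set 'M[R]_(n, d) := [set A | (T <= \sum_(i < n) h (sv s i 0%R) (tnth (rows A) i))%R].
have mB s : borel_mx (B s).
  have mF : measurable_fun setT (fun A : g_sigma_algebraType (@open 'M[R]_(n, d)) =>
      \sum_(i < n) h (sv s i 0%R) (tnth (rows (A : 'M[R]_(n, d))) i))%R.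
    apply: measurable_sum => i; apply: (measurableT_comp (mh _)).
    by apply: (measurableT_comp (measurable_tnth i)); exact: measurable_rows.
  have := @measurable_fun_le _ _ R _ _ _ measurableT (measurable_cst T) mF.
  by rewrite setTI.
have EE : [set w | (T <= \sum_(i < n) h (y w i 0%R) (tnth (rows (X w)) i))%R] =
    \big[setU/set0]_(s <- enum {: {ffun 'I_n -> bool}}) (X @^-1` B s `&` y @^-1` [set sv s]).
  apply/seteqP; split => w /=.
    move=> hw; have [s ys] := y_sv w; rewrite -bigcup_seq; exists s; first by rewrite /= mem_enum.
    by split; [rewrite /preimage /B /= -ys|exact: ys].
  by rewrite -bigcup_seq => -[s _ [/= hw ->]].
have mys s : measurable (y @^-1` [set sv s]).
  apply: my; rewrite (_ : [set sv s] = ~` (~` [set sv s])); last by rewrite setCK.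
  apply: (@measurableC _ (g_sigma_algebraType (@open 'M[R]_(n, 1)))).
  apply: sub_sigma_algebra; rewrite openC; exact: accessible_closed_set1 (hausdorff_accessible (@norm_hausdorff _ _)) _.
have mXB s : measurable (X @^-1` B s) by exact: gX.1.
have mEs s : measurable (X @^-1` B s `&` y @^-1` [set sv s]) by exact: measurableI.
rewrite EE; split; first exact: measurable_bigsetU.
apply: le_trans (measure_bigsetU_le P _ mEs) _.
pose f (i : 'I_n) (b : bool) (t : d.-tuple mR) : R :=
  ((if b then p (dotp thf t) else 1 - p (dotp thf t)) * expR (h (if b then 1%R else (- 1)%R) t))%R.
have f0 i b t : (0 <= f i b t)%R.
  rewrite mulr_ge0 ?expR_ge0//; have /andP[? ?] := p01 (dotp thf t).
  by case: b; rewrite ?subr_ge0.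
have mf i b : measurable_fun setT (f i b).
  apply: measurable_funM; last exact: measurableT_comp.
  by case: b; [|apply: measurable_funB => //]; exact: measurable_p_dotp.
have n1 : (1 == - 1 :> R)%R = false by apply/eqP; have := @ltr01 R; lra.
pose rw w i := tnth (rows (X w)) i.
have mrw i : measurable_fun setT (rw ^~ i).
  by apply: (measurableT_comp (measurable_tnth i)); exact: measurable_rowsX.
have mprod s : measurable_fun setT (fun w => \prod_(i < n) f i (s i) (rw w i))%R.
  apply: measurable_prod => i _; exact: (measurableT_comp (mf i (s i)) (mrw i)).
apply: (@le_trans _ _ (\sum_(s <- enum {: {ffun 'I_n -> bool}})
    \int[P]_w (expR (- T) * \prod_(i < n) f i (s i) (rw w i))%:E)).
  apply: lee_sum => s _.
  have spm i : sv s i 0%R = 1%R \/ sv s i 0%R = (- 1)%R.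
    by rewrite mxE; case: (s i); [left|right].
  have svE i : sv s i 0%R = (if s i then 1%R else (- 1)%R) by rewrite mxE.
  have n1' : (- 1 == 1 :> R)%R = false by rewrite eq_sym.
  have hP := yE _ _ (mB s) spm.
  apply: le_trans (_ : \int[P]_(w in X @^-1` B s)
    (\prod_(i < n) resp_prob p ((X w *m th) i 0%R) (sv s i 0%R))%:E <= _).
    by rewrite le_eqVlt; apply/orP; left; apply/eqP; exact: hP.
  rewrite integral_mkcond; apply: ge0_le_integral => //.
  - move=> w _; rewrite patchE; case: ifP => // _; rewrite lee_fin prodr_ge0// => i _.
    rewrite /resp_prob; case: ifP => _; have /andP[? ?] := p01 ((X w *m th) i 0%R) => //.
    by rewrite subr_ge0.
  - apply/(measurable_restrictT _ _).1 => //; apply: measurable_funTS; apply/measurable_EFinP.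
    apply: measurable_prod => i _; rewrite svE /resp_prob.
    rewrite (_ : (fun w => _) = (fun w => if s i then p (dotp thf (rw w i)) else 1 - p (dotp thf (rw w i)))%R).
      by case: (s i); [|apply: measurable_funB => //];
        apply: (measurableT_comp (measurable_p_dotp thf mp)).
    apply/funext => w; rewrite /rw (dotp_row th).
    by case: (s i); rewrite ?eqxx ?n1'.
  - by apply/measurable_EFinP; apply: measurable_funM.
  - move=> w _; rewrite patchE; case: ifPn => [|_]; last first.
      by rewrite lee_fin mulr_ge0 ?expR_ge0// prodr_ge0.
    rewrite inE /= => hw; rewrite lee_fin.
    rewrite [X in (_ <= expR _ * X)%R](_ : _ = (\prod_(i < n) resp_prob p ((X w *m th) i 0%R) (sv s i 0%R)) *
        expR (\sum_(i < n) h (sv s i 0%R) (rw w i)))%R; last first.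
      rewrite expR_sum -big_split/=; apply: eq_bigr => i _; rewrite /f svE /rw (dotp_row th) /resp_prob.
      by case: (s i); rewrite ?eqxx ?n1'.
    rewrite mulrCA -expRD ler_peMr//.
      rewrite prodr_ge0// => i _; rewrite /resp_prob; case: ifP => _; have /andP[? ?] := p01 ((X w *m th) i 0%R) => //.
      by rewrite subr_ge0.
    by rewrite -expR0 ler_expR addrC subr_ge0.
rewrite -ge0_integral_sum//; last 2 first.
- by move=> s; apply/measurable_EFinP; apply: measurable_funM.
- by move=> s w _; rewrite lee_fin mulr_ge0 ?expR_ge0// prodr_ge0.
pose m t : R := (p (dotp thf t) * expR (h 1 t) + (1 - p (dotp thf t)) * expR (h (- 1) t))%R.
have mE i t : m t = (\sum_(b : bool) f i b t)%R.
  by rewrite big_bool /f/=.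
rewrite (eq_integral (fun w => (expR (- T))%:E * \prod_(i < n) (m (rw w i))%:E)); last first.
  move=> w _; rewrite sumEFin -mulr_sumr EFinM prodEFin; congr (_ * _%:E).
  rewrite big_enum/=; transitivity (\prod_(i < n) \sum_(b : bool) f i b (rw w i))%R.
    by rewrite bigA_distr_bigA.
  by apply: eq_bigr => i _; rewrite -mE.
have m0 t : (0 <= m t)%R.
  have /andP[? ?] := p01 (dotp thf t).
  by rewrite addr_ge0// mulr_ge0 ?expR_ge0// subr_ge0.
have mm : measurable_fun setT (fun t => (m t)%:E).
  apply/measurable_EFinP.
  apply: (measurable_row thf mp (h := fun s t => expR (h s t))) => s.
  exact: measurableT_comp.
rewrite ge0_integralZl//; last 2 first.
- apply: (emeasurable_prod (g := fun i w => (m (rw w i))%:E)) => i.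
  exact: (measurableT_comp mm (mrw i)).
- by move=> w _; apply: prode_ge0E => i; rewrite lee_fin.
rewrite (integral_rows_prod (g := fun=> fun t => (m t)%:E))//.
rewrite EFinM lee_wpmul2l ?lee_fin ?expR_ge0//.
apply: (@le_trans _ _ (\prod_(i < n) M%:E)); last first.
  by rewrite prodEFin prodr_const card_ord.
suff [] : 0 <= \prod_(i < n) \int[gam d]_t (m t)%:E /\
  \prod_(i < n) \int[gam d]_t (m t)%:E <= \prod_(i < n) M%:E by [].
apply: (big_ind2 (fun a b => 0 <= a /\ a <= b)) => // [a b a' b' [a0 ab] [a0' ab']|i _].
  by split; [exact: mule_ge0|exact: lee_pmul].
by split; [apply: integral_ge0 => t _; rewrite lee_fin|exact: hM].
Qed.

End Response.
End RowsLaw.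

(** * The update of BIHT: passage off the net and mean *)

Section OffNet.
Context {R : realType} {d : nat}.
Notation mR := (measurableTypeR R).
Implicit Types (u v th : 'cV[R]_d) (t : d.-tuple mR) (s : R).

Lemma dotp_sup_dist u v t (tau : R) : (forall i, `|u i 0 - v i 0| <= tau) ->
  `|dotp (u^~ 0) t - dotp (v^~ 0) t| <= tau * norm1 t.
Proof.
move=> uv; rewrite /dotp /norm1 -sumrB mulr_sumr.
apply: le_trans (ler_norm_sum _ _ _) _; apply: ler_sum => i _.
by rewrite -mulrBl normrM ler_wpM2r.
Qed.

(** If |<v', t>| exceeds tau |t|_1, the signs at v and v' agree and only the change of u counts;
    otherwise the sign may flip, which is charged to [vstat]. *)
Lemma wstat_sup_dist u u' v v' s t (tau : R) : s = 1 \/ s = -1 ->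
  (forall i, `|u i 0 - u' i 0| <= tau) -> (forall i, `|v i 0 - v' i 0| <= tau) ->
  wstat (u^~ 0) (v^~ 0) s t <=
    wstat (u'^~ 0) (v'^~ 0) s t + tau * norm1 t + vstat tau (u'^~ 0) (v'^~ 0) t.
Proof.
move=> s1 hu hv; have := dotp_sup_dist t hu; have := dotp_sup_dist t hv.
rewrite /wstat /vstat /near; set a := dotp _ t; set a' := dotp _ t.
set b := dotp _ t; set b' := dotp _ t; set D := tau * _ => ha hb.
case: (boolP (`|a'| <= D)) => [_|]; last first.
  rewrite -ltNge => Da; have -> : sign a = sign a'.
    have := ha; rewrite ler_norml => /andP[h1 h2].
    rewrite /sign; case: (leP 0 a'); case: (leP 0 a) => // x x'.
      by move: Da; rewrite ger0_norm//; lra.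
    by move: Da; rewrite ltr0_norm//; lra.
  rewrite mulr0 addr0; have := hb; rewrite ler_norml => /andP[h1 h2].
  by case: (sign_pm1 a') => ->; case: s1 => ->; lra.
rewrite mulr1; have := hb; rewrite ler_norml => /andP[h1 h2].
have := ler_norm b'; have := ler_norm (- b'); rewrite normrN => h3 h4.
by case: (sign_pm1 a') => ->; case: (sign_pm1 a) => ->; case: s1 => ->; lra.
Qed.

Lemma dotc_sup_dist u u' v v' (tau : R) : l2norm u' = 1 -> l2norm v = 1 ->
  (forall i, `|u i 0 - u' i 0| <= tau) -> (forall i, `|v i 0 - v' i 0| <= tau) ->
  `|dotc u v - dotc u' v'| <= 2 * (tau * d%:R).
Proof.
move=> u1 v1 hu hv; rewrite /dotc -sumrB.
apply: le_trans (ler_norm_sum _ _ _) _.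
rewrite mulrA mulr_natr -[X in _ <= _ *+ X](card_ord d) -sumr_const; apply: ler_sum => i _.
have := l2norm_coord u' i; have := l2norm_coord v i; rewrite u1 v1 => ha hb.
rewrite (_ : _ - _ = (u i 0 - u' i 0) * v i 0 + u' i 0 * (v i 0 - v' i 0)); last by ring.
apply: le_trans (ler_normD _ _) _; rewrite !normrM mulr_natl mulr2n.
by apply: lerD; [rewrite -[leRHS]mulr1|rewrite -[leRHS]mul1r]; apply: ler_pM.
Qed.

(* The update of BIHT concentrates, in sparse directions, around gain p *: th. *)
Definition gain (p : R -> R) : R := Num.sqrt (2 * pi) / 2 * corr p.

(** Since sqrt(2 pi) E|z| = 2, the step size is exactly the one for which the term -<u, v> cancels
    the previous iterate in [dotc_update], leaving an update centred at [gain p *: th]. *)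
Lemma wmean_gain p th u v : Num.sqrt (2 * pi) * wmean p (th^~ 0) (u^~ 0) (v^~ 0) =
  gain p * dotc u th - dotc u v.
Proof.
have h : Num.sqrt (2 * pi) * Num.sqrt (2 / pi) = 2 :> R.
  have pi0 := pi_gt0 R; rewrite -sqrtrM ?mulr_ge0 ?(ltW pi0)//.
  have -> : 2 * pi * (2 / pi) = 2 ^+ 2 :> R.
    by move: (pi : R) pi0 => q q0; field; rewrite gt_eqF.
  by rewrite sqrtr_sqr ger0_norm.
rewrite /wmean /gain /dotc.
set c := Num.sqrt (2 * pi) in h *; set e := Num.sqrt (2 / pi) in h *.
set U := \sum_i _; set V := \sum_i _; rewrite mulrA mulrBr (_ : c * (V * e) = V * 2).
  by field.
by rewrite mulrCA h.
Qed.

Lemma dotc_update n (X : 'M[R]_(n, d)) y th v u (g : R) :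
  dotc u (biht_update X y v - g *: th) = dotc u v - g * dotc u th +
    Num.sqrt (2 * pi) / n%:R *
      \sum_(i < n) wstat (u^~ 0) (v^~ 0) (y i 0) (tnth (rows X) i).
Proof.
rewrite /dotc /biht_update; set c := _ / n%:R.
transitivity (\sum_i (u i 0 * v i 0 - g * (u i 0 * th i 0)) +
    c * \sum_i u i 0 * (X^T *m (2^-1 *: (y - map_mx sign (X *m v)))) i 0).
  rewrite mulr_sumr -big_split/=; apply: eq_bigr => i _; rewrite !mxE; ring.
rewrite sumrB -mulr_sumr; congr (_ + _ * _).
under eq_bigr do rewrite mxE mulr_sumr.
rewrite exchange_big/=; apply: eq_bigr => i _.
rewrite /wstat !dotp_row [X in _ = X * _]mxE mulr_suml; apply: eq_bigr => j _.
have -> : (2^-1 *: (y - map_mx sign (X *m v))) i 0 = 2^-1 * (y i 0 - sign ((X *m v) i 0)).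
  by move: (X *m v) => Z; rewrite !mxE.
by rewrite [X^T _ _]mxE; ring.
Qed.

End OffNet.

Section SqrtBounds.
Context {R : realType}.
Implicit Types a b : R.

Lemma le_sqrtr a b : 0 <= a -> a ^+ 2 <= b -> a <= Num.sqrt b.
Proof. by move=> a0 ab; rewrite -[leLHS]ger0_norm// -sqrtr_sqr; apply: ler_wsqrtr. Qed.

Lemma sqrtr_le a b : 0 <= a -> b <= a ^+ 2 -> Num.sqrt b <= a.
Proof. by move=> a0 ab; rewrite -[leRHS]ger0_norm// -sqrtr_sqr; apply: ler_wsqrtr. Qed.

End SqrtBounds.

(** * Deterministic analysis of a run on the good event *)

Section GoodRun.
Context {R : realType} {n d : nat}.
Variables (k : nat) (X : 'M[R]_(n, d)) (y : 'cV[R]_n) (p : R -> R) (th : 'cV[R]_d).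
Variables (eps tau K : R) (net : seq 'cV[R]_d).
Let g := gain p.
Let scale v := Num.max eps (l2norm (th - v)).
Hypotheses (n0 : (0 < n)%N) (g0 : 0 < g) (eps01 : 0 < eps < 1) (tau0 : 0 <= tau).
Hypotheses (thT : Theta k th) (y1 : forall i, y i 0 = 1 \/ y i 0 = -1).
Hypothesis net1 : forall v, v \in net -> l2norm v = 1.
Hypothesis netP : forall u, l2norm u = 1 -> (l0norm u <= k + k)%N ->
  exists2 v, v \in net & forall i, `|u i 0 - v i 0| <= tau.
Hypothesis good_wstat : forall u v, u \in net -> v \in net ->
  \sum_(i < n) wstat (u^~ 0) (v^~ 0) (y i 0) (tnth (rows X) i) <=
    n%:R * (wmean p (th^~ 0) (u^~ 0) (v^~ 0) + g / 60 * Num.sqrt (eps * scale v)).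
Hypothesis good_vstat : forall u v, u \in net -> v \in net ->
  \sum_(i < n) vstat tau (u^~ 0) (v^~ 0) (tnth (rows X) i) <= n%:R * (g * eps / 60).
Hypothesis good_norm1 : \sum_(i < n) norm1 (tnth (rows X) i) <= K * n%:R.
Hypothesis small_norm1 : 3 * (tau * K) + 2 * (tau * d%:R) <= g * eps / 16.
Hypothesis small_tau : tau * d%:R <= eps / 64.

Lemma good_step v : Theta k v -> forall u, l2norm u = 1 -> (l0norm u <= k + k)%N ->
  dotc u (biht_update X y v - g *: th) <= g / 4 * Num.sqrt (eps * scale v).
Proof.
move=> [v1 vk] u u1 uk; have [th1 _] := thT; have /andP[e0 e1] := eps01.
have [u' nu hu] := netP u1 uk.
have [v' nv hv] := netP v1 (leq_trans vk (leq_addr _ _)).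
set s := Num.sqrt (eps * scale v).
have es : eps <= s.
  by apply: le_sqrtr; [exact: ltW|rewrite expr2 ler_pM2l// le_max lexx].
(* The accuracy is granted at the net point v' rather than at v. As |v - v'| <= eps / 64, the scale
   at most doubles, and sqrt 2 <= 3/2 turns g / 60 into g / 40. *)
have s'E : Num.sqrt (eps * scale v') <= 3 / 2 * s.
  have h : scale v' <= 2 * scale v.
    have : l2norm (v - v') <= tau * d%:R.
      apply: le_trans (l2norm_le_sum _) _.
      rewrite mulr_natr -[X in _ <= _ *+ X](card_ord d) -sumr_const; apply: ler_sum => i _.
      by rewrite !mxE.
    have := ler_l2normD (th - v) (v - v'); rewrite addrA subrK => h1 h2.
    have e_v : eps <= scale v by rewrite le_max lexx.
    have n_v : l2norm (th - v) <= scale v by rewrite le_max lexx orbT.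
    by have h3 := small_tau; rewrite ge_max; apply/andP; split; lra.
  rewrite -(ger0_norm (_ : 0 <= 3 / 2 :> R))// -sqrtr_sqr -sqrtrM ?sqr_ge0//.
  apply: ler_wsqrtr; rewrite (_ : (3 / 2) ^+ 2 = 9 / 4 :> R); last by field.
  have : 0 <= scale v by rewrite le_max (ltW e0).
  nra.
have c3 : 0 <= Num.sqrt (2 * (pi : R)) <= 3.
  rewrite sqrtr_ge0/=; apply: sqrtr_le => //.
  have := @pihalf_lt2 R; nra.
rewrite dotc_update.
have nR : 0 < n%:R :> R by rewrite ltr0n.
have hW : n%:R^-1 * \sum_(i < n) wstat (u^~ 0) (v^~ 0) (y i 0) (tnth (rows X) i) <=
    wmean p (th^~ 0) (u'^~ 0) (v'^~ 0) + g / 40 * s + tau * K + g * eps / 60.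
  rewrite mulrC ler_pdivrMr//.
  apply: (@le_trans _ _ (\sum_(i < n) (wstat (u'^~ 0) (v'^~ 0) (y i 0) (tnth (rows X) i)
      + tau * norm1 (tnth (rows X) i) + vstat tau (u'^~ 0) (v'^~ 0) (tnth (rows X) i)))).
    by apply: ler_sum => i _; exact: wstat_sup_dist.
  rewrite !big_split/= -mulr_sumr.
  have h1 := good_wstat nu nv; have h2 := good_vstat nu nv.
  have h3 := ler_wpM2l tau0 good_norm1.
  have h4 : n%:R * (g / 60 * Num.sqrt (eps * scale v')) <= n%:R * (g / 40 * s).
    rewrite ler_pM2l// (_ : g / 40 * s = g / 60 * (3 / 2 * s)); last by field.
    by rewrite ler_wpM2l// divr_ge0// ltW.
  lra.
rewrite [_ / n%:R * _]mulrAC -mulrA [_ * n%:R^-1]mulrC.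
case/andP: c3 => c0 c3.
have := ler_wpM2l c0 hW.
have wE := wmean_gain p th u' v'; rewrite -/g in wE.
rewrite (_ : _ * (_ + _ + _ + _) = Num.sqrt (2 * pi) * wmean p (th^~ 0) (u'^~ 0) (v'^~ 0) +
  Num.sqrt (2 * pi) * (g / 40 * s) + Num.sqrt (2 * pi) * (tau * K) +
  Num.sqrt (2 * pi) * (g * eps / 60)); last by rewrite -!mulrDr.
rewrite wE => {}hW.
(* Budget in units of g s, using eps <= s and sqrt(2 pi) <= 3: 3/40 for [wstat], 3/60 for [vstat],
   1/16 for the terms of [small_norm1], 2/64 for the change of <u, th>. The total 7/32 is below
   1/4. *)
have h11 := small_tau; have h12 := small_norm1.
have := dotc_sup_dist (net1 nu) v1 hu hv; rewrite ler_norml => /andP[_ hd].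
have /(dotc_sup_dist (net1 nu) th1 hu) : forall i, `|th i 0 - th i 0| <= tau.
  by move=> i; rewrite subrr normr0.
rewrite ler_norml => /andP[hd' _].
have h5 := ler_wpM2l (ltW g0) hd'.
have h6 : g * (tau * d%:R) <= g * (eps / 64) by rewrite ler_pM2l.
have tK0 : 0 <= tau * K.
  rewrite mulr_ge0// -(pmulr_lge0 _ nR); apply: le_trans good_norm1.
  by apply: sumr_ge0 => i _; exact: norm1_ge0.
have h7 : Num.sqrt (2 * pi) * (g / 40 * s) <= 3 * (g / 40 * s).
  by rewrite ler_wpM2r// mulr_ge0 ?divr_ge0 ?(ltW g0)// sqrtr_ge0.
have h8 : Num.sqrt (2 * pi) * (tau * K) <= 3 * (tau * K) by rewrite ler_wpM2r.
have h9 : Num.sqrt (2 * pi) * (g * eps / 60) <= 3 * (g * eps / 60).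
  by rewrite ler_wpM2r// divr_ge0// mulr_ge0 ?(ltW g0) ?(ltW e0).
have h10 : g * eps <= g * s by rewrite ler_pM2l.
have gs0 : 0 <= g * s by rewrite mulr_ge0 ?sqrtr_ge0 ?(ltW g0).
lra.
Qed.

Lemma good_run theta0 theta : Theta k theta0 -> biht_run k X y theta0 theta ->
  forall t, Theta k (theta t) /\ l2norm (th - theta t) <= err_bound eps t.
Proof.
move=> T0 [th0E hrun]; have /andP[e0 e1] := eps01; elim=> [|t [IT IH]].
  rewrite th0E err_bound0; split=> //; apply: le_trans (ler_l2normD _ _) _.
  by rewrite l2normN thT.1 T0.1; lra.
have [w topw ->] := hrun t.
have m_le : scale (theta t) <= err_bound eps t by rewrite ge_max err_bound_ge.
have s_le2 : scale (theta t) <= 2.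
  rewrite ge_max; apply/andP; split; first lra.
  apply: le_trans (ler_l2normD _ _) _; rewrite l2normN thT.1 IT.1; lra.
(* Two unit vectors are at distance at most 2, which makes D < 3 g / 8 and so ensures the condition
   2 D < g of [top_k_step], even at the first iteration. *)
have s_lt : Num.sqrt (eps * scale (theta t)) < 3 / 2.
  rewrite -(ger0_norm (_ : 0 <= 3 / 2 :> R))// -sqrtr_sqr ltr_sqrt; last by [].
  have : 0 < scale (theta t) by rewrite lt_max e0.
  rewrite (_ : (3 / 2) ^+ 2 = 9 / 4 :> R); last by field.
  nra.
set D := g / 4 * Num.sqrt (eps * scale (theta t)).
have [||Tw hw] := @top_k_step R d k _ w th g D g0 _ _ thT topw (good_step IT).
- by rewrite mulr_ge0 ?sqrtr_ge0// divr_ge0// ltW.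
- rewrite /D; have := g0; nra.
split=> //; apply: le_trans hw _.
rewrite err_boundS// (_ : 4 * D / g = Num.sqrt (eps * scale (theta t))).
  by apply: ler_wsqrtr; rewrite ler_pM2l.
by rewrite /D; field; rewrite gt_eqF.
Qed.

End GoodRun.

(** * Tail bounds and the probability of the good event *)

Section UnionBoundConst.
Local Open Scope ereal_scope.
Context d (T : measurableType d) (R : realType) (mu : {measure set T -> \bar R}).

Lemma measure_bigsetU_cst (I : eqType) (s : seq I) (A : I -> set T) (c : R) :
  (forall i, i \in s -> measurable (A i) /\ mu (A i) <= c%:E) ->
  measurable (\big[setU/set0]_(i <- s) A i) /\
  mu (\big[setU/set0]_(i <- s) A i) <= ((size s)%:R * c)%:E.
Proof.
elim: s => [|i s IH] h; first by rewrite big_nil measure0 mul0r; split.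
have [mi hi] := h i (mem_head _ _).
have [ms hs] := IH (fun j js => h j (mem_behead (s := i :: s) js)).
rewrite !big_cons; split; first exact: measurableU.
apply: le_trans (measureU2 _ mi ms) _.
by rewrite -[(size (i :: s))%:R]/((size s).+1%:R) -natr1 mulrDl mul1r addrC EFinD; exact: leeD.
Qed.

End UnionBoundConst.

Section Tails.
Local Open Scope ereal_scope.
Context {R : realType} {disp : measure_display} {Omega : measurableType disp}.
Notation mR := (measurableTypeR R).
Variables (P : probability Omega R) (n d : nat) (X : Omega -> 'M[R]_(n, d)).
Hypothesis gX : iid_gaussian_mx P X.
Variables (p : R -> R) (th : 'cV[R]_d) (y : Omega -> 'cV[R]_n).
Hypotheses (mp : measurable_fun setT p) (p01 : forall z, (0 <= p z <= 1)%R).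
Hypotheses (th1 : l2norm th = 1%R) (yp : glm_response P p th X y).

Lemma sumsq_l2norm (v : 'cV[R]_d) : l2norm v = 1%R -> sumsq (v^~ 0%R) = 1%R.
Proof. by move=> v1; rewrite /sumsq -l2norm_sqr v1 expr1n. Qed.

(** Chernoff bound at the parameter l = min(1 / B, T / (2 Q)): the first entry is the range allowed
    by the truncation, the second keeps the quadratic term l^2 Q below l T / 2, so that half of the
    exponent l T survives. *)
Lemma wstat_tail (u v : 'cV[R]_d) (q B T Q : R) : l2norm u = 1%R -> l2norm v = 1%R ->
  row_mean p (th^~ 0%R) (wrong (v^~ 0%R)) <= q%:E -> (1 <= B)%R -> (0 < T)%R -> (0 < Q)%R ->
  (4 * B ^+ 2 * q + 2048 * expR (- B) <= Q)%R ->
  let bad := [set w | n%:R * (wmean p (th^~ 0) (u^~ 0) (v^~ 0) + T) <=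
    \sum_(i < n) wstat (u^~ 0) (v^~ 0) (y w i 0) (tnth (rows (X w)) i)]%R in
  measurable bad /\ P bad <= (expR (- (n%:R * (T * Num.min B^-1 (T / (2 * Q)) / 2))))%:E.
Proof.
move=> u1 v1 hq B1 T0 Q0 hQ bad; set l := Num.min _ _.
have B0 : (0 < B)%R by lra.
have l0 : (0 < l)%R by rewrite lt_min invr_gt0 B0 divr_gt0// mulr_gt0.
have lB : (`|l| * B <= 1)%R.
  by rewrite (ger0_norm (ltW l0)) -ler_pdivlMr// div1r ge_min lexx.
set mu := wmean _ _ _ _ in bad *.
have hM := row_mean_mgf mp p01 (sumsq_l2norm th1) (sumsq_l2norm u1) (sumsq_l2norm v1) B1 lB hq.
have mw s : measurable_fun setT (fun t : d.-tuple mR => l * wstat (u^~ 0) (v^~ 0) s t)%R.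
  apply: measurable_funM => //; apply: measurable_funM; first exact: measurable_dotp.
  apply: measurable_funM => //; apply: measurable_funB => //; exact: measurable_sign_dotp.
have [mE PE] := stat_sum_tail gX mp p01 yp (l * (n%:R * (mu + T)))%R mw hM.
have badE : bad = [set w | (l * (n%:R * (mu + T)) <= \sum_(i < n)
    l * wstat (u^~ 0) (v^~ 0) (y w i 0) (tnth (rows (X w)) i))%R].
  by apply/seteqP; split => w /=; rewrite /bad/= -mulr_sumr ler_pM2l.
rewrite badE; split=> //; apply: le_trans PE _.
rewrite lee_fin -expRM_natl -expRD ler_expR -/mu -mulr_natl.
have lQ : (l ^+ 2 * (4 * B ^+ 2 * q + 2048 * expR (- B)) <= l * (T / 2))%R.
  apply: (@le_trans _ _ (l * (l * Q)))%R.
    by rewrite mulrA -expr2 ler_wpM2l// sqr_ge0.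
  rewrite ler_pM2l// -ler_pdivlMr//.
  by rewrite (_ : (T / 2 / Q = T / (2 * Q))%R) ?ge_min ?lexx ?orbT//; field; rewrite gt_eqF.
have := @ler_wpM2l _ n%:R%R (ler0n _ _) _ _ lQ; lra.
Qed.

Lemma vstat_tail (u v : 'cV[R]_d) (sg B ka T : R) : l2norm u = 1%R -> l2norm v = 1%R ->
  (0 < sg)%R -> (expR B * (sg * (1 + d%:R)) + 32 * expR (- B) <= ka)%R ->
  let bad := [set w | n%:R * T <=
    \sum_(i < n) vstat (sg ^+ 2) (u^~ 0) (v^~ 0) (tnth (rows (X w)) i)]%R in
  measurable bad /\ P bad <= (expR (- (n%:R * (T - ka))))%:E.
Proof.
move=> u1 v1 sg0 hka bad.
have hM : row_mean p (th^~ 0%R) (fun _ t => expR (vstat (sg ^+ 2) (u^~ 0) (v^~ 0) t))%R <= (expR ka)%:E.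
  (* The statistic ignores the response, so the weights p and 1 - p add up to 1. *)
  rewrite /row_mean; under eq_integral do rewrite -mulrDl addrC subrK mul1r.
  apply: le_trans (gam_vstat_mgf B sg0 (sumsq_l2norm u1) (sumsq_l2norm v1)) _.
  by rewrite lee_fin; apply: le_trans (expR_ge1Dx ka); rewrite lerD2l.
have [mE PE] := stat_sum_tail gX mp p01 yp (n%:R * T)%R (h := fun=> _)
  (fun=> @measurable_vstat _ _ _ _ _) hM.
split=> //; apply: le_trans PE _.
rewrite lee_fin -expRM_natl -expRD ler_expR -mulr_natl; lra.
Qed.

(** The deviation [T1] depends on v: the accuracy demanded of the update relaxes as v moves away
    from the parameter, in step with the variance. *)
Lemma good_event (net : seq 'cV[R]_d) (tau K H rho : R) (T1 : 'cV[R]_d -> R) (T2 : R) :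
  (0 < n)%N -> (0 < K)%R ->
  (forall u v, u \in net -> v \in net -> let bad := [set w | n%:R * (wmean p (th^~ 0) (u^~ 0) (v^~ 0) + T1 v) <=
    \sum_(i < n) wstat (u^~ 0) (v^~ 0) (y w i 0) (tnth (rows (X w)) i)]%R in
    measurable bad /\ P bad <= (expR (- H))%:E) ->
  (forall u v, u \in net -> v \in net -> let bad := [set w | n%:R * T2 <=
    \sum_(i < n) vstat tau (u^~ 0) (v^~ 0) (tnth (rows (X w)) i)]%R in
    measurable bad /\ P bad <= (expR (- H))%:E) ->
  (2 * ((size net)%:R ^+ 2 * expR (- H)) + d%:R / K <= rho)%R ->
  exists E : set Omega, [/\ measurable E, (1 - rho)%:E <= P E & forall w, E w ->
    [/\ forall u v, u \in net -> v \in net ->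
      (\sum_(i < n) wstat (u^~ 0) (v^~ 0) (y w i 0) (tnth (rows (X w)) i) <=
        n%:R * (wmean p (th^~ 0) (u^~ 0) (v^~ 0) + T1 v))%R,
      forall u v, u \in net -> v \in net ->
      (\sum_(i < n) vstat tau (u^~ 0) (v^~ 0) (tnth (rows (X w)) i) <= n%:R * T2)%R
    & (\sum_(i < n) norm1 (tnth (rows (X w)) i) <= K * n%:R)%R]].
Proof.
move=> n0 K0 h1 h2 hrho.
pose A1 (uv : 'cV[R]_d * 'cV[R]_d) := [set w | n%:R * (wmean p (th^~ 0) (uv.1^~ 0) (uv.2^~ 0) + T1 uv.2) <=
    \sum_(i < n) wstat (uv.1^~ 0) (uv.2^~ 0) (y w i 0) (tnth (rows (X w)) i)]%R.
pose A2 (uv : 'cV[R]_d * 'cV[R]_d) := [set w | n%:R * T2 <=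
    \sum_(i < n) vstat tau (uv.1^~ 0) (uv.2^~ 0) (tnth (rows (X w)) i)]%R.
set A3 := [set w | K * n%:R <= \sum_(i < n) norm1 (tnth (rows (X w)) i)]%R.
have [mA3 PA3] : measurable A3 /\ P A3 <= (d%:R / K)%:E := rows_norm1_tail gX n0 K0.
pose s := [seq (u, v) | u <- net, v <- net].
have [uv|mU1 PU1] := @measure_bigsetU_cst _ _ _ P _ s A1 (expR (- H))%R.
  by move=> /allpairsP[[u v] [/= nu nv ->]]; exact: h1.
have [uv|mU2 PU2] := @measure_bigsetU_cst _ _ _ P _ s A2 (expR (- H))%R.
  by move=> /allpairsP[[u v] [/= nu nv ->]]; exact: h2.
set U1 := \big[_/_]_(_ <- _) A1 _ in mU1 PU1; set U2 := \big[_/_]_(_ <- _) A2 _ in mU2 PU2.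
have mU : measurable (U1 `|` U2 `|` A3) by apply: measurableU => //; exact: measurableU.
exists (~` (U1 `|` U2 `|` A3)); split; first exact: measurableC.
- rewrite probability_setC// EFinB leeB//.
  apply: le_trans (measureU2 _ (measurableU _ _ mU1 mU2) mA3) _.
  apply: (@le_trans _ _ (P U1 + P U2 + P A3)); first by apply: leeD => //; exact: measureU2.
  apply: le_trans (_ : ((2 * ((size net)%:R ^+ 2 * expR (- H)) + d%:R / K)%R)%:E <= _); last by rewrite lee_fin.
  rewrite size_allpairs natrM -expr2 in PU1 PU2.
  rewrite EFinD mulr_natl mulr2n EFinD; apply: leeD => //; exact: leeD.
- move=> w /= /not_orP[/not_orP[nU1 nU2] nA3]; split.
  + move=> u v nu nv; rewrite leNgt; apply/negP => /ltW h; apply: nU1.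
    rewrite /U1 -bigcup_seq; exists (u, v) => //=.
    by apply/allpairsP; exists (u, v).
  + move=> u v nu nv; rewrite leNgt; apply/negP => /ltW h; apply: nU2.
    rewrite /U2 -bigcup_seq; exists (u, v) => //=.
    by apply/allpairsP; exists (u, v).
  + by rewrite leNgt; apply/negP => /ltW.
Qed.

End Tails.

(** * Numerical parameters and the sample size *)

Section SampleSize.
Context {R : realType}.

(* The left-hand sides are variance and range of the row statistics divided by
   the square of the required accuracy, resp. by that accuracy. *)
Lemma Phi_ge (k : nat) (beta eps m : R) : 0 < eps < 1 -> 0 < beta -> eps <= m ->
  k%:R * Num.min 1 (beta^-1 + m) / (Num.min beta 1 ^+ 2 * eps * m) <= 2 * Phi 1 1 k beta eps /\
  k%:R / (Num.min beta 1 * eps) <= Phi 1 1 k beta eps.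
Proof.
move=> /andP[e0 e1] b0 em; have m0 : 0 < m by lra.
have k0 : 0 <= k%:R :> R by [].
have eV : 1 <= eps^-1 by rewrite -[leLHS]invr1 lef_pV2 ?posrE// ltW.
have eV0 : 0 < eps^-1 by rewrite invr_gt0.
have mV : m^-1 <= eps^-1 by rewrite lef_pV2 ?posrE.
have mV0 : 0 < m^-1 by rewrite invr_gt0.
have mK : m * m^-1 = 1 by rewrite divff ?gt_eqF.
have bV0 : 0 < beta^-1 by rewrite invr_gt0.
have split_min b M : k%:R * M / (b * eps * m) = k%:R / (b * eps) * (M / m).
  by rewrite !invfM; ring.
rewrite split_min /Phi div1r; case: (ltP beta 1) => b1.
  have bV1 : 1 <= beta^-1 by rewrite -[leLHS]invr1 lef_pV2 ?posrE// ltW.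
  split.
    have -> : 2 * (k%:R / (beta ^+ 2 * eps ^+ 2)) = k%:R / (beta ^+ 2 * eps) * (2 * eps^-1).
      by rewrite [eps ^+ 2]expr2 !invfM; ring.
    rewrite ler_wpM2l ?divr_ge0 ?mulr_ge0 ?exprn_ge0 ?(ltW e0) ?(ltW b0)//.
    apply: (@le_trans _ _ (1 / m)); last lra.
    by rewrite ler_wpM2r ?(ltW mV0)// ge_min lexx.
  have -> : k%:R / (beta ^+ 2 * eps ^+ 2) = k%:R / (beta * eps) * (beta^-1 * eps^-1).
    by rewrite !expr2 !invfM; ring.
  rewrite ler_peMr ?divr_ge0 ?mulr_ge0 ?(ltW e0) ?(ltW b0)//; nra.
(* The two terms cross at beta = 1 / eps: comparing them there gives the threshold b2 = 1, and
   bounding their sum by twice the larger one gives the factor 2. *)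
have hM : Num.min 1 (beta^-1 + m) / m <= beta^-1 * eps^-1 + 1.
  apply: (@le_trans _ _ ((beta^-1 + m) / m)).
    by rewrite ler_wpM2r ?(ltW mV0)// ge_min lexx orbT.
  by rewrite mulrDl mK lerD2r ler_pM2l.
have ke : 0 <= k%:R / eps by rewrite divr_ge0// ltW.
have hM' := ler_wpM2l ke hM; rewrite expr1n !mul1r.
case: (ltP beta eps^-1) => be.
  have bK : beta * beta^-1 = 1 by rewrite divff ?gt_eqF.
  have h1 : 1 <= beta^-1 * eps^-1 by rewrite mulrC -ler_pdivrMr ?invrK ?mul1r// ltW.
  have -> : k%:R / (beta * eps ^+ 2) = k%:R / eps * (beta^-1 * eps^-1).
    by rewrite !expr2 !invfM; ring.
  have := ler_wpM2l ke h1; rewrite mulr1; lra.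
have h1 : beta^-1 * eps^-1 <= 1 by rewrite mulrC ler_pdivrMr// mul1r.
by have := ler_wpM2l ke h1; rewrite mulr1; lra.
Qed.

End SampleSize.

Section Scale.
Context {R : realType}.
Variables (d : nat) (eps rho beta : R).
Hypotheses (d0 : (0 < d)%N) (eps01 : 0 < eps < 1) (rho01 : 0 < rho < 1) (beta0 : 0 < beta).
Let b := Num.min beta 1.
(* All parameters are powers of x = eps rho min(beta, 1) / (e d) <= 1 / 2. *)
Let L := logfactor d beta eps rho.
Let x := expR (- L).

Lemma scale_bounds : [/\ 0 < x <= 2^-1, x * d%:R <= rho, x <= b * eps & 1 <= L].
Proof.
have /andP[e0 e1] := eps01; have /andP[r0 r1] := rho01; have B0 := beta0.
have D1 : 1 <= d%:R :> R by rewrite ler1n.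
have b0 : 0 < b by rewrite lt_min B0 ltr01.
have b1 : b <= 1 by rewrite ge_min lexx orbT.
have D0 : 0 < d%:R :> R by lra.
pose w := eps * rho * b.
have w0 : 0 < w by rewrite !mulr_gt0.
have Lam0 : 0 < expR 1 * d%:R / w by rewrite divr_gt0// mulr_gt0// expR_gt0.
have E2 : 2 <= expR 1 :> R by have := expR_ge1Dx (1 : R); lra.
have E0 : 0 < expR 1 :> R by lra.
have xE : x = w / (expR 1 * d%:R) by rewrite /x /L /logfactor -/b -/w expRN lnK ?posrE// invf_div.
have eb1 : eps * b <= 1 by rewrite mulr_ile1// ltW.
have eb0 : 0 < eps * b by rewrite mulr_gt0.
have wr : w <= rho by rewrite /w mulrAC ger_pMl.
have web : w <= b * eps by rewrite /w mulrAC [eps * b]mulrC ger_pMr 1?mulrC// ltW.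
have ED : 2 <= expR 1 * d%:R :> R.
  by rewrite -[leLHS]mulr1; apply: ler_pM.
have ED0 : 0 < expR 1 * d%:R :> R by lra.
split.
- rewrite expR_gt0/= xE ler_pdivrMr//; lra.
- rewrite xE invfM mulrA -mulrA mulVf ?gt_eqF// mulr1 ler_pdivrMr//; nra.
- rewrite xE ler_pdivrMr//; nra.
- rewrite -ler_expR; have -> : expR L = x^-1 by rewrite /x expRN invrK.
  rewrite xE invf_div ler_pdivlMr//; nra.
Qed.

Lemma expR_scale (m : nat) : expR (- (m%:R * L)) = x ^+ m.
Proof. by rewrite -mulrN expRM_natl. Qed.

(** Surplus powers of x are exchanged for numerical constants. *)
Lemma scale_pow (m j : nat) : x ^+ (m + j) <= x ^+ m * 2 ^- j.
Proof.
have [/andP[x0 x2] _ _ _] := scale_bounds.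
by rewrite exprD ler_wpM2l ?exprn_ge0 ?(ltW x0)// -exprVn lerXn2r ?nnegrE ?invr_ge0// ltW.
Qed.

(** Origin of the exponents: e^(-B) = x^18 makes even 2048 e^(-B) smaller than x; sg <= x^33 has to
    beat e^B = x^(-18) with room for d and constants; and tau = sg^2 gives 66. *)
Let B := 18%:R * L.
Let N := (Num.truncn (x ^- 66)).+1.
Let tau : R := N%:R^-1.
Let sg := Num.sqrt tau.

Lemma tau_le : 0 < tau <= x ^+ 66.
Proof.
have [/andP[x0 x2] _ _ _] := scale_bounds.
rewrite invr_gt0 ltr0n/= -[leRHS]invrK lef_pV2 ?posrE ?ltr0n//; last by rewrite invr_gt0 exprn_gt0.
by rewrite /N ltW// truncnS_gt.
Qed.

Lemma sg_le : 0 < sg <= x ^+ 33.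
Proof.
have [/andP[x0 x2] _ _ _] := scale_bounds; have /andP[t0 t1] := tau_le.
rewrite sqrtr_gt0 t0/=; apply: sqrtr_le; first by rewrite exprn_ge0// ltW.
by rewrite -exprM.
Qed.

(** Here e^B sg (1 + d) <= x^14 (x + x d) <= 2 x^14, which is tiny compared with x <= b eps. The
    right-hand side is half of b eps / 600, a lower bound of the accuracy g eps / 60; the other half
    drives the tail bound. *)
Lemma vstat_params : expR B * (sg * (1 + d%:R)) + 32 * expR (- B) <= b * eps / 1200.
Proof.
have [/andP[x0 x2] xd xb L1] := scale_bounds; have /andP[s0 s1] := sg_le.
have /andP[r0 r1] := rho01.
have -> : expR B = x ^- 18 by rewrite -[B]opprK expRN expR_scale.
rewrite expR_scale.
have x14 := scale_pow 1 13; have x18 := scale_pow 1 17.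
have h : x ^- 18 * (sg * (1 + d%:R)) <= x ^+ 14 * 2.
  rewrite mulrC ler_pdivrMr ?exprn_gt0//.
  apply: le_trans (ler_wpM2r _ s1) _; first by rewrite addr_ge0.
  rewrite (_ : x ^+ 33 = x ^+ 14 * x ^+ 18 * x); last by rewrite -exprD -exprSr.
  have := exprn_ge0 14 (ltW x0); have := exprn_ge0 18 (ltW x0).
  move: (x ^+ 14) (x ^+ 18) => p q q0 p0.
  rewrite (_ : p * q * x * (1 + d%:R) = p * q * (x + x * d%:R)); last by ring.
  rewrite (_ : p * 2 * q = p * q * 2); last by ring.
  by rewrite ler_wpM2l ?mulr_ge0//; lra.
rewrite expr1 in x14 x18.
apply: le_trans (lerD h (lexx _)) _; move: x14 x18.
rewrite -!exprVn (_ : 2^-1 ^+ 13 = 8192^-1 :> R); last by field.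
rewrite (_ : 2^-1 ^+ 17 = 2^-1 ^+ 13 / 16 :> R); last by field.
rewrite (_ : 2^-1 ^+ 13 = 8192^-1 :> R); last by field.
move=> x14 x18; rewrite /= in x14 x18; lra.
Qed.

(** Write M = min(1, 1 / beta + m). The exponentially small terms are at most x <= eps <= m, so the
    probability of a wrong sign is at most 4 B M; then 16 B^3 M plus a remainder at most M stays
    below 20 B^3 M. *)
Lemma wstat_params (m : R) : eps <= m -> 1 <= B ->
  4 * B ^+ 2 * Num.min 1 (4 / beta + B * m + 4 * expR (- B)) + 2048 * expR (- B) <=
  20 * B ^+ 3 * Num.min 1 (beta^-1 + m).
Proof.
have [/andP[x0 x2] xd xb L1] := scale_bounds; have /andP[e0 e1] := eps01.
move=> em B1; rewrite expR_scale; set M := Num.min 1 (beta^-1 + m).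
have B0 := beta0; have bV0 : 0 < beta^-1 by rewrite invr_gt0.
have xe : x <= eps by apply: le_trans xb _; rewrite ger_pMl// ge_min lexx orbT.
have x18 : 2048 * x ^+ 18 <= x.
  have := scale_pow 1 17; rewrite expr1 -exprVn (_ : 2^-1 ^+ 17 = 2^-1 ^+ 6 * 2048^-1 :> R); last by field.
  rewrite (_ : 2^-1 ^+ 6 = 64^-1 :> R); last by field.
  rewrite /=; lra.
have x18' : 4 * x ^+ 18 <= x by have := exprn_ge0 18 (ltW x0); lra.
have xM : x <= M by rewrite le_min; apply/andP; split; lra.
have qM : Num.min 1 (4 / beta + B * m + 4 * x ^+ 18) <= 4 * B * M.
  rewrite /M minr_pMr ?mulr_ge0//; last lra.
  rewrite le_min !ge_min; apply/andP; split; apply/orP; [left; lra|right].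
  have : beta^-1 <= B * beta^-1 by rewrite ler_pMl.
  have : m <= B * m by rewrite ler_pMl//; lra.
  lra.
have h1 := ler_wpM2l (_ : 0 <= 4 * B ^+ 2) qM.
apply: le_trans (lerD (h1 _) x18) _; first by rewrite mulr_ge0// sqr_ge0.
have B3 : 1 <= B ^+ 3 by rewrite exprn_ege1.
have M0 : 0 <= M by lra.
have : M <= B ^+ 3 * M by rewrite ler_peMl.
rewrite [B ^+ 3]exprS; lra.
Qed.

Lemma offnet_params : 3 * (tau * (2 * d%:R / rho)) + 2 * (tau * d%:R) <= b * eps / 160 /\
  tau * d%:R <= eps / 64.
Proof.
have [/andP[x0 x2] xd xb L1] := scale_bounds; have /andP[e0 e1] := eps01.
have /andP[r0 r1] := rho01; have /andP[t0 t1] := tau_le.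
have td : tau * (d%:R / rho) <= x ^+ 65.
  rewrite mulrA ler_pdivrMr//; apply: le_trans (ler_wpM2r (ler0n _ d) t1) _.
  by rewrite exprSr -mulrA ler_wpM2l ?exprn_ge0 ?(ltW x0).
have td' : tau * d%:R <= tau * (d%:R / rho).
  by rewrite ler_wpM2l ?(ltW t0)// ler_pMr ?ltr0n// -[leLHS]invr1 lef_pV2 ?posrE// ltW.
have xe : x <= eps by apply: le_trans xb _; rewrite ger_pMl// ge_min lexx orbT.
have x65 : x ^+ 65 <= x / 4096.
  apply: le_trans (_ : x ^+ (1 + 12) <= _).
    by apply: ler_wiXn2l => //; lra.
  apply: le_trans (scale_pow 1 12) _.
  rewrite expr1 ler_wpM2l ?(ltW x0)// -exprVn (_ : 2^-1 ^+ 12 = 4096^-1 :> R)//; by field.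
rewrite (_ : tau * (2 * d%:R / rho) = 2 * (tau * (d%:R / rho))); last by ring.
by split; lra.
Qed.

(** One code entry has d (2 N + 1) <= x^(-70) values: 66 + 3 for the grid, 1 for d. With 2k entries
    and pairs of net points this makes x^(-280 k), so the exponent 283 k leaves x^(3 k) <= x^3 for
    each of the two families of events. The last term is the other half of rho, from Markov with K =
    2 d / rho. *)
Lemma net_params (k s : nat) : (0 < k)%N -> (s <= (d * (N.*2).+1) ^ (k + k))%N ->
  2 * (s%:R ^+ 2 * expR (- ((283 * k)%:R * L))) + d%:R / (2 * d%:R / rho) <= rho.
Proof.
have [/andP[x0 x2] xd xb L1] := scale_bounds; have /andP[e0 e1] := eps01.
have /andP[r0 r1] := rho01 => k0 hs.
have e4 j : ((j + j) * 2 = 4 * j)%N by clear; lia.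
have e280 j : (70 * (4 * j) = 280 * j)%N by clear; lia.
have e283 j : (283 * j = 280 * j + 3 * j)%N by clear; lia.
have D1 : 1 <= d%:R :> R by rewrite ler1n.
have -> : d%:R / (2 * d%:R / rho) = rho / 2 by field; rewrite !gt_eqF//; lra.
rewrite expR_scale.
have xV : 2 <= x^-1 by rewrite -[leLHS]invrK lef_pV2 ?posrE ?invr_gt0.
have hN : d%:R * (N.*2).+1%:R <= x ^- 70.
  have dx : d%:R <= x^-1 by rewrite -[leRHS]mul1r ler_pdivlMr// mulrC; lra.
  apply: (@le_trans _ _ (x^-1 * x ^- 69)); last by rewrite -!exprVn -exprS.
  apply: ler_pM => //.
  rewrite -natr1 -muln2 natrM /N -natr1.
  have hx : x ^- 69 = x ^- 66 * x ^- 3 by rewrite -!exprVn -exprD.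
  have h3 : 8 <= x ^- 3.
    by rewrite -exprVn (_ : 8 = 2 ^+ 3 :> R); [rewrite lerXn2r ?nnegrE ?invr_ge0 ?(ltW x0)|ring].
  have h66 : 1 <= x ^- 66 by rewrite -exprVn exprn_ege1//; lra.
  have ht : (Num.truncn (x ^- 66))%:R <= x ^- 66 by rewrite truncn_le//; lra.
  rewrite hx; nra.
rewrite -natrM in hN; move: (d * _)%N hN hs => M hM hs.
have hs' : s%:R ^+ 2 <= x ^- (280 * k).
  apply: (@le_trans _ _ ((M ^ (k + k))%:R ^+ 2)).
    by rewrite lerXn2r ?nnegrE ?ler0n// ler_nat.
  apply: (@le_trans _ _ ((x ^- 70) ^+ (4 * k))).
    rewrite natrX -exprM e4.
    by rewrite lerXn2r ?nnegrE ?invr_ge0 ?exprn_ge0 ?(ltW x0).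
  by rewrite -!exprVn -exprM e280.
apply: le_trans (_ : 2 * x ^+ 3 + rho / 2 <= _).
  rewrite lerD2r ler_pM2l//; apply: le_trans (ler_wpM2r _ hs') _; first by rewrite exprn_ge0 ?(ltW x0).
  rewrite e283.
  rewrite exprD mulKf ?expf_neq0 ?gt_eqF//; apply: ler_wiXn2l; [exact: ltW|lra|by rewrite leq_pmulr].
have := scale_pow 1 2; rewrite expr1 -exprVn (_ : 2^-1 ^+ 2 = 4^-1 :> R); last by field.
rewrite /=; nra.
Qed.

End Scale.

Section SampleSizeBounds.
Context {R : realType}.
Variables (k : nat) (n L eps beta cT cB cQ cH : R).
Let b := Num.min beta 1.
Hypotheses (n0 : 0 <= n) (L1 : 1 <= L) (eps01 : 0 < eps < 1) (beta0 : 0 < beta).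
Hypotheses (cT1 : 1 <= cT) (cB1 : 1 <= cB) (cBQ : cB <= cQ) (cH0 : 0 <= cH).
Hypothesis n_ge : 8 * (cT ^+ 2 * cQ * cH) * Phi 1 1 k beta eps * L ^+ 4 <= n.

(* The requirement for deviations T of the order b sqrt (eps m), where cB * L is
   the truncation level, cQ * L ^ 3 * min 1 (1 / beta + m) the variance proxy,
   and cH * k * L the entropy of the net. *)
Lemma sample_size_linear : 2 * (cB * cT * cH) * (k%:R * L ^+ 2) <= n * (b * eps).
Proof.
have /andP[e0 e1] := eps01; have B0 := beta0; have LL := L1; have T1 := cT1.
have B1 := cB1; have BQ := cBQ; have H0 := cH0.
have b0 : 0 < b by rewrite lt_min B0 ltr01.
have [_ h] := Phi_ge k eps01 B0 (lexx eps).
have L2 : 1 <= L ^+ 2 by rewrite exprn_ege1.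
have L24 : L ^+ 2 <= L ^+ 4.
  by rewrite (_ : L ^+ 4 = L ^+ 2 * L ^+ 2); [rewrite ler_peMr//; lra|rewrite -exprD].
have be0 : 0 < b * eps by rewrite mulr_gt0.
rewrite -ler_pdivrMr//; apply: le_trans n_ge.
have kbe : 0 <= k%:R / (b * eps) by rewrite divr_ge0// ltW.
rewrite (_ : _ / _ = 2 * (cB * cT * cH) * (k%:R / (b * eps) * L ^+ 2)); last by ring.
rewrite -[8 * _ * Phi _ _ _ _ _ * _]mulrA.
have c0 : 0 <= cB * cT * cH by rewrite !mulr_ge0//; lra.
have c1 : cB * cT * cH <= cT ^+ 2 * cQ * cH.
  rewrite ler_wpM2r// mulrC expr2 -mulrA ler_wpM2l//; first lra.
  nra.
apply: ler_pM; [lra| |lra|].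
- by rewrite mulr_ge0//; lra.
- by apply: ler_pM => //; lra.
Qed.

Lemma sample_size_vstat (T : R) : b * eps / (2 * cT) <= T -> cH * (k%:R * L) <= n * T.
Proof.
move=> hT; have h := sample_size_linear; have LL := L1; have T1 := cT1; have B1 := cB1.
have H0 := cH0.
apply: le_trans (ler_wpM2l n0 hT); rewrite [n * _]mulrA ler_pdivlMr; last lra.
apply: le_trans h.
rewrite (_ : _ * (2 * cT) = 2 * (cT * cH) * (k%:R * L)); last by ring.
apply: ler_pM.
- by rewrite !mulr_ge0//; lra.
- by rewrite mulr_ge0//; lra.
- by rewrite ler_pM2l// -[cB * cT * cH]mulrA ler_peMl// mulr_ge0//; lra.
- by rewrite ler_wpM2l// expr2 ler_peMr//; lra.
Qed.

(** The first entry of the minimum needs n T of order k L^2, which holds as T >= b eps / cT. The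
    second needs n T^2 of order k L^4 min(1, 1 / beta + m); as T^2 is at least of order b^2 eps m,
    this is the first half of [Phi_ge]. *)
Lemma sample_size_wstat (m T : R) : eps <= m -> b / cT * Num.sqrt (eps * m) <= T ->
  cH * (k%:R * L) <= n * (T * Num.min (cB * L)^-1
    (T / (2 * (cQ * L ^+ 3 * Num.min 1 (beta^-1 + m)))) / 2).
Proof.
move=> em hT; have h := sample_size_linear; have LL := L1; have cT1' := cT1.
have B1 := cB1; have BQ := cBQ; have H0 := cH0.
have /andP[e0 e1] := eps01; have B0 := beta0.
have b0 : 0 < b by rewrite lt_min B0 ltr01.
have m0 : 0 < m by lra.
set M := Num.min 1 (beta^-1 + m).
have M0 : 0 < M by rewrite lt_min ltr01 addr_gt0// invr_gt0.
have es : eps <= Num.sqrt (eps * m) by apply: le_sqrtr; [exact: ltW|rewrite expr2 ler_pM2l].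
have cT0 : 0 < cT by lra.
have T1 : b * eps / cT <= T.
  by apply: le_trans hT; rewrite mulrAC ler_wpM2l// divr_ge0// ltW.
have T0 : 0 < T by apply: lt_le_trans T1; rewrite divr_gt0// mulr_gt0.
have T2 : b ^+ 2 * (eps * m) / cT ^+ 2 <= T ^+ 2.
  apply: (@le_trans _ _ ((b / cT * Num.sqrt (eps * m)) ^+ 2)).
    rewrite exprMn sqr_sqrtr ?mulr_ge0 ?(ltW e0) ?(ltW m0)//.
    by rewrite exprMn exprVn mulrAC.
  by rewrite lerXn2r ?nnegrE ?mulr_ge0 ?sqrtr_ge0 ?(ltW T0) ?invr_ge0 ?(ltW b0) ?(ltW cT0).
have L0 : 0 < L by lra.
have nT : n * (b * eps) <= cT * (n * T).
  rewrite [cT * _]mulrCA ler_wpM2l//; move: T1; rewrite ler_pdivrMr//; lra.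
have [hP _] := Phi_ge k eps01 B0 em.
have nT2 : 4 * (cQ * cH) * (k%:R * M * L ^+ 4) <= n * T ^+ 2.
  apply: le_trans (ler_wpM2l n0 T2).
  rewrite [n * _]mulrA ler_pdivlMr ?exprn_gt0//.
  have bem : 0 < b ^+ 2 * eps * m by rewrite !mulr_gt0// exprn_gt0.
  have := hP; rewrite -/b -/M ler_pdivrMr// => {}hP.
  have L4 : 0 <= L ^+ 4 by rewrite exprn_ge0// ltW.
  apply: le_trans (_ : 8 * (cT ^+ 2 * cQ * cH) * Phi 1 1 k beta eps * L ^+ 4 * (b ^+ 2 * (eps * m)) <= _); last first.
    by apply: ler_wpM2r n_ge; rewrite mulr_ge0 ?mulr_ge0 ?exprn_ge0 ?(ltW b0) ?(ltW e0) ?(ltW m0).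
  have c0 : 0 <= 4 * (cT ^+ 2 * cQ * cH) * L ^+ 4.
    by rewrite !mulr_ge0 ?exprn_ge0//; lra.
  have := ler_wpM2l c0 hP; lra.
set Q := cQ * L ^+ 3 * M.
have cQ0 : 0 < cQ by lra.
have Q0 : 0 < Q by rewrite !mulr_gt0// exprn_gt0.
have cBL : 0 < cB * L by rewrite mulr_gt0//; lra.
rewrite [n * (_ / 2)]mulrA ler_pdivlMr// [n * (T * _)]mulrA minr_pMr ?mulr_ge0 ?(ltW T0)// le_min.
apply/andP; split.
- rewrite ler_pdivlMr// -(ler_pM2l cT0); apply: le_trans nT; apply: le_trans h.
  rewrite le_eqVlt; apply/orP; left; apply/eqP; rewrite expr2; ring.
- rewrite [n * T * (_ / _)]mulrA ler_pdivlMr ?mulr_gt0// -[n * T * T]mulrA -expr2.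
  apply: le_trans nT2; rewrite le_eqVlt; apply/orP; left; apply/eqP.
  by rewrite /Q; ring.
Qed.

End SampleSizeBounds.

Section GainLowerBound.
Context {R : realType}.

Lemma gain_ge (model : glm) (beta : R) : 0 < beta ->
  Num.min beta 1 / 10 <= gain (prob_one model beta).
Proof.
move=> b0; have h := corr_ge model b0.
have B0 : 0 <= Num.min beta 1 by rewrite le_min (ltW b0) ler01.
have h2 : 2 <= Num.sqrt (2 * (pi : R)) by apply: le_sqrtr => //; have := @pi_ge2 R; nra.
apply: (le_trans h); rewrite /gain ler_peMl//; last lra.
by apply: le_trans h; rewrite divr_ge0.
Qed.

End GainLowerBound.

(** * The good event for the chosen parameters, and the conclusion *)

Section Success.
Context {R : realType} {disp : measure_display} {Omega : measurableType disp}.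
Variables (P : probability Omega R) (model : glm) (d k n : nat) (eps rho beta : R).
Variables (th : 'cV[R]_d) (X : Omega -> 'M[R]_(n, d)) (y : Omega -> 'cV[R]_n).
Hypotheses (d0 : (0 < d)%N) (k0 : (0 < k)%N) (n0 : (0 < n)%N).
Hypotheses (eps01 : 0 < eps < 1) (rho01 : 0 < rho < 1) (beta0 : 0 < beta).
Hypotheses (thT : Theta k th) (gX : iid_gaussian_mx P X).
Let p := prob_one model beta.
Let L := logfactor d beta eps rho.
Hypothesis yp : glm_response P p th X y.
(** 600 = 60 * 10 combines the accuracy g / 60 with g >= b / 10; 18 is B / L; 20 * 18^3 is the
    variance constant of [wstat_params]; 283 is the exponent of [net_params]. *)
Variables (cT cB cQ cH : R).
Hypotheses (cT_E : cT = 600) (cB_E : cB = 18) (cQ_E : cQ = 20 * cB ^+ 3) (cH_E : cH = 283%:R).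
Hypothesis n_ge : 8 * (cT ^+ 2 * cQ * cH) * Phi 1 1 k beta eps * L ^+ 4 <= n%:R.

(** The event is chosen before the starting point and the run, so any dependence of these on the
    data, including the way ties are broken, is allowed. *)
Lemma biht_success : exists E : set Omega, [/\ measurable E, ((1 - rho)%:E <= P E)%E &
  forall w, E w -> forall theta0 theta, Theta k theta0 -> biht_run k (X w) (y w) theta0 theta ->
    forall t, l2norm (th - theta t) <= err_bound eps t].
Proof.
have mp : measurable_fun setT p := measurable_prob_one model beta0.
have p01 z : 0 <= p z <= 1 := prob_one01 model beta z.
have [th1 _] := thT; have /andP[e0 e1] := eps01; have /andP[r0 r1] := rho01.
have [xx xd xb L1] := scale_bounds d0 eps01 rho01 beta0; rewrite -/L in L1.
set b := Num.min beta 1 in xb *.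
have b0 : 0 < b by rewrite lt_min beta0 ltr01.
have B1 : 1 <= 18 * L by lra.
set N := (Num.truncn (expR (- L) ^- 66)).+1.
set tau : R := N%:R^-1.
have [net [net_size net1 netP]] := @sparse_net R d N (k + k) isT.
have g10 := gain_ge model beta0; rewrite -/b -/p in g10.
have g0 : 0 < gain p by apply: lt_le_trans g10; rewrite divr_gt0.
have geps : b * eps / 10 <= gain p * eps by rewrite mulrAC ler_wpM2r// ltW.
have [off1 off2] := offnet_params d0 eps01 rho01 beta0; rewrite -/L -/N -/tau -/b in off1 off2.
have cT1 : 1 <= cT by rewrite cT_E; lra.
have cB1 : 1 <= cB by rewrite cB_E; lra.
have cH0 : 0 <= cH by rewrite cH_E ler0n.
have cBQ : cB <= cQ.
  rewrite cQ_E exprS mulrCA ler_peMr//; first lra.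
  have : 1 <= cB ^+ 2 by rewrite exprn_ege1.
  lra.
have L0 : 0 < L by exact: lt_le_trans L1.
have cQ0 : 0 < cQ by apply: lt_le_trans cBQ; exact: lt_le_trans cB1.
pose m v := Num.max eps (l2norm (th - v)).
have em v : eps <= m v by rewrite le_max lexx.
have m0 v : 0 < m v by exact: lt_le_trans (em v).
pose T1 v := gain p / 60 * Num.sqrt (eps * m v).
pose T2 := gain p * eps / 60.
have HE : cH * (k%:R * L) = (283 * k)%:R * L by rewrite natrM mulrA cH_E.
have K0 : 0 < 2 * d%:R / rho by rewrite divr_gt0// mulr_gt0// ltr0n.
have [|||E [mE PE hE]] := @good_event R disp Omega P n d X gX p th y net tau
  (2 * d%:R / rho) ((283 * k)%:R * L) rho T1 T2 n0 K0.
- move=> u v nu nv.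
  have hq := row_mean_wrong mp p01 (sumsq_l2norm th1) (ler0n R 4) beta0
    (prob_one_noise model beta) (v := fun j => v j 0) (m := m v) (B := 18 * L) (m0 v) (lt_le_trans ltr01 B1).
  have {}hq := hq _.
  have T10 : 0 < T1 v.
    by rewrite mulr_gt0 ?divr_gt0// sqrtr_gt0 mulr_gt0.
  set Q := cQ * L ^+ 3 * Num.min 1 (beta^-1 + m v).
  have Q0 : 0 < Q.
    rewrite mulr_gt0//; first by rewrite mulr_gt0// exprn_gt0.
    by rewrite lt_min ltr01 addr_gt0// invr_gt0.
  have hQ : 4 * (18 * L) ^+ 2 * Num.min 1 (4 / beta + 18 * L * m v + 4 * expR (- (18 * L)))
     + 2048 * expR (- (18 * L)) <= Q.
    rewrite /Q cQ_E cB_E -[20 * _ * _]mulrA -exprMn.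
    exact: wstat_params.
  have [//|mb hb] := wstat_tail gX mp p01 th1 yp (net1 _ nu) (net1 _ nv) (hq _) B1 T10 Q0 hQ.
    rewrite (_ : sumsq _ = \sum_i (th - v) i 0 ^+ 2).
      by rewrite -/(l2norm _) le_max lexx orbT.
    by rewrite /sumsq; apply: eq_bigr => i _; rewrite !mxE.
  split=> //; apply: le_trans hb _; rewrite lee_fin ler_expR lerN2 -HE.
  rewrite -cB_E; apply: (sample_size_wstat (ler0n R n) L1 eps01 beta0 cT1 cB1 cBQ cH0 n_ge (em v)).
  rewrite /T1 ler_wpM2r ?sqrtr_ge0// cT_E -/b; lra.
- move=> u v nu nv.
  have s_gt : 0 < Num.sqrt tau by rewrite sqrtr_gt0 invr_gt0 ltr0n.
  have tauE : Num.sqrt tau ^+ 2 = tau by rewrite sqr_sqrtr// invr_ge0.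
  have hka := vstat_params d0 eps01 rho01 beta0; rewrite -/L -/N -/tau -/b in hka.
  have := vstat_tail gX mp p01 yp T2 (net1 _ nu) (net1 _ nv) s_gt hka.
  rewrite tauE => -[mb hb]; split=> //; apply: le_trans hb _; rewrite lee_fin ler_expR lerN2 -HE.
  apply: (sample_size_vstat (ler0n R n) L1 eps01 beta0 cT1 cB1 cBQ cH0 n_ge).
  rewrite cT_E /T2 -/b; lra.
- exact: net_params.
exists E; split=> // w Ew theta0 theta T0 hrun t; have [h1 h2 h3] := hE w Ew.
have [_ yy _] := yp.
have tau0 : 0 <= tau by rewrite invr_ge0.
have off1' : 3 * (tau * (2 * d%:R / rho)) + 2 * (tau * d%:R) <= gain p * eps / 16.
  by apply: le_trans off1 _; lra.
by have [] := good_run n0 g0 eps01 tau0 thT (yy w) net1 netP h1 h2 h3 off1' off2 T0 hrun t.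
Qed.

End Success.

Theorem corollary4p3 (R : realType) (model : glm) :
  exists b1 b2 C r : R, [/\ 0 < b1, 0 < b2, 0 < C, 0 < r &
  forall (d k n : nat) (eps rho beta : R) (theta_star : 'cV[R]_d),
    (0 < d)%N -> (0 < k)%N -> (0 < n)%N -> (k <= d)%N ->
    0 < eps < 1 -> 0 < rho < 1 -> 0 < beta ->
    Theta k theta_star ->
    C * Phi b1 b2 k beta eps * logfactor d beta eps rho `^ r <= n%:R ->
  forall (disp : measure_display) (Omega : measurableType disp)
    (P : probability Omega R)
    (X : Omega -> 'M[R]_(n, d)) (y : Omega -> 'cV[R]_n)
    (theta0 : Omega -> 'cV[R]_d),
    iid_gaussian_mx P X ->
    glm_response P (prob_one model beta) theta_star X y ->
    uniform_init P k X y theta0 ->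
  exists E : set Omega, [/\ measurable E, ((1 - rho)%:E <= P E)%E &
    forall w : Omega, E w ->
    forall theta : nat -> 'cV[R]_d, biht_run k (X w) (y w) (theta0 w) theta ->
      (forall t : nat, l2norm (theta_star - theta t) <=
                       2 `^ (2 ^- t) * eps `^ (1 - 2 ^- t)) /\
      (limn_esup (fun t => (l2norm (theta_star - theta t))%:E) <= eps%:E)%E]].
Proof.
(* The thresholds are those of [Phi_ge], and C is 8 cT^2 cQ cH with the constants of
   [biht_success]. *)
exists 1, 1, (8 * (600 ^+ 2 * (20 * 18 ^+ 3) * 283)), 4; split.
- by [].
- by [].
- have pos (a b c u v : R) : 0 < a -> 0 < b -> 0 < c -> 0 < u -> 0 < v ->
      0 < a * (b ^+ 2 * (c * u ^+ 3) * v).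
    by move=> *; rewrite !mulr_gt0// exprn_gt0.
  by apply: pos; rewrite ltr0n.
- by [].
move=> d k n eps rho beta th d0 k0 n0 kd eps01 rho01 beta0 thT n_ge disp Omega P X y theta0 gX yp init.
have [_ _ _ L1] := scale_bounds d0 eps01 rho01 beta0.
have n_ge' := n_ge.
(* The real power agrees with the integer one because L >= 1 is nonnegative. *)
rewrite (_ : _ `^ 4 = logfactor d beta eps rho ^+ 4) in n_ge'; last first.
  by rewrite powR_mulrn//; lra.
have [E [mE PE hE]] := biht_success d0 k0 n0 eps01 rho01 beta0 thT gX yp
  (erefl _) (erefl _) (erefl _) (erefl _) n_ge'.
have [_ T0 _ _] := init.
exists E; split=> // w Ew theta hrun; have h := hE w Ew _ _ (T0 w) hrun.
by split=> //; exact: limn_esup_err.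
Qed.
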